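(* Let $f_0(\theta,v)=F(e_0(\theta,v))$, $e_0(\theta,v)=\frac{v^2}{2}+\phi_0(\theta)$, $\phi_0(\theta)=-m_0\cos\theta$ with $m_0>0$, be a steady state such that $\phi_{f_0}=\phi_0$, satisfying Assumption A and the stability criterion $\kappa_0<1$ (both stated in the context). Then there exist $\delta>0$ and a constant $C>0$ depending only on $f_0$ such that, for all nonnegative $f\in L^1((1+|v|^2)\,d\theta\,dv)$ satisfying $|M_f-M_{f_0(\cdot-\theta_f)}|<\delta$, where $\theta_f\in\mathbb T$ is defined by $M_f=|M_f|(\cos\theta_f,\sin\theta_f)^T$, one has $$\|f-f_0(\cdot-\theta_f)\|_{L^1}^2\le C\Big(\mathcal H(f)-\mathcal H(f_0)+C(1+\|f\|_{L^1})\|f^*-f_0^*\|_{L^1}+C\int_0^{+\infty}s^2\big(f_0^\sharp(s)-f^\sharp(s)\big)_+ds+C\int_0^{+\infty}\mu_{f_0}(s)^2\beta_{f^*,f_0^*}(s)\,ds\Big),$$ where $\beta_{f^*,f_0^*}(s)=\big|\{(\theta,v)\in\mathbb T\times\mathbb R: f^*(\theta,v)\le s<f_0^*(\theta,v)\}\big|$ for all $s\ge 0$. In particular, if $f_0$ is compactly supported, this reduces to $$\|f-f_0(\cdot-\theta_f)\|_{L^1}^2\le C\Big(\mathcal H(f)-\mathcal H(f_0)+C(1+\|f\|_{L^1})\|f^*-f_0^*\|_{L^1}\Big).$$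
   Context: $\mathbb T=[0,2\pi]$ is the flat torus; $x_+=\max(0,x)$; $|A|$ is the Lebesgue measure of a set $A$; $L^1$ norms of functions of $(\theta,v)$ are over $\mathbb T\times\mathbb R$. For $f\in L^1((1+|v|^2)\,d\theta\,dv)$ set $\rho_f(\theta)=\int_{\mathbb R}f(\theta,v)\,dv$, $\phi_f(\theta)=-\int_0^{2\pi}\rho_f(\theta')\cos(\theta-\theta')\,d\theta'$, magnetization $M_f=\int_0^{2\pi}\rho_f(\theta)(\cos\theta,\sin\theta)^T d\theta\in\mathbb R^2$, and energy $\mathcal H(f)=\frac12\iint v^2f\,d\theta\,dv-\frac12|M_f|^2$. The translate is $f_0(\cdot-\theta_f)(\theta,v)=f_0(\theta-\theta_f,v)$ (with $2\pi$-periodicity in $\theta$). Rearrangements. For nonnegative $f\in L^1(\mathbb T\times\mathbb R)$: $\mu_f(s)=|\{(\theta,v)\in\mathbb T\times\mathbb R: f(\theta,v)>s\}|$ for $s\ge0$; $f^\sharp(s)=\inf\{t\ge0:\mu_f(t)\le s\}$ for $s\ge0$; $f^*(\theta,v)=f^\sharp\big(|B(0,\sqrt{\theta^2+v^2})\cap(\mathbb T\times\mathbb R)|\big)$, where $B(0,R)$ is the open ball of $\mathbb R^2$ centered at $0$ of radius $R$. Assumption A (on $F$ and $f_0$). $F$ is a $\mathcal C^0$ function on $\mathbb R$; there is $e_*\in\mathbb R\cup\{+\infty\}$ such that $F$ is $\mathcal C^1$ on $(-\infty,e_* )$ with $F'<0$ there; $F(e)=0$ for $e\ge e_*$ if $e_*$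 is finite, and $\lim_{e\to+\infty}F(e)=0$ if $e_*=+\infty$. The inverse $F^{-1}$ is $\mathcal C^1$ from $(0,\sup F)$ onto $(-\infty,e_* )$. The function $f_0$ belongs to $L^1((1+|v|^2)\,d\theta\,dv)$. Moreover, if $e_*<+\infty$ and $m_0=e_*$, then $\int_{-m_0}^{m_0}\log(m_0-e)F'(e)\,de<+\infty$. ($f_0$ is compactly supported if and only if $e_*<+\infty$.) Stability criterion: $\kappa_0<1$, where $$\kappa_0=\int_0^{2\pi}\!\!\int_{-\infty}^{+\infty}|F'(e_0(\theta,v))|\left(\frac{\int_{\mathcal D}(\cos\theta-\cos\theta')(e_0(\theta,v)-\phi_0(\theta'))^{-1/2}d\theta'}{\int_{\mathcal D}(e_0(\theta,v)-\phi_0(\theta'))^{-1/2}d\theta'}\right)^2 d\theta\,dv,$$ with $\mathcal D=\mathcal D(\theta,v)=\{\theta'\in\mathbb T:\phi_0(\theta')<e_0(\theta,v)\}$. *)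

(* Defs.v *)
From HB Require Import structures.
From mathcomp Require Import all_boot all_order all_algebra.
From mathcomp Require Import all_classical all_reals all_analysis.

Set Implicit Arguments.
Unset Strict Implicit.
Unset Printing Implicit Defensive.

Import Order.TTheory GRing.Theory Num.Theory.
Import numFieldNormedType.Exports.

Local Open Scope classical_set_scope.
Local Open Scope ring_scope.

Section phase_space.
Context {R : realType}.

Definition torus : set R := `[0, 2 * pi].

(* A phase-space function of (theta, v) is a total function on R * R; apart
   from the translates of a function that is 2 pi-periodic in theta, only its
   values on the strip matter. *)
Definition strip : set (R * R) := torus `*` [set: R].

Definition leb : {measure set (measurableTypeR R) -> \bar R} :=
  @lebesgue_measure R.

Definition leb2 :
    {measure set (measurableTypeR R * measurableTypeR R) -> \bar R} :=
  (@lebesgue_measure R \x @lebesgue_measure R)%E.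

(* L^1((1 + v^2) dtheta dv) *)
Definition weightedL1 (f : R * R -> R) : Prop :=
  leb2.-integrable strip (fun x => ((1 + x.2 ^+ 2) * f x)%:E).

Definition nonnegative (f : R * R -> R) : Prop :=
  {ae leb2, forall x, strip x -> 0 <= f x}.

(* Extended-real valued, because f^* may be infinite at the origin. *)
Definition norm1 (f : R * R -> \bar R) : \bar R :=
  (\int[leb2]_(x in strip) `|f x|)%E.

Definition euclid (a : R * R) : R := Num.sqrt (a.1 ^+ 2 + a.2 ^+ 2).

End phase_space.

Section hmf.
Context {R : realType}.
Implicit Type f : R * R -> R.

Definition density f (theta : R) : R := \int[leb]_v f (theta, v).

Definition potential f (theta : R) : R :=
  - \int[leb]_(theta' in torus) (density f theta' * cos (theta - theta')).

Definition magnetization f : R * R :=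
  (\int[leb]_(theta in torus) (density f theta * cos theta),
   \int[leb]_(theta in torus) (density f theta * sin theta)).

Definition energy f : R :=
  2^-1 * \int[leb2]_(x in strip) (x.2 ^+ 2 * f x)
  - 2^-1 * euclid (magnetization f) ^+ 2.

Definition translate f (theta : R) : R * R -> R :=
  fun x => f (x.1 - theta, x.2).

End hmf.

Section rearrangement.
Context {R : realType}.
Implicit Type f : R * R -> R.

Definition distribution_function f (s : R) : \bar R :=
  leb2 [set x | strip x /\ s < f x].

(* The infimum is taken in \bar R: it is +oo when the set is empty, which can
   only happen at s = 0. *)
Definition sharp f (s : R) : \bar R :=
  ereal_inf [set t%:E | t in
    [set t : R | 0 <= t /\ (distribution_function f t <= s%:E)%E]].

Definition disc (r : R) : set (R * R) := [set x | euclid x < r].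

(* The disc has finite measure, so that fine loses nothing. *)
Definition rearr f (x : R * R) : \bar R :=
  sharp f (fine (leb2 (disc (euclid x) `&` strip))).

Definition beta (g h : R * R -> \bar R) (s : R) : \bar R :=
  leb2 [set x | [/\ strip x, (g x <= s%:E)%E & (s%:E < h x)%E]].

End rearrangement.

Section steady_state.
Context {R : realType}.

Definition phi0 (m0 theta : R) : R := - m0 * cos theta.

Definition e0 (m0 : R) (x : R * R) : R := x.2 ^+ 2 / 2 + phi0 m0 x.1.

(* f is C^1 on the set A; meant for open sets A. *)
Definition C1_on (A : set R) (F : R -> R) : Prop :=
  forall x, A x -> derivable F x 1 /\ {for x, continuous (derive1 F)}.

Definition lt_set (a : \bar R) : set R := [set e | (e%:E < a)%E].

(* The open interval (0, sup F), where sup F may be +oo. *)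
Definition value_set (F : R -> R) : set R :=
  [set y | 0 < y /\ (y%:E < ereal_sup (range (EFin \o F)))%E].

Record profile_with_cutoff (F : R -> R) (estar : \bar R) : Prop := {
  cutoff_gtNy : (-oo < estar)%E;
  profile_continuous : continuous F;
  profile_C1 : C1_on (lt_set estar) F;
  profile_derive_lt0 : forall e, lt_set estar e -> derive1 F e < 0;
  profile_eq0 : forall e, (estar <= e%:E)%E -> F e = 0;
  profile_cvg0 : estar = +oo%E -> F e @[e --> +oo] --> (0 : R);
  profile_inverse : exists G : R -> R,
    [/\ set_bij (value_set F) (lt_set estar) G,
        {in value_set F, cancel G F} &
        C1_on (value_set F) G]
}.

Definition assumptionA (F : R -> R) (m0 : R) (f0 : R * R -> R) : Prop :=
  exists estar : \bar R,
    [/\ profile_with_cutoff F estar,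
        weightedL1 f0 &
        estar = m0%:E ->
        (\int[leb]_(e in `](- m0)%R, m0[%classic)
           (ln (m0 - e) * derive1 F e)%:E < +oo)%E].

Definition wells (m0 : R) (x : R * R) : set R :=
  [set theta' | torus theta' /\ phi0 m0 theta' < e0 m0 x].

Definition inv_speed (m0 : R) (x : R * R) (theta' : R) : R :=
  (e0 m0 x - phi0 m0 theta') `^ (- 2^-1).

(* On the null sets e0 = m0, where the integrals over the wells diverge, and
   e0 = - m0, where the wells are empty, the quotient has a junk value. *)
Definition kappa0 (F : R -> R) (m0 : R) : \bar R :=
  (\int[leb2]_(x in strip)
    (`|derive1 F (e0 m0 x)| *
     ((\int[leb]_(theta' in wells m0 x)
         ((cos x.1 - cos theta') * inv_speed m0 x theta')) /
      (\int[leb]_(theta' in wells m0 x) inv_speed m0 x theta')) ^+ 2)%R%:E)%E.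

Definition compactly_supported (f : R * R -> R) : Prop :=
  compact (closure [set x | strip x /\ f x != 0]).

End steady_state.

(* Main.v *)
Require Import Defs.
From HB Require Import structures.
From mathcomp Require Import all_boot all_order all_algebra.
From mathcomp Require Import all_classical all_reals all_analysis.
From mathcomp Require Import measurable_realfun simple_functions.
From mathcomp Require Import measurable_fun_approximation.
From mathcomp Require Import lra ring.

Set Implicit Arguments.
Unset Strict Implicit.
Unset Printing Implicit Defensive.

Import Order.TTheory GRing.Theory Num.Theory.
Import numFieldNormedType.Exports.
Local Open Scope classical_set_scope.
Local Open Scope ring_scope.

(** Let [g] be the translate of [f0] by [thetaf], and measure the energy of a
    particle in the potential of [g] from the bottom of the well:
    [eps = v^2 / 2 + m0 (1 - cos (theta - thetaf))]. Since [F] decreases, the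
    superlevels of [g] are sublevels of the energy, [s < g] iff
    [eps < eta s]. Functions are compared value by value, through the transport
    cost
      [T] = the integral over [s > 0] of [|eps - eta s|] over the symmetric
            difference of the superlevels of [f] and [g] at [s].
    Write [h = |M_f| - m0], [H] for the difference of the energies of [f] and
    [f0], and [D] for the [L^1] distance of their distribution functions.

    The cost is controlled by the energy. The integral of [eps (f - g)] is at
    least [T] up to a change of the volumes of the superlevels, and it equals
    [H + h^2 / 2] up to a multiple of the difference of the masses
    ([transport_energy], [energy_balance]); hence [T <= H + h^2 / 2 + c D + W],
    where [W] integrates [mu_f0^2 (mu_f0 - mu_f)_+], because a superlevel that
    reaches high is large ([height_level_le]).

    The quadratic term, which has the wrong sign, is absorbed by the stability
    criterion. Displacing the levels of [g] by [t (1 + cos)], recentred by its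
    average over each orbit, changes [f - g] at first order by [t h], and by
    convexity [t h <= T + r(t) + c |t| D] with a second order remainder [r(t)]
    ([transport_test]). Integrated in the velocity, the remainder is asymptotic
    to [t^2 / 2] times the variance of the cosine over the orbits
    ([integral_excess_curvature]), which is at most [kappa0]
    ([orbit_variance_le_kappa0]). Hence [r(t) <= q t^2] with [q < 1 / 2] for
    small [t] ([quadratic_excess]); the limit is taken by dominated convergence,
    and what makes the dominating function integrable is the condition on the
    logarithm at the separatrix ([integral_period_level]). Taking [t = h], which
    is small by hypothesis, [(1/2 - q) h^2] is bounded by the right-hand side.

    The cost controls the distance. The part of a superlevel of [g] that [f]
    misses is at an energy distance at least [k] from the boundary, but for a
    shell whose volume is of order [k]; therefore
    [k |(g - f)_+|_1 <= T + K k^2] for every [k > 0] ([transport_defect],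
    [shell_bound]). The best choice of [k] bounds the square of [|(g - f)_+|_1]
    by a multiple of [T], and [|f - g|_1] differs from twice this norm by at most
    [D] ([dist_le_defect]). These estimates add up to [stability_estimate].

    It remains to pass to rearrangements. The volume of the disc through a point
    is uniformly distributed over the positive half-line ([disc_volume_lt]), and
    [s < f^*] means that this volume is less than [mu_f s] ([lt_rearr]). So [D]
    is at most the distance of [f^*] and [f0^*] ([tail_dist_le_rearr]) and [beta]
    is at least [(mu_f0 - mu_f)_+] ([beta_ge]). When [f0] has compact support,
    [mu_f0] is bounded and [W] is at most a multiple of [D]. *)

(** * Decreasing changes of variables for nonnegative measurable functions *)

Section density_measure.
Local Open Scope ereal_scope.
Context d (T : measurableType d) (R : realType) (mu : {measure set T -> \bar R}).

Definition with_density (h : {mfun T >-> R}) (A : set T) : \bar R :=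
  \int[mu]_(x in A) `|h x|%:E.

Section instance.
Variable h : {mfun T >-> R}.

Let mh D : measurable_fun D (fun x => `|h x|%:E : \bar R).
Proof. by apply/measurable_EFinP; apply: measurableT_comp => //; exact: measurable_funTS. Qed.

Let with_density0 : with_density h set0 = 0. Proof. exact: integral_set0. Qed.

Let with_density_ge0 A : 0 <= with_density h A.
Proof. by apply: integral_ge0 => x _; rewrite lee_fin. Qed.

Let with_density_sigma_additive : semi_sigma_additive (with_density h).
Proof.
move=> F mF tF mUF; rewrite /with_density ge0_integral_bigcup//.
apply: is_cvg_ereal_nneg_natsum_cond => n _ _; exact: with_density_ge0.
Qed.

HB.instance Definition _ := isMeasure.Build _ _ _ (with_density h)
  with_density0 with_density_ge0 with_density_sigma_additive.
End instance.

Import HBNNSimple.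

Lemma ge0_integral_with_density (h : {mfun T >-> R}) (g : T -> \bar R) :
  measurable_fun setT g -> (forall x, 0 <= g x) ->
  \int[with_density h]_x g x = \int[mu]_x (`|h x|%:E * g x).
Proof.
move=> mg g0; pose g_ := nnsfun_approx measurableT mg.
have mh : measurable_fun setT (fun x => `|h x|%:E : \bar R).
  by apply/measurable_EFinP; exact: measurableT_comp.
have cg x : (g_ n x)%:E @[n --> \oo] --> g x.
  by apply: cvg_nnsfun_approx => // y _; exact: g0.
have ndg x : {homo (fun n => (g_ n x)%:E) : m n / (m <= n)%N >-> m <= n}.
  by move=> m n mn; rewrite lee_fin; exact/lefP/nd_nnsfun_approx.
transitivity (limn (fun n => \int[with_density h]_x (g_ n x)%:E)).
  rewrite -monotone_convergence//; last first.
  - by move=> n x _; rewrite lee_fin.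
  - by move=> n; exact/measurable_EFinP.
  by apply: eq_integral => x _; apply/esym/cvg_lim.
transitivity (limn (fun n => \int[mu]_x (`|h x|%:E * (g_ n x)%:E))); last first.
  rewrite -monotone_convergence//; last 3 first.
  - by move=> n; apply: emeasurable_funM => //; exact/measurable_EFinP.
  - by move=> n x _; rewrite -EFinM lee_fin mulr_ge0.
  - by move=> x _ m n mn; apply: lee_wpmul2l; rewrite ?lee_fin// -lee_fin; exact: ndg.
  apply: eq_integral => x _; apply/cvg_lim => //.
  by apply: cvgeZl => //; exact: cg.
congr (limn _); apply/funext => n.
transitivity (\sum_(r \in range (g_ n))
    r%:E * with_density h (g_ n @^-1` [set r])).
  under eq_integral do rewrite fimfunE -fsumEFin//.
  rewrite ge0_integral_fsum//; last 2 first.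
  - by move=> r; exact/measurable_EFinP/measurable_funM.
  - by move=> r x _; rewrite nnfun_muleindic_ge0.
  apply: eq_fsbigr => r _; rewrite integralZl_indic_nnsfun//.
  by rewrite integral_indic// setIT.
under [RHS]eq_integral.
  move=> x _; rewrite fimfunE -fsumEFin// ge0_mule_fsumr; last first.
    by move=> r; rewrite EFinM nnfun_muleindic_ge0.
  over.
rewrite ge0_integral_fsum//; last 2 first.
- move=> r; apply: emeasurable_funM => //.
  by apply/measurable_EFinP; exact: measurable_funM.
- by move=> r x _; rewrite EFinM mule_ge0// ?nnfun_muleindic_ge0// lee_fin.
apply: eq_fsbigr => r _.
have [r0|r0] := ltP r 0%R.
  rewrite preimage_nnfun0// measure0 mule0 integral0_eq// => x _.
  by rewrite indic0/= mulr0 mule0.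
under eq_integral do rewrite EFinM muleCA.
rewrite ge0_integralZl//; last first.
  by apply: emeasurable_funM => //; exact/measurable_EFinP.
congr (_ * _); rewrite /with_density integral_mkcond; apply: eq_integral => x _.
by rewrite patchE indicE; case: (x \in _); rewrite ?mule1 ?mule0.
Qed.

Lemma ge0_integral_mrestr (D : set T) (mD : measurable D) (g : T -> \bar R) :
  measurable_fun setT g -> (forall x, 0 <= g x) ->
  \int[mrestr mu mD]_x g x = \int[mu]_(x in D) g x.
Proof.
move=> mg g0.
have m1 : measurable_fun setT (\1_D : T -> R) by exact: measurable_indic.
pose h : {mfun T >-> R} := HB.pack (\1_D : T -> R)
  (isMeasurableFun.Build _ _ _ _ (\1_D : T -> R) m1).
transitivity (\int[with_density h]_x g x).
  apply: eq_measure_integral => A mA _; rewrite /mrestr/= /with_density/=.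
  transitivity (\int[mu]_(x in A) (\1_D x)%:E); first by rewrite integral_indic// setIC.
  by apply: eq_integral => x _; rewrite ger0_norm.
rewrite ge0_integral_with_density// [RHS]integral_mkcond.
apply: eq_integral => x _; rewrite /= patchE indicE.
by case: (_ \in _); rewrite ?normr1 ?normr0 ?mul1e ?mul0e.
Qed.
End density_measure.

Section substitution.
Context {R : realType}.
Local Notation mu := (@lebesgue_measure R).
Implicit Types (a b : R) (phi : R -> R) (g : R -> \bar R).

(** Continuous functions that increase to the indicator of the ray []c, +oo[];
    they carry a change of variables for continuous integrands over to
    measures of rays. *)
Let ramp (c : R) (n : nat) (y : R) : R := Num.min 1 (n%:R * Num.max 0 (y - c)).

Let ramp_ge0 c n y : 0 <= ramp c n y.
Proof. by rewrite /ramp le_min ler01 mulr_ge0// le_max lexx. Qed.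

Let ramp_nd c y : {homo (fun n => ramp c n y) : m n / (m <= n)%N >-> m <= n}.
Proof.
move=> m n mn; rewrite /= /ramp. rewrite le_min !ge_min lexx/=.
have -> /= : m%:R * Num.max 0 (y - c) <= n%:R * Num.max 0 (y - c).
  by rewrite ler_wpM2r ?ler_nat// le_max lexx.
by rewrite orbT.
Qed.

Let ramp_cvg c y : (ramp c n y)%:E @[n --> \oo] --> (\1_(`]c, +oo[%classic) y)%:E.
Proof.
apply: cvg_EFin; first exact: nearW.
have [cy|yc] := ltP c y.
  rewrite indicE mem_set/= ?in_itv/= ?cy//.
  apply: cvg_near_cst.
  exists (Num.bound ((y - c)^-1)) => // n /= bn.
  rewrite /ramp max_r ?subr_ge0 1?ltW//.
  apply/min_idPl; rewrite -ler_pdivrMr ?subr_gt0// mul1r.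
  rewrite ltW// (lt_le_trans (archi_boundP _)) ?ler_nat// invr_ge0 subr_ge0.
  exact: ltW.
rewrite indicE memNset/=; last by rewrite in_itv/= andbT; apply/negP; rewrite -leNgt.
rewrite (_ : _ \o _ = fun=> 0); first exact: cvg_cst.
apply/funext => n; rewrite /= /ramp max_l ?subr_le0// mulr0; apply/min_idPr.
exact: ler01.
Qed.

Let ramp_continuous c n : continuous (ramp c n).
Proof.
move=> x; rewrite /ramp.
apply: (@continuous2_cvg _ R R R (nbhs x) _ (fun=> 1)
  (fun y => n%:R * Num.max 0 (y - c)) (fun u v : R => Num.min u v)).
- exact: (@min_continuous _ R (1, _)).
- exact: cvg_cst.
apply: cvgM; first exact: cvg_cst.
apply: (@continuous2_cvg _ R R R (nbhs x) _ (fun=> 0) (fun y => y - c) (fun u v : R => Num.max u v)).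
- exact: (@max_continuous _ R (0, _)).
- exact: cvg_cst.
- by apply: cvgB; [exact: cvg_id|exact: cvg_cst].
Qed.

Section segment.
Variables (phi : R -> R) (a b : R).
Hypothesis ab : a < b.
Hypothesis dphi : forall x, x \in `[a, b] -> derivable phi x 1.
Hypothesis cphi : forall x, x \in `[a, b] -> {for x, continuous (derive1 phi)}.
Hypothesis phi_lt0 : forall x, x \in `[a, b] -> derive1 phi x < 0.

Let oo_cc x : x \in `]a, b[ -> x \in `[a, b].
Proof. by rewrite !in_itv/= => /andP[? ?]; rewrite !ltW. Qed.

Let cont x : x \in `[a, b] -> {for x, continuous phi}.
Proof. by move=> xab; apply/differentiable_continuous/derivable1_diffP/dphi. Qed.

Let phi_cts : {within `[a, b], continuous phi}.
Proof. by apply: continuous_in_subspaceT => x /[!inE] xab; exact: cont. Qed.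

Lemma segment_decr : {in `[a, b] &, {homo phi : x y /~ (x < y)%R}}.
Proof.
apply: (@ltr0_derive1_lt_cc _ phi a b) => // x xab.
  by apply: dphi; exact: oo_cc.
by apply: phi_lt0; exact: oo_cc.
Qed.

Lemma segment_image : phi @` `[a, b] = `[phi b, phi a]%classic.
Proof.
apply/seteqP; split => y /=.
  move=> [x + <-]; rewrite /= !in_itv/= => /andP[ax xb].
  have aab : a \in `[a, b] by rewrite in_itv/= lexx ltW.
  have bab : b \in `[a, b] by rewrite in_itv/= lexx ltW.
  have xab : x \in `[a, b] by rewrite in_itv/= ax xb.
  apply/andP; split.
    have [->//|xb'] := eqVneq x b.
    by rewrite ltW// segment_decr// lt_neqAle xb xb'.
  have [->//|xa'] := eqVneq x a; rewrite ltW// segment_decr// lt_neqAle ax.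
  by rewrite eq_sym xa'.
rewrite in_itv/= => /andP[by_ ya].
have [|x xab <-] := @IVT _ phi a b y (ltW ab) phi_cts.
  have ba : phi b <= phi a by exact: le_trans ya.
  by rewrite min_r// max_l// by_ ya.
by exists x.
Qed.

Let subst_cts (G : R -> R) : continuous G ->
  (\int[mu]_(x in `[phi b, phi a]) (G x)%:E =
   \int[mu]_(x in `[a, b]) (((G \o phi) * - derive1 phi) x)%:E)%E.
Proof.
move=> cG; apply: integration_by_substitution_decreasing.
- exact: ltW.
- exact: segment_decr.
- by move=> x xab; apply: cphi; exact: oo_cc.
- apply/cvg_ex; exists (derive1 phi a); apply: cvg_at_right_filter; apply: cphi.
  by rewrite in_itv/= lexx ltW.
- apply/cvg_ex; exists (derive1 phi b); apply: cvg_at_left_filter; apply: cphi.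
  by rewrite in_itv/= lexx ltW.
- split.
  + by move=> x xab; apply: dphi; exact: oo_cc.
  + by apply: cvg_at_right_filter; apply: cont; rewrite in_itv/= lexx ltW.
  + by apply: cvg_at_left_filter; apply: cont; rewrite in_itv/= lexx ltW.
- exact: continuous_subspaceT.
Qed.

Let mh : measurable_fun [set: measurableTypeR R] (derive1 phi \_ `[a, b]).
Proof.
apply/(measurable_restrictT _ _).1 => //.
apply: subspace_continuous_measurable_fun => //.
by apply: continuous_in_subspaceT => x /[!inE] xab; exact: cphi.
Qed.

Let mphi1 : measurable_fun [set: measurableTypeR R] (phi \_ `[a, b]).
Proof.
apply/(measurable_restrictT _ _).1 => //.
exact: subspace_continuous_measurable_fun.
Qed.

Let h0 : measurableTypeR R -> R := derive1 phi \_ `[a, b].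
Let h : {mfun measurableTypeR R >-> R} :=
  HB.pack h0 (isMeasurableFun.Build _ _ _ _ h0 mh).
Let phi1 : measurableTypeR R -> measurableTypeR R := phi \_ `[a, b].
Let mphi2 : measurable_fun [set: measurableTypeR R] phi1 := mphi1.
Let m1 : {measure set (measurableTypeR R) -> \bar R} :=
  measure_function_pushforward__canonical__measure_function_Measure
    (with_density mu h) mphi2.
Let m2 : {measure set (measurableTypeR R) -> \bar R} :=
  mrestr mu (measurable_itv `[phi b, phi a]).

Let ray c : m2 `]c, +oo[%classic = m1 `]c, +oo[%classic.
Proof.
have mN : measurable_fun `[a, b] (fun x => (- derive1 phi x)%:E : \bar R).
  apply/measurable_EFinP; apply: measurableT_comp => //.
  by apply/(measurable_restrictT _ _).2 => //; exact: mh.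
have mp : measurable_fun `[a, b] phi.
  by apply/(measurable_restrictT _ _).2 => //; exact: mphi1.
have mramp n : measurable_fun [set: measurableTypeR R] (ramp c n).
  by apply: continuous_measurable_fun.
transitivity (\int[mu]_(x in `[phi b, phi a]) (\1_(`]c, +oo[%classic) x)%:E)%E.
  by rewrite integral_indic//= setIC.
transitivity (\int[mu]_(x in `[a, b])
   ((\1_(`]c, +oo[%classic) (phi x))%:E * (- derive1 phi x)%:E))%E.
  transitivity (limn (fun n => \int[mu]_(x in `[phi b, phi a]) (ramp c n x)%:E)%E).
    rewrite -monotone_convergence//.
    - by apply: eq_integral => x _; apply/esym/cvg_lim => //; exact: ramp_cvg.
    - by move=> n; apply/measurable_EFinP; exact: measurable_funTS.
    - by move=> n x _; rewrite lee_fin.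
    - by move=> x _ m n mn; rewrite lee_fin; exact: ramp_nd.
  under eq_fun do rewrite subst_cts//.
  rewrite -monotone_convergence//.
  - apply: eq_integral => x xab; apply/cvg_lim => //=.
    under eq_fun do rewrite EFinM.
    by apply: cvgeZr => //; exact: ramp_cvg.
  - move=> n; apply/measurable_EFinP; apply: measurable_funM; last exact/measurable_EFinP.
    have mrampR : measurable_fun [set: R] (ramp c n) by exact: mramp.
    exact: (measurableT_comp mrampR mp).
  - move=> n x xab; rewrite lee_fin mulr_ge0 ?ramp_ge0//.
    by rewrite oppr_ge0 ltW// phi_lt0.
  - move=> x xab m n mn; rewrite lee_fin ler_wpM2r ?ramp_nd//.
    by rewrite oppr_ge0 ltW// phi_lt0.
rewrite /m1/= /pushforward /with_density [LHS]integral_mkcond [RHS]integral_mkcond.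
apply: eq_integral => x _; rewrite !patchE.
have [xab|xab] := boolP (x \in `[a, b]%classic).
  rewrite /phi1 /h/= /h0 [in RHS]patchE xab.
  have -> : (x \in (phi \_ `[a, b]) @^-1` `]c, +oo[) = (phi x \in `]c, +oo[%classic).
    by apply/idP/idP; rewrite !inE/= patchE xab.
  rewrite indicE; case: (_ \in _); rewrite ?mul1e ?mul0e//.
  by rewrite ltr0_norm//; apply: phi_lt0; rewrite inE in xab.
by case: ifP => // _; rewrite /h/= /h0 patchE (negbTE xab) normr0.
Qed.

Let m12 Y : measurable Y -> m2 Y = m1 Y.
Proof.
apply: (@measure_unique _ R (measurableTypeR R) (@RGenOInfty.G R) (fun n => `]- n%:R, +oo[%classic)).
- exact: RGenOInfty.measurableE.
- move=> _ _ [x ->] [y ->]; exists (Num.max x y).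
  by apply/seteqP; split => z /=; rewrite !in_itv/= !andbT gt_max => /andP.
- by move=> i; exists (- i%:R).
- apply/seteqP; split => // x _; exists (Num.bound `|x|) => //=.
  by rewrite in_itv/= andbT ltrNl (le_lt_trans (ler_norm _))// normrN; exact: archi_boundP.
- by move=> _ [x ->]; exact: ray.
move=> k; rewrite /m2/= /mrestr.
apply: (@le_lt_trans _ _ (mu `[phi b, phi a]%classic)).
  by apply: le_measure; rewrite ?inE//; exact: measurableI.
rewrite lebesgue_measure_itv/=; case: ifP => _; last exact: ltry.
by rewrite -EFinB ltry.
Qed.

(** The image under [phi] of the density [|phi'|] and Lebesgue measure agree on
    rays, hence on all Borel sets, so that the integrand need not be
    continuous. *)
Lemma ge0_substitution_segment g : measurable_fun setT g -> (forall y, (0 <= g y)%E) ->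
  (\int[mu]_(y in `[phi b, phi a]) g y =
   \int[mu]_(x in `[a, b]) (`|derive1 phi x|%:E * g (phi x)))%E.
Proof.
move=> mg g0.
transitivity (\int[m2]_y g y)%E.
  by rewrite ge0_integral_mrestr.
transitivity (\int[m1]_y g y)%E.
  by apply: eq_measure_integral => A mA _; exact: m12.
rewrite ge0_integral_pushforward//=.
rewrite preimage_setT ge0_integral_with_density//; last exact: measurableT_comp.
rewrite [RHS]integral_mkcond; apply: eq_integral => x _.
rewrite patchE /h/= /h0 /phi1 !patchE; case: ifP => // _.
by rewrite normr0 mul0e.
Qed.
End segment.

(** An open interval with extended real bounds is exhausted by segments. *)
Let lo_ (l : \bar R) (n : nat) : R := if l is r%:E then r + n.+1%:R^-1 else - n%:R.
Let hi_ (h : \bar R) (n : nat) : R := if h is r%:E then r - n.+1%:R^-1 else n%:R.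

Let lo_noninc l m n : (m <= n)%N -> lo_ l n <= lo_ l m.
Proof.
case: l => [r| |]/= mn; rewrite ?lerN2 ?ler_nat//.
by rewrite lerD2l lef_pV2 ?posrE// ler_nat.
Qed.

Let hi_nondec h m n : (m <= n)%N -> hi_ h m <= hi_ h n.
Proof.
case: h => [r| |]/= mn; rewrite ?ler_nat//.
by rewrite lerD2l lerN2 lef_pV2 ?posrE// ler_nat.
Qed.

Let exhaust (l h : \bar R) : (l < +oo)%E -> (-oo < h)%E ->
  [set x : R | (l < x%:E)%E /\ (x%:E < h)%E] = \bigcup_n `[lo_ l n, hi_ h n]%classic.
Proof.
move=> ly hNy; apply/seteqP; split => x /=.
  move=> [lx xh].
  have [n1 n1P] : exists n, forall k, (n <= k)%N -> lo_ l k <= x.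
    case: l lx ly => [r| |]//= rx _.
      rewrite lte_fin in rx.
      exists (Num.bound ((x - r)^-1)) => k bk; rewrite -lerBrDl.
      rewrite -[leRHS]invrK lef_pV2 ?posrE ?invr_gt0 ?subr_gt0//.
      rewrite ltW// (lt_le_trans (archi_boundP _)) ?invr_ge0 ?subr_ge0 ?(ltW rx)//.
      by rewrite ler_nat (leq_trans bk).
    exists (Num.bound `|x|) => k bk; rewrite lerNl (le_trans (ler_norm _))// normrN.
    by rewrite ltW// (lt_le_trans (archi_boundP _))// ler_nat.
  have [n2 n2P] : exists n, forall k, (n <= k)%N -> x <= hi_ h k.
    case: h xh hNy => [r| |]//= xr _.
      rewrite lte_fin in xr.
      exists (Num.bound ((r - x)^-1)) => k bk; rewrite lerBrDl -lerBrDr.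
      rewrite -[leRHS]invrK lef_pV2 ?posrE ?invr_gt0 ?subr_gt0//.
      rewrite ltW// (lt_le_trans (archi_boundP _)) ?invr_ge0 ?subr_ge0 ?(ltW xr)//.
      by rewrite ler_nat (leq_trans bk).
    exists (Num.bound `|x|) => k bk; rewrite (le_trans (ler_norm _))//.
    by rewrite ltW// (lt_le_trans (archi_boundP _))// ler_nat.
  exists (maxn n1 n2) => //=.
  by rewrite in_itv/= n1P ?n2P// ?leq_maxl ?leq_maxr.
move=> [n _]; rewrite /= in_itv/= => /andP[lx xh]; split.
  case: l lx ly => [r| |]//= rx _; last by rewrite ltNyr.
  by rewrite lte_fin (lt_le_trans _ rx)// ltrDl invr_gt0.
case: h xh hNy => [r| |]//= xr _; last by rewrite ltry.
by rewrite lte_fin (le_lt_trans xr)// gtrDl oppr_lt0 invr_gt0.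
Qed.

Lemma ge0_substitution_decr phi g (l h : \bar R)
    (U := [set x : R | (l < x%:E)%E /\ (x%:E < h)%E]) :
  (l < +oo)%E -> (-oo < h)%E ->
  (forall x, U x -> derivable phi x 1) ->
  (forall x, U x -> {for x, continuous (derive1 phi)}) ->
  (forall x, U x -> derive1 phi x < 0) ->
  measurable_fun setT g -> (forall y, (0 <= g y)%E) ->
  (\int[mu]_(y in phi @` U) g y =
   \int[mu]_(x in U) (`|derive1 phi x|%:E * g (phi x)))%E.
Proof.
move=> ly hNy dphi cphi phi_lt0 mg g0.
have UE : U = \bigcup_n `[lo_ l n, hi_ h n]%classic by exact: exhaust.
have subU n x : x \in `[lo_ l n, hi_ h n] -> U x by move=> xn; rewrite UE; exists n.
have nd : nondecreasing_seq (fun n => `[lo_ l n, hi_ h n]%classic).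
  move=> m n mn; apply/subsetPset => x; rewrite /= !in_itv/= => /andP[lx xh].
  by rewrite (le_trans (lo_noninc _ mn))// (le_trans xh)//; exact: hi_nondec.
have seg n : lo_ l n < hi_ h n ->
    phi @` `[lo_ l n, hi_ h n] = `[phi (hi_ h n), phi (lo_ l n)]%classic.
  move=> lh; apply: segment_image => // x /subU; [exact: dphi|exact: phi_lt0].
have seg0 n : lo_ l n > hi_ h n -> `[lo_ l n, hi_ h n]%classic = set0.
  by move=> hl; rewrite set_itv_ge// bnd_simp -ltNge.
have mimg n : measurable (phi @` `[lo_ l n, hi_ h n] : set (measurableTypeR R)).
  have [/seg -> //|/seg0 ->|->] := ltgtP (lo_ l n) (hi_ h n).
  - by rewrite image_set0.
  - by rewrite set_itv1 image_set1; exact: measurable_set1.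
have cU x : U x -> {for x, continuous phi}.
  by move=> Ux; apply/differentiable_continuous/derivable1_diffP/dphi.
have mF n : measurable_fun (`[lo_ l n, hi_ h n] : set (measurableTypeR R))
   (fun x => `|derive1 phi x|%:E * g (phi x))%E.
  apply: emeasurable_funM.
    apply/measurable_EFinP; apply: measurableT_comp => //.
    apply: subspace_continuous_measurable_fun => //.
    by apply: continuous_in_subspaceT => x /[!inE] /subU; exact: cphi.
  have mp : measurable_fun `[lo_ l n, hi_ h n] phi.
    apply: subspace_continuous_measurable_fun => //.
    by apply: continuous_in_subspaceT => x /[!inE] /subU; exact: cU.
  exact: (measurableT_comp mg mp).
rewrite {1}UE image_bigcup [in RHS]UE.
have H1 := @ge0_nondecreasing_set_cvg_integral _ (measurableTypeR R) R
  (fun n => phi @` `[lo_ l n, hi_ h n]) g mu.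
have H2 := @ge0_nondecreasing_set_cvg_integral _ (measurableTypeR R) R
  (fun n => `[lo_ l n, hi_ h n]%classic) (fun x => `|derive1 phi x|%:E * g (phi x))%E mu.
have mgs D : measurable_fun (D : set (measurableTypeR R)) g by exact: measurable_funTS.
have ndi : nondecreasing_seq (fun n => phi @` `[lo_ l n, hi_ h n]).
  by move=> m n mn; apply/subsetPset; apply: image_subset; exact/subsetPset/nd.
have {}H1 := H1 ndi mimg (fun n => mgs _) (fun _ y _ => g0 y).
have E n : (\int[mu]_(x in phi @` `[lo_ l n, hi_ h n]) g x =
    \int[mu]_(x in `[lo_ l n, hi_ h n]) (`|derive1 phi x|%:E * g (phi x)))%E.
  have [lh|/seg0 ->|->] := ltgtP (lo_ l n) (hi_ h n).
  - by rewrite seg// ge0_substitution_segment// => x /subU; [exact: dphi|exact: cphi|exact: phi_lt0].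
  - by rewrite image_set0 !integral_set0.
  - by rewrite set_itv1 image_set1 !integral_set1.
rewrite (funext E) in H1.
apply: (cvg_unique _ H1) => //.
by apply: H2 => // n x _; rewrite mule_ge0.
Qed.
End substitution.

(** * Iterated integrals over rectangles *)

Section tonelli_on.
Local Open Scope ereal_scope.
Context d1 d2 (T1 : measurableType d1) (T2 : measurableType d2) (R : realType).
Variable m1 : {sigma_finite_measure set T1 -> \bar R}.
Variable m2 : {sigma_finite_measure set T2 -> \bar R}.
Variables (A : set T1) (B : set T2).
Hypotheses (mA : measurable A) (mB : measurable B).
Variable f : T1 * T2 -> \bar R.
Hypothesis mf : measurable_fun setT f.
Hypothesis f0 : forall z, 0 <= f z.

Let h := f \_ (A `*` B).

Let mh : measurable_fun setT h.
Proof.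
apply/(measurable_restrictT _ _).1; first exact: measurableX.
exact: measurable_funTS.
Qed.

Let h0 z : 0 <= h z. Proof. by rewrite /h patchE; case: ifP. Qed.

Let hE x y : h (x, y) = (if x \in A then (fun y => f (x, y)) \_ B else cst 0) y.
Proof.
rewrite /h patchE in_setX/=.
by case: (boolP (x \in A)) => //= xA; rewrite patchE.
Qed.

Let FE : (fun x => \int[m2]_y h (x, y)) =
  (fun x => \int[m2]_(y in B) f (x, y)) \_ A.
Proof.
apply/funext => x; rewrite patchE; under eq_integral do rewrite hE.
by case: ifP => _; [rewrite -integral_mkcond|rewrite integral0].
Qed.

Let GE : (fun y => \int[m1]_x h (x, y)) =
  (fun y => \int[m1]_(x in A) f (x, y)) \_ B.
Proof.
apply/funext => y; rewrite patchE.
transitivity (\int[m1]_x (if y \in B then (fun x => f (x, y)) \_ A else cst 0) x).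
  apply: eq_integral => x _; rewrite hE.
  by case: ifP => xA; case: ifP => yB; rewrite ?patchE ?xA ?yB.
by case: ifP => _; [rewrite -integral_mkcond|rewrite integral0].
Qed.

Lemma tonelli_on1 :
  \int[m1 \x m2]_(z in A `*` B) f z = \int[m1]_(x in A) \int[m2]_(y in B) f (x, y).
Proof.
rewrite integral_mkcond -/h (fubini_tonelli1 h mh h0) /fubini_F.
by rewrite [in LHS]FE -integral_mkcond.
Qed.

Lemma tonelli_on2 :
  \int[m1 \x m2]_(z in A `*` B) f z = \int[m2]_(y in B) \int[m1]_(x in A) f (x, y).
Proof.
rewrite integral_mkcond -/h (fubini_tonelli2 h mh h0) /fubini_G.
by rewrite [in LHS]GE -integral_mkcond.
Qed.

Lemma tonelli_on :
  \int[m1]_(x in A) \int[m2]_(y in B) f (x, y) =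
  \int[m2]_(y in B) \int[m1]_(x in A) f (x, y).
Proof. by rewrite -tonelli_on1 tonelli_on2. Qed.
End tonelli_on.

Section measurable_sections.
Local Open Scope ereal_scope.
Context d1 d2 (T1 : measurableType d1) (T2 : measurableType d2) (R : realType).

Lemma measurable_integral_sectionr (m2 : {sigma_finite_measure set T2 -> \bar R})
    (B : set T2) (f : T1 * T2 -> \bar R) : measurable B ->
  measurable_fun setT f -> (forall z, 0 <= f z) ->
  measurable_fun setT (fun x => \int[m2]_(y in B) f (x, y)).
Proof.
move=> mB mf f0.
pose h := f \_ (setT `*` B).
have mh : measurable_fun setT h.
  apply/(measurable_restrictT _ _).1; first exact: measurableX.
  exact: measurable_funTS.
have h0 z : 0 <= h z by rewrite /h patchE; case: ifP.
rewrite (_ : (fun _ => _) = (fun x => \int[m2]_y h (x, y))); last first.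
  apply/funext => x; rewrite integral_mkcond; apply: eq_integral => y _.
  by rewrite /h !patchE in_setX in_setT.
exact: (measurable_fun_fubini_tonelli_F h mh h0).
Qed.

Lemma measurable_integral_sectionl (m1 : {sigma_finite_measure set T1 -> \bar R})
    (A : set T1) (f : T1 * T2 -> \bar R) : measurable A ->
  measurable_fun setT f -> (forall z, 0 <= f z) ->
  measurable_fun setT (fun y => \int[m1]_(x in A) f (x, y)).
Proof.
move=> mA mf f0.
pose h := f \_ (A `*` setT).
have mh : measurable_fun setT h.
  apply/(measurable_restrictT _ _).1; first exact: measurableX.
  exact: measurable_funTS.
have h0 z : 0 <= h z by rewrite /h patchE; case: ifP.
rewrite (_ : (fun _ => _) = (fun y => \int[m1]_x h (x, y))); last first.
  apply/funext => y; rewrite integral_mkcond; apply: eq_integral => x _.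
  by rewrite /h !patchE in_setX in_setT andbT.
exact: (measurable_fun_fubini_tonelli_G h mh h0).
Qed.
End measurable_sections.

(** * The distribution of the kinetic energy *)

Section one_dim.
Context {R : realType}.
Local Notation mu := (@lebesgue_measure R).
Implicit Types (g : R -> \bar R).

Lemma ge0_integral_reflect g (c : R) :
  measurable_fun setT g -> (forall y, (0 <= g y)%E) ->
  (\int[mu]_x g (c - x)%R = \int[mu]_x g x)%E.
Proof.
move=> mg g0.
have D (x : R) : is_derive x 1 (fun x => c - x) (-1).
  have := @is_deriveB _ _ _ (cst c) id x 1 0 1 (is_derive_cst _ _ _) (is_derive_id _ _).
  by rewrite sub0r.
have D1 : derive1 (fun x : R => c - x) = cst (-1).
  by apply/funext => x; rewrite derive1E; apply: derive_val.
have := @ge0_substitution_decr _ (fun x : R => c - x) g -oo%E +oo%E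
  erefl erefl _ _ _ mg g0.
rewrite D1 (_ : [set x | _] = setT); last first.
  by apply/seteqP; split => // x _; rewrite /= ltNyr ltry.
rewrite (_ : _ @` _ = setT); last first.
  by apply/seteqP; split => // x _; exists (c - x) => //; lra.
move=> ->//.
- by apply: eq_integral => x _; rewrite normrN normr1 mul1e.
- by move=> x _; exact: cvg_cst.
- by move=> x _; rewrite /= ltrN10.
Qed.

Lemma ge0_integral_translate g (c : R) :
  measurable_fun setT g -> (forall y, (0 <= g y)%E) ->
  (\int[mu]_x g (x - c)%R = \int[mu]_x g x)%E.
Proof.
move=> mg g0; rewrite -(ge0_integral_reflect c mg g0).
rewrite -[RHS](@ge0_integral_reflect (fun x => g (c - x)) (c + c)) //; last first.
  by apply: measurableT_comp => //; exact: measurable_funB.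
by apply: eq_integral => x _; congr g; lra.
Qed.

(** The weight of the one-dimensional inverse square root singularities; it
    vanishes on the negative half-line. *)
Definition isq (y : R) : R := (Num.sqrt y)^-1.

Lemma isq_ge0 y : 0 <= isq y. Proof. by rewrite invr_ge0 sqrtr_ge0. Qed.

Lemma isq_le0 y : y <= 0 -> isq y = 0.
Proof. by move=> y0; rewrite /isq ler0_sqrtr// invr0. Qed.

Lemma isq_gt0 y : 0 < y -> 0 < isq y.
Proof. by move=> y0; rewrite invr_gt0 sqrtr_gt0. Qed.

Lemma sqr_isq y : isq y ^+ 2 = (Num.max 0 y)^-1.
Proof.
rewrite /isq exprVn; have [y0|y0] := leP 0 y; first by rewrite sqr_sqrtr.
by rewrite ler0_sqrtr ?expr0n// ltW.
Qed.

Lemma le_isq x y : 0 < x -> x <= y -> isq y <= isq x.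
Proof.
move=> x0 xy; rewrite lef_pV2 ?posrE ?sqrtr_gt0// ?(lt_le_trans x0)//.
exact: ler_wsqrtr.
Qed.

Lemma isqM x y : 0 <= x -> isq (x * y) = isq x * isq y.
Proof. by move=> x0; rewrite /isq sqrtrM// invfM. Qed.

Lemma measurable_isq : measurable_fun [set: R] isq.
Proof.
rewrite (_ : isq = (@powR R ^~ (-1)) \o Num.sqrt); last first.
  by apply/funext => y; rewrite /= powR_inv1 ?sqrtr_ge0.
apply: measurableT_comp; first exact: measurable_powR.
by apply: continuous_measurable_fun; exact: sqrt_continuous.
Qed.

(** The kinetic energy of a velocity is distributed with density
    [sqrt (2 / y)], twice that of either half-line. *)
Lemma ge0_integral_kinetic g :
  measurable_fun setT g -> (forall y, (0 <= g y)%E) ->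
  (\int[mu]_v g ((v ^+ 2 / 2)%R) = \int[mu]_y ((Num.sqrt 2 * isq y)%:E * g y))%E.
Proof.
move=> mg g0.
pose G y : \bar R := ((Num.sqrt 2 * isq y)%:E * g y)%E.
have mG : measurable_fun setT G.
  apply: emeasurable_funM => //; apply/measurable_EFinP.
  by apply: measurable_funM => //; exact: measurable_isq.
have G0 y : (0 <= G y)%E by rewrite mule_ge0// lee_fin mulr_ge0 ?sqrtr_ge0 ?isq_ge0.
pose phi (v : R) : R := v ^+ 2 / 2.
have D (v : R) : is_derive v 1 phi v.
  have -> : phi = 2^-1 \*: (@id R ^+ 2) by apply/funext => y; rewrite /phi mulrC.
  have := @is_deriveZ _ _ _ (@id R ^+ 2) 2^-1 v 1 _ (is_deriveX 2 (is_derive_id _ _)).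
  by move=> H; apply: is_derive_eq H _; rewrite /GRing.scale/= expr1; lra.
have D1 : derive1 phi = id.
  by apply/funext => x; rewrite derive1E; apply: derive_val.
have mphi : measurable_fun [set: R] phi by apply: measurable_funM.
have := @ge0_substitution_decr _ phi G -oo%E 0%:E erefl (ltNyr _) _ _ _ mG G0.
rewrite (_ : [set x | _] = `]-oo, 0[%classic); last first.
  by apply/seteqP; split => x; rewrite /= in_itv/= ltNyr lte_fin => // -[].
rewrite (_ : phi @` _ = `]0, +oo[%classic); last first.
  apply/seteqP; split => y /=; rewrite in_itv/= ?andbT.
    move=> [v /= + <-]; rewrite in_itv/= => v0.
    by rewrite /phi divr_gt0// exprn_even_gt0//= lt_eqF.
  move=> y0; exists (- Num.sqrt (2 * y)).
    by rewrite in_itv/= oppr_lt0 sqrtr_gt0 mulr_gt0.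
  by rewrite /phi sqrrN sqr_sqrtr ?mulr_ge0// ?ltW//; lra.
rewrite D1 => H.
transitivity (\int[mu]_(v in `]-oo, 0%R[) (2%:E * g (phi v)))%E; last first.
  transitivity (\int[mu]_(y in `]0%R, +oo[) G y)%E; last first.
    rewrite [LHS]integral_mkcond; apply: eq_integral => y _.
    rewrite patchE; case: ifPn => //; rewrite notin_setE/= in_itv/= andbT => /negP.
    by rewrite -leNgt => y0; rewrite /G isq_le0// mulr0 mul0e.
  rewrite H//.
  - apply: eq_integral => v /[!inE]/=; rewrite in_itv/= => v0.
    rewrite /G muleA; congr (_ * _)%E; rewrite -EFinM; congr EFin.
    rewrite /phi /isq sqrtrM ?sqr_ge0// sqrtr_sqr sqrtrV// invfM invrK.
    have v1 : `|v| != 0 by rewrite normr_eq0 lt_eqF.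
    rewrite [RHS](_ : _ = (Num.sqrt 2 * Num.sqrt 2) * (`|v| * `|v|^-1)); last by ring.
    by rewrite mulfV// mulr1 -expr2 sqr_sqrtr.
  - by move=> x _; exact: cvg_id.
have mgp : measurable_fun [set: R] (g \o phi) by exact: measurableT_comp.
rewrite ge0_integralZl//; last by apply: measurable_funTS; exact: mgp.
rewrite mule_natl mule2n.
have E : (\int[mu]_(v in `]-oo, 0%R[) g (phi v) = \int[mu]_(v in `]0%R, +oo[) g (phi v))%E.
  rewrite [LHS]integral_mkcond -[LHS](@ge0_integral_reflect _ 0); last 2 first.
  - by apply/(measurable_restrictT _ _).1 => //; exact: measurable_funTS.
  - by move=> y; rewrite patchE; case: ifP.
  rewrite [RHS]integral_mkcond; apply: eq_integral => v _.
  rewrite !patchE sub0r /phi sqrrN.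
  by rewrite (_ : (- v \in _) = (v \in `]0, +oo[%classic))//; apply/idP/idP; rewrite !inE/= !in_itv/= andbT ltrNl oppr0.
transitivity (\int[mu]_(v in `]-oo, 0%R[) g (phi v) +
              \int[mu]_(v in `[0%R, +oo[) g (phi v))%E; last first.
  congr (_ + _)%E; rewrite -integral_itv_obnd_cbnd ?E//.
  by apply: measurable_funTS; exact: mgp.
rewrite -ge0_integral_setU//.
- by rewrite -[X in X `|` _]setCitvr setUC setUv.
- exact: measurable_funTS.
- apply/disj_setPS => v /= []; rewrite !in_itv/= andbT => v0 v0'.
  by move: (lt_le_trans v0 v0'); rewrite ltxx.
Qed.

Lemma measurable_shell (p q : R) :
  measurable ([set v : R | (p <= v ^+ 2 / 2) && (v ^+ 2 / 2 < q)]
    : set (measurableTypeR R)).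
Proof.
have mphi : measurable_fun [set: R] (fun v : R => v ^+ 2 / 2) by apply: measurable_funM.
rewrite (_ : [set v | _] = (fun v : R => v ^+ 2 / 2) @^-1` `[p, q[%classic); last first.
  by apply/seteqP; split => v; rewrite /= in_itv.
rewrite -[X in measurable X]setTI; apply: mphi => //.
Qed.

Lemma shell_measure (p q : R) : p <= q ->
  (mu [set v : R | ((p <= v ^+ 2 / 2) && (v ^+ 2 / 2 < q))%R]
   <= (2 * Num.sqrt 2 * (Num.sqrt q - Num.sqrt p))%:E)%E.
Proof.
move=> pq; set a := Num.sqrt 2 * Num.sqrt p; set b := Num.sqrt 2 * Num.sqrt q.
have aE : a ^+ 2 / 2 = Num.max 0 p.
  rewrite /a exprMn sqr_sqrtr// mulrAC mulfV ?mul1r//.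
  by have [p0|/ltW p0] := leP 0 p; [rewrite sqr_sqrtr|rewrite ler0_sqrtr ?expr0n].
have ab : a <= b by rewrite ler_wpM2l ?sqrtr_ge0// ler_wsqrtr.
have a0 : 0 <= a by rewrite mulr_ge0 ?sqrtr_ge0.
apply: (@le_trans _ _ (mu (`[(- b), (- a)]%classic `|` `[a, b]%classic))).
  apply: le_measure; rewrite ?inE.
  - exact: measurable_shell.
  - by apply: measurableU; exact: measurable_itv.
  - move=> v /= /andP[pv vq].
    have q0 : 0 < q by apply: le_lt_trans vq; rewrite divr_ge0 ?sqr_ge0.
    have bE : b ^+ 2 / 2 = q.
      by rewrite /b exprMn !sqr_sqrtr ?(ltW q0)// mulrAC mulfV ?mul1r.
    have vb : `|v| <= b.
      rewrite -(ger0_norm (le_trans a0 ab)) -ler_sqr ?nnegrE// !real_normK ?num_real//.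
      by move: vq; rewrite -bE; lra.
    have av : a <= `|v|.
      rewrite -(ger0_norm a0) -ler_sqr ?nnegrE// !real_normK ?num_real//.
      suff : a ^+ 2 / 2 <= v ^+ 2 / 2 by lra.
      by rewrite aE ge_max pv divr_ge0// sqr_ge0.
    rewrite !in_itv/=.
    have [v0|v0] := leP 0 v; [right|left].
      by rewrite -(ger0_norm v0) av vb.
    by move: av vb; rewrite ltr0_norm//; lra.
apply: (le_trans (measureU2 _ _ _)); do ?exact: measurable_itv.
rewrite -[leLHS]/(mu `[(- b)%R, (- a)%R]%classic + mu `[a, b]%classic)%E.
rewrite !lebesgue_measure_itv/= !lte_fin.
have -> : 2 * Num.sqrt 2 * (Num.sqrt q - Num.sqrt p) = (b - a) + (b - a).
  by rewrite /a /b; ring.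
rewrite EFinD; apply: leeD.
  by case: ifP => _; rewrite ?lee_fin; lra.
by case: ifP => _; rewrite ?lee_fin; lra.
Qed.

Lemma sqrt_shell (w k : R) : 0 < w -> 0 <= k ->
  Num.sqrt w - Num.sqrt (w - k) <= k * isq w.
Proof.
move=> w0 k0; rewrite /isq ler_pdivlMr ?sqrtr_gt0//.
have := sqrtr_gt0 w; rewrite w0; set r := Num.sqrt w => r0.
have rr : r * r = w by rewrite -expr2 sqr_sqrtr// ltW.
have [wk|wk] := leP 0 (w - k); last by rewrite [Num.sqrt (w - k)]ler0_sqrtr ?ltW//; lra.
have tt : Num.sqrt (w - k) * Num.sqrt (w - k) = w - k by rewrite -expr2 sqr_sqrtr.
have tr : Num.sqrt (w - k) <= r by rewrite ler_wsqrtr//; lra.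
have := sqrtr_ge0 (w - k).
move: tt tr; set t := Num.sqrt (w - k) => tt tr t0.
have : 0 <= (r - t) * t by rewrite mulr_ge0// subr_ge0.
nra.
Qed.

Lemma sqrtrB_le (a b : R) : a <= b -> Num.sqrt b - Num.sqrt a <= Num.sqrt (b - a).
Proof.
move=> ab; rewrite lerBlDr.
have [b0|b0] := leP b 0; first by rewrite ler0_sqrtr// addr_ge0 ?sqrtr_ge0.
have [a0|a0] := leP a 0.
  by rewrite (ler0_sqrtr a0) addr0 ler_wsqrtr//; lra.
rewrite -ler_sqr ?nnegrE ?addr_ge0 ?sqrtr_ge0// sqrrD !sqr_sqrtr ?(ltW a0) ?(ltW b0) ?subr_ge0//.
have : 0 <= Num.sqrt (b - a) * Num.sqrt a by rewrite mulr_ge0 ?sqrtr_ge0.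
by rewrite mulr2n; lra.
Qed.

Lemma measurable_isqE : measurable_fun [set: R] (fun y => (isq y)%:E).
Proof. by apply/measurable_EFinP; exact: measurable_isq. Qed.

(** Up to a factor, the integral is the measure of the velocities whose kinetic
    energy lies between [a] and [b]. *)
Lemma integral_isq_itv (a b : R) : a <= b ->
  (\int[mu]_(y in `[a, b]) (isq y)%:E <= (2 * Num.sqrt (b - a))%:E)%E.
Proof.
move=> ab; rewrite -integral_itv_bndo_bndc; last first.
  by apply: measurable_funTS; exact: measurable_isqE.
have s2 : 0 < Num.sqrt 2 :> R by rewrite sqrtr_gt0.
rewrite -(@lee_pmul2l _ (Num.sqrt 2)%:E) ?lte_fin//.
pose g (y : R) : \bar R := (\1_(`[a, b[%classic : set R) y)%:E.
have mg : measurable_fun setT g.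
  by apply/measurable_EFinP; exact: measurable_indic.
have := ge0_integral_kinetic mg (fun y => _).
rewrite -ge0_integralZl//; last 2 first.
- by apply: measurable_funTS; exact: measurable_isqE.
- by move=> y _; rewrite lee_fin isq_ge0.
rewrite integral_mkcond => H.
rewrite (_ : (\int[mu]_y _ = \int[mu]_y ((Num.sqrt 2 * isq y)%:E * g y))%E); last first.
  apply: eq_integral => y _; rewrite patchE /g indicE.
  by case: (_ \in _); rewrite ?mule1 ?mule0.
rewrite -H => [|y]; last by rewrite lee_fin.
apply: (@le_trans _ _ (2 * Num.sqrt 2 * (Num.sqrt b - Num.sqrt a))%:E); last first.
  have := sqrtrB_le ab; rewrite -EFinM lee_fin; nra.
apply: le_trans (shell_measure ab).
rewrite -[in leRHS](setIT [set v : R | _]) -integral_indic//; last first.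
  exact: measurable_shell.
Qed.

Lemma integral_isq_abs (a b c : R) : a <= b ->
  (\int[mu]_(y in `[a, b]) (isq `|y - c|)%:E <= (4 * Num.sqrt (b - a))%:E)%E.
Proof.
move=> ab.
have E y : isq `|y - c| = isq (y - c) + isq (c - y).
  have [yc|yc] := leP 0 (y - c).
    by rewrite ger0_norm// [isq (c - y)]isq_le0 ?addr0//; lra.
  by rewrite ltr0_norm// [isq (y - c)]isq_le0 ?add0r ?opprB//; lra.
under eq_integral do rewrite E EFinD.
rewrite ge0_integralD//; last 4 first.
- by move=> y _; rewrite lee_fin isq_ge0.
- apply: measurable_funTS; apply: (measurableT_comp measurable_isqE).
  exact: measurable_funB.
- by move=> y _; rewrite lee_fin isq_ge0.
- apply: measurable_funTS; apply: (measurableT_comp measurable_isqE).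
  exact: measurable_funB.
pose G p q (z : R) : \bar R := ((fun z => (isq z)%:E) \_ (`[p, q]%classic : set R)) z.
have mG p q : measurable_fun setT (G p q).
  apply/(measurable_restrictT _ _).1 => //.
  by apply: measurable_funTS; exact: measurable_isqE.
have G0 p q z : (0 <= G p q z)%E.
  by rewrite /G patchE; case: ifP => // _; rewrite lee_fin isq_ge0.
have IG p q : p <= q -> (\int[mu]_z G p q z <= (2 * Num.sqrt (q - p))%:E)%E.
  by move=> pq; rewrite -integral_mkcond; exact: integral_isq_itv.
rewrite (_ : 4 * Num.sqrt (b - a) = 2 * Num.sqrt (b - a) + 2 * Num.sqrt (b - a)); last by ring.
rewrite EFinD; apply: leeD.
- rewrite integral_mkcond.
  apply: (@le_trans _ _ (\int[mu]_z G (a - c)%R (b - c)%R z)%E); last first.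
    rewrite (le_trans (IG _ _ _))//; first by lra.
    by rewrite (_ : b - c - (a - c) = b - a)//; ring.
  rewrite -(ge0_integral_translate c)//.
  rewrite le_eqVlt; apply/orP; left; apply/eqP; apply: eq_integral => y _.
  rewrite /G !patchE (_ : (y - c \in _) = (y \in `[a, b]%classic))//.
  by apply/idP/idP; rewrite !inE/= !in_itv/= => /andP[? ?]; apply/andP; split; lra.
- rewrite integral_mkcond.
  apply: (@le_trans _ _ (\int[mu]_z G (c - b)%R (c - a)%R z)%E); last first.
    rewrite (le_trans (IG _ _ _))//; first by lra.
    by rewrite (_ : c - a - (c - b) = b - a)//; ring.
  rewrite -(ge0_integral_reflect c)//.
  rewrite le_eqVlt; apply/orP; left; apply/eqP; apply: eq_integral => y _.
  rewrite /G !patchE (_ : (c - y \in _) = (y \in `[a, b]%classic))//.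
  by apply/idP/idP; rewrite !inE/= !in_itv/= => /andP[? ?]; apply/andP; split; lra.
Qed.
End one_dim.

(** * The logarithmic divergence of the period at the separatrix *)

Lemma ge0_integral_subU d (T : measurableType d) (R : realType)
    (mu : {measure set T -> \bar R}) (A B C : set T) (f : T -> \bar R) :
  measurable A -> measurable B -> measurable C -> A `<=` B `|` C ->
  measurable_fun setT f -> (forall x, (0 <= f x)%E) ->
  (\int[mu]_(x in A) f x <= \int[mu]_(x in B) f x + \int[mu]_(x in C) f x)%E.
Proof.
move=> mA mB mC ABC mf f0.
rewrite ![integral mu _ f]integral_mkcond -ge0_integralD//.
- apply: ge0_le_integral => //.
  + by move=> x _; rewrite patchE; case: ifP.
  + by apply/(measurable_restrictT _ _).1 => //; exact: measurable_funTS.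
  + by apply: emeasurable_funD; apply/(measurable_restrictT _ _).1 => //; exact: measurable_funTS.
  + move=> x _; rewrite !patchE.
    case: (boolP (x \in A)) => [|_]; last by rewrite adde_ge0//; case: ifP.
    rewrite inE => /ABC[] xB; rewrite (mem_set xB)/=; last by rewrite leeDr//; case: ifP.
    by rewrite leeDl//; case: ifP.
- by move=> x _; rewrite patchE; case: ifP.
- by apply/(measurable_restrictT _ _).1 => //; exact: measurable_funTS.
- by move=> x _; rewrite patchE; case: ifP.
- by apply/(measurable_restrictT _ _).1 => //; exact: measurable_funTS.
Qed.

Section log_singularity.
Context {R : realType}.
Local Notation mu := (@lebesgue_measure R).

Lemma integral_inv_itv (a b : R) : 0 < a -> a <= b ->
  (\int[mu]_(z in `[a, b]) (z^-1)%:E = (ln b - ln a)%:E)%E.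
Proof.
move=> a0; rewrite le_eqVlt => /orP[/eqP <-|ab].
  by rewrite subrr set_itv1 integral_set1.
have cln (x : R) : 0 < x -> {for x, continuous (@ln R)}.
  by move=> x0; apply: continuous_ln.
rewrite EFinB; apply: continuous_FTC2 => //.
- apply: continuous_in_subspaceT => x; rewrite inE/= in_itv/= => /andP[ax xb].
  by apply: cvgV; [rewrite gt_eqF// (lt_le_trans a0)|exact: cvg_id].
- split.
  + move=> x; rewrite in_itv/= => /andP[ax xb].
    by have H := @is_derive1_ln R x (lt_trans a0 ax); exact: ex_derive.
  + by apply: cvg_at_right_filter; exact: cln.
  + by apply: cvg_at_left_filter; apply: cln; exact: lt_trans ab.
- move=> x; rewrite in_itv/= => /andP[ax xb].
  by have H := @is_derive1_ln R x (lt_trans a0 ax); rewrite derive1E; exact: derive_val.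
Qed.

Let misqD (d : R) : measurable_fun [set: R] (fun z => isq `|z - d|).
Proof.
apply: measurableT_comp; first exact: measurable_isq.
by apply: measurableT_comp => //; exact: measurable_funB.
Qed.

(** The two square root singularities at [0] and [d] merge when [d] tends to
    [0], which costs a logarithm. *)
Lemma integral_isq2 (d : R) : 0 < d -> d < 2 ->
  (\int[mu]_(z in `[0%R, 2%R]) (isq `|z - d| * isq z)%:E
   <= (12 + 2 * `|ln d|)%:E)%E.
Proof.
move=> d0 d2.
pose f (z : R) : \bar R := (isq `|z - d| * isq z)%:E.
have mf : measurable_fun setT f.
  by apply/measurable_EFinP; apply: measurable_funM; [exact: misqD|exact: measurable_isq].
have f0 z : (0 <= f z)%E by rewrite lee_fin mulr_ge0 ?isq_ge0.
have q1 : isq (d / 2) * Num.sqrt (d / 2) = 1.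
  by rewrite /isq mulVf// gt_eqF// sqrtr_gt0 divr_gt0.
have I1 : (\int[mu]_(z in `[0%R, (d / 2)%R]) f z <= 2%:E)%E.
  apply: (@le_trans _ _ (\int[mu]_(z in `[0%R, (d / 2)%R]) ((isq (d / 2))%:E * (isq z)%:E))%E).
    apply: ge0_le_integral => //.
    - exact: measurable_funTS.
    - by apply: measurable_funTS; apply: emeasurable_funM => //; exact: measurable_isqE.
    - move=> z /=; rewrite in_itv/= => /andP[z0 zd].
      rewrite -EFinM lee_fin ler_wpM2r ?isq_ge0// le_isq ?divr_gt0//.
      by rewrite distrC ger0_norm; lra.
  rewrite ge0_integralZl//; last 3 first.
  - by apply: measurable_funTS; exact: measurable_isqE.
  - by move=> z _; rewrite lee_fin isq_ge0.
  - by rewrite lee_fin isq_ge0.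
  apply: (@le_trans _ _ ((isq (d / 2))%:E * (2 * Num.sqrt (d / 2 - 0))%:E)%E).
    by rewrite lee_wpmul2l ?lee_fin ?isq_ge0// integral_isq_itv// divr_ge0// ltW.
  by rewrite -EFinM lee_fin subr0 mulrCA q1 mulr1.
have I2 : (\int[mu]_(z in `[(d / 2)%R, (2 * d)%R]) f z <= 8%:E)%E.
  apply: (@le_trans _ _ (\int[mu]_(z in `[(d / 2)%R, (2 * d)%R]) ((isq (d / 2))%:E * (isq `|z - d|)%:E))%E).
    apply: ge0_le_integral => //.
    - exact: measurable_funTS.
    - apply: measurable_funTS; apply: emeasurable_funM => //.
      by apply/measurable_EFinP; exact: misqD.
    - move=> z /=; rewrite in_itv/= => /andP[z0 zd].
      by rewrite /f mulrC -EFinM lee_fin ler_wpM2r ?isq_ge0// le_isq ?divr_gt0.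
  rewrite ge0_integralZl//; last 3 first.
  - by apply: measurable_funTS; apply/measurable_EFinP; exact: misqD.
  - by move=> z _; rewrite lee_fin isq_ge0.
  - by rewrite lee_fin isq_ge0.
  apply: (@le_trans _ _ ((isq (d / 2))%:E * (4 * Num.sqrt (2 * d - d / 2))%:E)%E).
    by rewrite lee_wpmul2l ?lee_fin ?isq_ge0// integral_isq_abs//; lra.
  rewrite -EFinM lee_fin.
  have -> : 2 * d - d / 2 = 3 * (d / 2) by lra.
  rewrite sqrtrM//.
  have : Num.sqrt 3 <= 2 :> R.
    by rewrite -(@ler_sqr R) ?nnegrE ?sqrtr_ge0// sqr_sqrtr//; lra.
  have -> : isq (d / 2) * (4 * (Num.sqrt 3 * Num.sqrt (d / 2))) =
    4 * Num.sqrt 3 * (isq (d / 2) * Num.sqrt (d / 2)) by ring.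
  by rewrite q1; lra.
have I3 : (\int[mu]_(z in `[(2 * d)%R, 2%R]) f z <= (2 * `|ln d|)%:E)%E.
  have [d1|d1] := ltP 1 d.
    rewrite set_itv_ge ?integral_set0 ?lee_fin//.
    by rewrite bnd_simp -ltNge; lra.
  have mV : measurable_fun `[2 * d, 2] (fun z : R => (z^-1)%:E : \bar R).
    apply/measurable_EFinP; apply: subspace_continuous_measurable_fun => //.
    apply: continuous_in_subspaceT => x; rewrite inE/= in_itv/= => /andP[ax xb].
    by apply: cvgV; [rewrite gt_eqF//; lra|exact: cvg_id].
  apply: (@le_trans _ _ (\int[mu]_(z in `[(2 * d)%R, 2%R]) (2%:E * (z^-1)%:E))%E).
    apply: ge0_le_integral => //.
    - exact: measurable_funTS.
    - by apply: emeasurable_funM.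
    - move=> z /=; rewrite in_itv/= => /andP[z0 zd].
      rewrite -EFinM lee_fin.
      have z00 : 0 < z by lra.
      apply: (@le_trans _ _ (isq (z / 4) * isq z)).
        by rewrite ler_wpM2r ?isq_ge0// le_isq; [|lra|rewrite ger0_norm; lra].
      rewrite /isq sqrtrM ?(ltW z00)// sqrtrV// invfM invrK.
      have -> : Num.sqrt 4 = 2 :> R.
        by rewrite (_ : 4 = 2 ^+ 2); [rewrite sqrtr_sqr ger0_norm|ring].
      rewrite -mulrA mulrCA -invfM -expr2 sqr_sqrtr ?(ltW z00)//.
  rewrite ge0_integralZl//; last first.
    by move=> z /=; rewrite in_itv/= => /andP[? ?]; rewrite lee_fin invr_ge0; lra.
  rewrite integral_inv_itv; [|lra|lra].
  rewrite -EFinM lee_fin lnM ?posrE//.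
  have : - ln d <= `|ln d| by rewrite -normrN ler_norm.
  lra.
apply: (@le_trans _ _ (2%:E + (8%:E + (2 * `|ln d|)%:E))%E); last first.
  by rewrite -!EFinD lee_fin; lra.
apply: le_trans (leeD I1 (leeD I2 I3)).
apply: (@le_trans _ _ (\int[mu]_(z in `[0%R, (d / 2)%R]) f z + \int[mu]_(z in `[(d / 2)%R, 2%R]) f z)%E).
  apply: ge0_integral_subU => // z /=; rewrite !in_itv/= => /andP[z0 z2].
  by have [zd|zd] := leP z (d / 2); [left; rewrite z0|right; rewrite ltW].
rewrite leeD2l//.
apply: ge0_integral_subU => // z /=; rewrite !in_itv/= => /andP[z0 z2].
by have [zd|zd] := leP z (2 * d); [left; rewrite z0|right; rewrite ltW].
Qed.


Lemma ge0_integral_half_turn (g : R -> \bar R) :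
  measurable_fun setT g -> (forall y, (0 <= g y)%E) ->
  (\int[mu]_(t in `[0%R, (2 * pi)%R]) g (cos t) =
   2%:E * \int[mu]_(t in `[0%R, pi]) g (cos t))%E.
Proof.
move=> mg g0.
have mcos : measurable_fun [set: R] (@cos R).
  by apply: continuous_measurable_fun; exact: continuous_cos.
have mgc : measurable_fun [set: R] (g \o cos) by exact: measurableT_comp.
have pi0 := @pi_ge0 R.
have E : (\int[mu]_(t in `[pi, (2 * pi)%R]) g (cos t) = \int[mu]_(t in `[0%R, pi]) g (cos t))%E.
  rewrite integral_mkcond -(ge0_integral_reflect (2 * pi)).
  - rewrite [RHS]integral_mkcond; apply: eq_integral => t _.
    rewrite !patchE (_ : (2 * pi - t \in _) = (t \in `[0, pi]%classic)).
      by rewrite mulr_natl cosB cos2pi sin2pi mul1r mul0r addr0.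
    by apply/idP/idP; rewrite !inE/= !in_itv/= => /andP[? ?]; apply/andP; split; lra.
  - by apply/(measurable_restrictT _ _).1 => //; exact: measurable_funTS.
  - by move=> t; rewrite patchE; case: ifP.
rewrite mule_natl mule2n -{1}E addeC.
rewrite -(@integral_itv_obnd_cbnd _ pi (BRight (2 * pi))); last first.
  by apply: measurable_funTS; exact: mgc.
rewrite -ge0_integral_setU//.
- congr (integral _ _ _); apply/seteqP; split => t /=; rewrite !in_itv/=.
    move=> /andP[t0 t2]; have [tp|tp] := leP t pi; [left|right];
    by apply/andP; split; lra.
  by move=> [|] /andP[? ?]; apply/andP; split; lra.
- by apply: measurable_funTS; exact: mgc.
- apply/disj_setPS => v /= []; rewrite !in_itv/= => /andP[_ v1] /andP[v2 _].
  by move: (lt_le_trans v2 v1); rewrite ltxx.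
Qed.

(** The variable [1 + cos t] measures the distance to the top of the potential,
    which becomes the left endpoint. *)
Lemma ge0_integral_cos (g : R -> \bar R) :
  measurable_fun setT g -> (forall y, (0 <= g y)%E) ->
  (\int[mu]_(t in `[0%R, pi]) g (cos t) =
   \int[mu]_(z in `]0%R, 2%R[) (g (z - 1)%R * (isq (z * (2 - z)))%:E))%E.
Proof.
move=> mg g0.
pose G (z : R) : \bar R := (g (z - 1)%R * (isq (z * (2 - z)))%:E)%E.
have mG : measurable_fun setT G.
  apply: emeasurable_funM.
    by apply: (measurableT_comp mg); exact: measurable_funB.
  apply: (measurableT_comp measurable_isqE).
  by apply: measurable_funM => //; exact: measurable_funB.
have G0 z : (0 <= G z)%E by rewrite mule_ge0// lee_fin isq_ge0.
pose phi : R -> R := fun t => 1 + cos t.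
have D (t : R) : is_derive t 1 phi (- sin t).
  have := @is_deriveD R R R (cst 1) cos t 1 0 _ (is_derive_cst _ _ _) (is_derive_cos t).
  by rewrite add0r.
have D1 : derive1 phi = fun t => - sin t.
  by apply/funext => x; rewrite derive1E; apply: derive_val.
have := @ge0_substitution_decr _ phi G 0%:E pi%:E (ltry _) (ltNyr _) _ _ _ mG G0.
rewrite (_ : [set x : R | (0%:E < x%:E)%E /\ (x%:E < pi%:E)%E] = `]0, pi[%classic); last first.
  by apply/seteqP; split => x; rewrite /= in_itv/= !lte_fin; [move=> [-> ->]|move=> /andP[]].
rewrite (_ : phi @` _ = `]0, 2[%classic); last first.
  apply/seteqP; split => y /=; rewrite in_itv/=.
    move=> [t /= + <-]; rewrite in_itv/= => /andP[t0 tp].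
    have := @ltr_cos R 0 t; have := @ltr_cos R t pi.
    rewrite !in_itv/= !lexx ?(ltW t0) ?(ltW tp) ?pi_ge0/= cos0 cospi t0 tp /phi.
    move=> /(_ isT isT) ? /(_ isT isT) ?; apply/andP; split; lra.
  move=> /andP[y0 y2]; exists (acos (y - 1)).
    by rewrite in_itv/= acos_gt0 ?acos_ltpi//; apply/andP; split; lra.
  by rewrite /phi acosK ?in_itv/=; [lra|apply/andP; split; lra].
rewrite D1 => ->.
- rewrite [LHS](_ : _ = \int[mu]_(t in `]0%R, pi[) g (cos t))%E; last first.
    have mcos : measurable_fun [set: R] (@cos R).
      by apply: continuous_measurable_fun; exact: continuous_cos.
    have mgc : measurable_fun [set: R] (g \o cos) by exact: measurableT_comp.
    rewrite -integral_itv_obnd_cbnd; last by apply: measurable_funTS; exact: mgc.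
    by rewrite -integral_itv_bndo_bndc//; apply: measurable_funTS; exact: mgc.
  apply: eq_integral => t; rewrite inE/= in_itv/= => tp.
  have s0 := sin_gt0_pi tp.
  rewrite /G /phi normrN gtr0_norm// muleCA -EFinM.
  rewrite (_ : (1 + cos t) * (2 - (1 + cos t)) = sin t ^+ 2); last first.
    by rewrite sin2cos2; ring.
  by rewrite /isq sqrtr_sqr gtr0_norm// mulfV ?gt_eqF// mule1; congr g; lra.
- by move=> t _; exact: ex_derive.
- by move=> t _; apply: cvgN; exact: continuous_sin.
- by move=> t; rewrite /= in_itv/= oppr_lt0 => /sin_gt0_pi.
Qed.

(** Near the separatrix the period of the pendulum diverges only like a
    logarithm of the energy defect. *)
Lemma period_log_bound (m0 e1 : R) : 0 < m0 -> - m0 < e1 -> e1 < m0 ->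
  exists C : R, 0 < C /\ forall e, e1 <= e -> e < m0 ->
    (\int[mu]_(t in `[0%R, (2 * pi)%R]) (isq `|e + m0 * cos t|)%:E
     <= (C * (1 + `|ln (m0 - e)|))%:E)%E.
Proof.
move=> m00 e10 e11.
pose d1 := (m0 - e1) / m0; pose z1 := (2 + d1) / 2.
have d1_gt0 : 0 < d1 by rewrite divr_gt0// subr_gt0.
have d1_lt2 : d1 < 2 by rewrite ltr_pdivrMr//; lra.
have z1d : d1 < z1 by rewrite /z1; lra.
have z12 : z1 < 2 by rewrite /z1; lra.
have z10 : 0 < z1 by exact: lt_trans z1d.
pose c1 := isq m0 * isq (2 - z1).
pose c2 := isq m0 * isq (z1 - d1) * isq z1.
have c1_ge0 : 0 <= c1 by rewrite mulr_ge0// isq_ge0.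
have c2_ge0 : 0 <= c2 by rewrite !mulr_ge0// isq_ge0.
exists (2 * (c1 * (14 + 2 * `|ln m0|) + c2 * 8) + 1).
split.
  by rewrite ltr_pwDr// mulr_ge0// addr_ge0// mulr_ge0// addr_ge0// mulr_ge0.
move=> e e1e em0.
pose d := (m0 - e) / m0.
have d0 : 0 < d by rewrite divr_gt0// subr_gt0.
have dd1 : d <= d1 by rewrite ler_pM2r ?invr_gt0//; lra.
have lnd : `|ln d| <= `|ln (m0 - e)| + `|ln m0|.
  by rewrite ln_div ?posrE ?subr_gt0//; exact: ler_normB.
pose g (u : R) : \bar R := (isq `|e + m0 * u|)%:E.
have mg : measurable_fun setT g.
  apply: (measurableT_comp measurable_isqE); apply: measurableT_comp => //.
  by apply: measurable_funD => //; exact: measurable_funM.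
have g0 u : (0 <= g u)%E by rewrite lee_fin isq_ge0.
rewrite (ge0_integral_half_turn mg g0) (ge0_integral_cos mg g0).
have mD : measurable_fun [set: R] (fun z => (isq `|z - d| * isq z)%:E : \bar R).
  by apply/measurable_EFinP; apply: measurable_funM; [exact: misqD|exact: measurable_isq].
have bnd : (\int[mu]_(z in `]0%R, 2%R[) (g (z - 1)%R * (isq (z * (2 - z)))%:E)
   <= (c1 * (12 + 2 * `|ln d|) + c2 * 8)%:E)%E.
  apply: (@le_trans _ _ (\int[mu]_(z in `[0%R, 2%R])
     (c1%:E * (isq `|z - d| * isq z)%:E + c2%:E * (isq `|z - 2|)%:E))%E).
    apply: (@le_trans _ _ (\int[mu]_(z in `]0%R, 2%R[)
     (c1%:E * (isq `|z - d| * isq z)%:E + c2%:E * (isq `|z - 2|)%:E))%E); last first.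
      apply: ge0_subset_integral => //.
      - apply: measurable_funTS; apply: emeasurable_funD; apply: emeasurable_funM => //.
        by apply/measurable_EFinP; exact: misqD.
      - by move=> z _; rewrite -!EFinM -EFinD lee_fin addr_ge0// !mulr_ge0// isq_ge0.
      - by move=> z /=; rewrite !in_itv/= => /andP[? ?]; apply/andP; split; lra.
    apply: ge0_le_integral => //.
    - by move=> z _; rewrite mule_ge0// lee_fin isq_ge0.
    - apply: measurable_funTS; apply: emeasurable_funM.
        by apply: (measurableT_comp mg); exact: measurable_funB.
      apply: (measurableT_comp measurable_isqE).
      by apply: measurable_funM => //; exact: measurable_funB.
    - apply: measurable_funTS; apply: emeasurable_funD; apply: emeasurable_funM => //.
      by apply/measurable_EFinP; exact: misqD.
    - move=> z /=; rewrite in_itv/= => /andP[z0 z2].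
      have -> : g (z - 1) = (isq m0 * isq `|z - d|)%:E.
        rewrite /g -isqM ?(ltW m00)//; congr (isq _)%:E.
        rewrite -{2}(gtr0_norm m00) -normrM; congr `|_|.
        by rewrite /d; field; rewrite gt_eqF.
      rewrite isqM ?(ltW z0)// -!EFinM -EFinD lee_fin.
      have z2E : `|z - 2| = 2 - z by rewrite ltr0_norm; lra.
      rewrite z2E.
      have iz := isq_ge0 z; have im := isq_ge0 m0.
      have izd := isq_ge0 `|z - d|; have i2z := isq_ge0 (2 - z).
      have [zz1|zz1] := leP z z1.
        rewrite [leLHS](_ : _ = isq m0 * isq (2 - z) * (isq `|z - d| * isq z)); last by ring.
        apply: ler_wpDr; first by rewrite mulr_ge0.
        rewrite ler_wpM2r ?mulr_ge0// ler_wpM2l// le_isq; lra.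
      rewrite [leLHS](_ : _ = isq m0 * isq `|z - d| * isq z * isq (2 - z)); last by ring.
      apply: ler_wpDl; first by rewrite !mulr_ge0// isq_ge0.
      rewrite ler_wpM2r//; apply: ler_pM => //; rewrite ?mulr_ge0//.
        by rewrite ler_wpM2l// le_isq ?subr_gt0// ger0_norm; lra.
      by rewrite le_isq// ltW.
  rewrite ge0_integralD//; last 4 first.
  - by move=> z _; rewrite -EFinM lee_fin !mulr_ge0// isq_ge0.
  - by apply: measurable_funTS; exact: emeasurable_funM.
  - by move=> z _; rewrite -EFinM lee_fin !mulr_ge0// isq_ge0.
  - apply: measurable_funTS; apply: emeasurable_funM => //.
    by apply/measurable_EFinP; exact: misqD.
  rewrite EFinD; apply: leeD.
  - rewrite ge0_integralZl//; last 2 first.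
    + exact: measurable_funTS.
    + by move=> z _; rewrite lee_fin mulr_ge0// isq_ge0.
    by rewrite [leRHS]EFinM lee_wpmul2l ?lee_fin// integral_isq2//; lra.
  - rewrite ge0_integralZl//; last 2 first.
    + by apply: measurable_funTS; apply/measurable_EFinP; exact: misqD.
    + by move=> z _; rewrite lee_fin isq_ge0.
    rewrite [leRHS]EFinM lee_wpmul2l ?lee_fin//.
    apply: le_trans (integral_isq_abs _ _) _; first by lra.
    rewrite lee_fin subr0.
    have : Num.sqrt 2 <= 2 :> R.
      by rewrite -(@ler_sqr R) ?nnegrE ?sqrtr_ge0// sqr_sqrtr//; lra.
    lra.
apply: (@le_trans _ _ (2%:E * (c1 * (12 + 2 * `|ln d|) + c2 * 8)%:E)%E).
  by rewrite lee_wpmul2l// lee_fin.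
rewrite -EFinM lee_fin.
have L0 := normr_ge0 (ln (m0 - e)); have L1 := normr_ge0 (ln m0).
have : c1 * (12 + 2 * `|ln d|) <= c1 * (14 + 2 * `|ln m0|) * (1 + `|ln (m0 - e)|).
  rewrite -mulrA ler_wpM2l//.
  have : 0 <= `|ln m0| * `|ln (m0 - e)| by rewrite mulr_ge0.
  lra.
have : 0 <= c2 * `|ln (m0 - e)| by rewrite mulr_ge0.
set X := c1 * _ * _; set L := `|ln (m0 - e)| in L0 * => cL.
have -> : X = c1 * (14 + 2 * `|ln m0|) * (1 + L) by [].
lra.
Qed.
End log_singularity.

(** * The inverse of the profile *)

Section profile.
Context {R : realType}.
Local Notation mu := (@lebesgue_measure R).
Variables (F : R -> R) (estar : \bar R).
Hypothesis hF : profile_with_cutoff F estar.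

Let ltsW x y : x <= y -> lt_set estar y -> lt_set estar x.
Proof. by move=> xy; apply: le_lt_trans; rewrite lee_fin. Qed.

Lemma profile_decr x y : x < y -> (y%:E <= estar)%E -> F y < F x.
Proof.
move=> xy ye; have lt_y z : z < y -> lt_set estar z.
  by move=> zy; apply: lt_le_trans ye; rewrite lte_fin.
apply: (@ltr0_derive1_lt_cc _ F x y) => //.
- move=> z; rewrite in_itv/= => /andP[_ zy].
  exact: (profile_C1 hF (lt_y _ zy)).1.
- move=> z; rewrite in_itv/= => /andP[_ zy].
  by apply: (profile_derive_lt0 hF); exact: lt_y.
- by apply: continuous_subspaceT; exact: (profile_continuous hF).
- by rewrite in_itv/= lexx ltW.
- by rewrite in_itv/= lexx ltW.
Qed.

Lemma profile_ge0 e : 0 <= F e.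
Proof.
have [ee|ee] := leP estar e%:E; first by rewrite (profile_eq0 hF).
case E : estar ee => [r| |]// ee.
  rewrite -(profile_eq0 hF (_ : estar <= r%:E)%E) ?E//.
  by rewrite ltW// profile_decr ?E// -lte_fin.
have := profile_cvg0 hF E => /cvgrPdist_lt H.
rewrite leNgt; apply/negP => Fe.
have := H (- F e); rewrite oppr_gt0 => /(_ Fe)[M [_ HM]].
have := HM (Num.max M e + 1).
rewrite sub0r normrN => /(_ _).
have e1 : e < Num.max M e + 1.
  by rewrite (@le_lt_trans _ _ (Num.max M e)) ?le_max ?lexx ?orbT// ltrDl.
have M1 : M < Num.max M e + 1.
  by rewrite (@le_lt_trans _ _ (Num.max M e)) ?le_max ?lexx// ltrDl.
move=> /(_ M1).
have Fd : F (Num.max M e + 1) < F e by apply: profile_decr => //; rewrite E leey.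
by rewrite ltr0_norm; [lra|exact: lt_trans Fe].
Qed.

Lemma profile_gt0 e : lt_set estar e -> 0 < F e.
Proof.
move=> ee.
have [y [ey ye]] : exists y, e < y /\ (y%:E <= estar)%E.
  case E : estar ee => [r| |]// ee.
    by exists r; split => //; rewrite -lte_fin -E.
  by exists (e + 1); rewrite ltrDl leey.
exact: le_lt_trans (profile_ge0 y) (profile_decr ey ye).
Qed.

Lemma profile_noninc x y : x <= y -> F y <= F x.
Proof.
rewrite le_eqVlt => /orP[/eqP -> //|xy].
have [ye|ye] := leP y%:E estar; first by rewrite ltW// profile_decr.
by rewrite (profile_eq0 hF (ltW ye)) profile_ge0.
Qed.

Variables (m0 : R).
Hypothesis m0e : ((- m0)%:E < estar)%E.

Let S := F (- m0).

Lemma profile_top_gt0 : 0 < S. Proof. exact: profile_gt0. Qed.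

Let subV s : s \in `]0, S[ -> value_set F s.
Proof.
rewrite in_itv/= => /andP[s0 sS]; split => //.
apply: (@lt_le_trans _ _ S%:E); first by rewrite lte_fin.
by apply: ereal_sup_ubound; exists (- m0).
Qed.

(** The inverse profile, extended by 0 outside the range of values that the
    steady state takes. *)
Definition level : R -> R :=
  (projT1 (cid (profile_inverse hF))) \_ `]0, S[%classic.

Let G := projT1 (cid (profile_inverse hF)).

Let GP : [/\ set_bij (value_set F) (lt_set estar) G,
        {in value_set F, cancel G F} & C1_on (value_set F) G].
Proof. by rewrite /G; case: cid. Qed.

Let levelE s : s \in `]0, S[ -> level s = G s.
Proof. by move=> sS; rewrite /level patchE mem_set. Qed.

Lemma level_lt s : s \in `]0, S[ -> (((level s)%:E < estar)%E).
Proof. by move=> sS; rewrite levelE//; have [[GV _ _] _ _] := GP; apply: GV; exact: subV. Qed.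

Lemma profile_level s : s \in `]0, S[ -> F (level s) = s.
Proof. by move=> sS; rewrite levelE//; have [_ GK _] := GP; apply: GK; rewrite inE; exact: subV. Qed.

Lemma level_gt s : s \in `]0, S[ -> - m0 < level s.
Proof.
move=> sS; rewrite ltNge; apply/negP => /profile_noninc.
by rewrite profile_level// => Ss; move: sS; rewrite in_itv/= => /andP[_]; rewrite ltNge Ss.
Qed.

Lemma profile_lt s e : s \in `]0, S[ -> (s < F e) = (e < level s).
Proof.
move=> sS; apply/idP/idP => [sF|el].
  by rewrite ltNge; apply/negP => /profile_noninc; rewrite profile_level// leNgt sF.
by rewrite -{1}(profile_level sS) profile_decr// ltW// level_lt.
Qed.

Lemma levelK e : - m0 < e -> (e%:E < estar)%E -> level (F e) = e.
Proof.
move=> me ee.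
have FS : F e \in `]0, S[.
  by rewrite in_itv/= profile_gt0//= profile_decr// ltW.
apply/eqP; rewrite eq_le; apply/andP; split; rewrite leNgt -?profile_lt// ?ltxx//.
apply/negP => le; have := profile_decr le (ltW ee).
by rewrite profile_level// ltxx.
Qed.

Lemma measurable_level : measurable_fun [set: R] level.
Proof.
apply/(measurable_restrictT _ _).1 => //.
apply: subspace_continuous_measurable_fun => //.
apply: continuous_in_subspaceT => s; rewrite inE => sS.
have [_ _ /(_ s (subV sS))[ds _]] := GP.
exact/differentiable_continuous/derivable1_diffP.
Qed.

(** Above the cutoff the profile vanishes; at the cutoff it need not have a
    derivative. *)
Definition slope : R -> R := (fun e => `|derive1 F e|) \_ (lt_set estar).

Lemma measurable_lt_set : measurable (lt_set estar : set R).
Proof.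
rewrite /lt_set; have := cutoff_gtNy hF; case: estar => [r| |]// _.
- rewrite (_ : [set _ | _] = `]-oo, r[%classic)//.
- by rewrite (_ : [set _ | _] = setT)//; apply/seteqP; split => // x _ /=; rewrite ltry.
Qed.

Lemma measurable_slope : measurable_fun [set: R] slope.
Proof.
apply/(measurable_restrictT _ _).1; first exact: measurable_lt_set.
apply: measurableT_comp => //.
apply: subspace_continuous_measurable_fun; first exact: measurable_lt_set.
by apply: continuous_in_subspaceT => s; rewrite inE => se; exact: (profile_C1 hF se).2.
Qed.

Lemma slope_ge0 e : 0 <= slope e.
Proof. by rewrite /slope patchE; case: ifP. Qed.

Let U := [set e : R | ((- m0)%:E < e%:E)%E /\ (e%:E < estar)%E].

Lemma profile_image : F @` U = `]0, S[%classic.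
Proof.
apply/seteqP; split => s.
  move=> [e [me ee] <-]; rewrite lte_fin in me.
  by rewrite /= in_itv/= profile_gt0//= profile_decr// ltW.
move=> /= sS; exists (level s); last exact: profile_level.
by split; [rewrite lte_fin level_gt|exact: level_lt].
Qed.

(** The change of variables [s = F e]. *)
Lemma ge0_integral_level (g : R -> \bar R) :
  measurable_fun setT g -> (forall y, (0 <= g y)%E) ->
  (\int[mu]_(s in `]0%R, S[) g (level s) =
   \int[mu]_(e in `](- m0)%R, +oo[) ((slope e)%:E * g e))%E.
Proof.
move=> mg g0.
have mgl : measurable_fun setT (fun s => g (level s)).
  by apply: (measurableT_comp mg); exact: measurable_level.
have := @ge0_substitution_decr _ F (fun s => g (level s)) (- m0)%:E estar
  (ltry _) (cutoff_gtNy hF) _ _ _ mgl (fun _ => g0 _).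
rewrite -/U profile_image => ->.
- rewrite [LHS]integral_mkcond [RHS]integral_mkcond; apply: eq_integral => e _.
  rewrite !patchE /slope patchE.
  case: (boolP (e \in U)) => [|/negP eU].
    rewrite inE => -[me ee]; rewrite lte_fin in me.
    rewrite (mem_set (_ : `]- m0, +oo[%classic e)) ?mem_set//=.
      by rewrite levelK.
    by rewrite in_itv/= me.
  case: ifPn => // /[1!inE]; rewrite /= in_itv/= andbT => me.
  rewrite memNset ?mul0e// => ee; apply: eU; rewrite inE; split => //.
- by move=> e [_ ee]; exact: (profile_C1 hF ee).1.
- by move=> e [_ ee]; exact: (profile_C1 hF ee).2.
- by move=> e [_ ee]; exact: (profile_derive_lt0 hF).
Qed.

Lemma integral_slope :
  (\int[mu]_(e in `](- m0)%R, +oo[) (slope e)%:E = S%:E)%E.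
Proof.
have := @ge0_integral_level (cst 1%E) (measurable_cst _) (fun=> lee01).
under [X in _ = X -> _]eq_integral do rewrite mule1.
move=> <-; rewrite [LHS](_ : _ = \int[mu]_(s in `]0%R, S[) cst 1%E s)%E// integral_cst//= mul1e lebesgue_measure_itv/= lte_fin profile_top_gt0.
by rewrite -EFinB subr0.
Qed.


(** Up to a constant, a bound for the period of the orbit of energy [e]. The
    absolute value makes it dominate also what happens just outside the well,
    so that it bounds all second order quantities at that level. *)
Definition period (m0 e : R) : \bar R :=
  (\int[mu]_(t in `[0%R, (2 * pi)%R]) (isq `|e + m0 * cos t|)%:E)%E.

End profile.

Section period.
Context {R : realType}.
Local Notation mu := (@lebesgue_measure R).
Variables (F : R -> R) (estar : \bar R) (m0 : R).
Hypothesis hF : profile_with_cutoff F estar.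
Hypothesis m0_gt0 : 0 < m0.
Hypothesis m0e : ((- m0)%:E < estar)%E.

Let S := F (- m0).

Lemma measurable_isq_energy :
  measurable_fun [set: R * R] (fun z : R * R => isq `|z.1 + m0 * cos z.2|).
Proof.
apply: measurableT_comp; first exact: measurable_isq.
apply: measurableT_comp => //; apply: measurable_funD => //.
apply: measurable_funM => //; apply: measurableT_comp => //.
by apply: continuous_measurable_fun; exact: continuous_cos.
Qed.

Let f (z : measurableTypeR R * measurableTypeR R) : \bar R :=
  (isq `|z.1 + m0 * cos z.2|)%:E.

Let mf : measurable_fun setT f.
Proof. by apply/measurable_EFinP; exact: measurable_isq_energy. Qed.

Let f0 z : (0 <= f z)%E. Proof. by rewrite lee_fin isq_ge0. Qed.

Lemma period_ge0 e : (0 <= period m0 e)%E.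
Proof. by apply: integral_ge0 => t _; rewrite lee_fin isq_ge0. Qed.

Lemma measurable_period : measurable_fun [set: R] (period m0).
Proof. exact: (@measurable_integral_sectionr _ _ _ _ _ mu _ f). Qed.

Lemma integral_period_itv (L : R) : - m0 <= L ->
  (\int[mu]_(e in `[(- m0)%R, L]) period m0 e <= (4 * Num.sqrt (L + m0) * (2 * pi))%:E)%E.
Proof.
move=> mL.
have -> : (\int[mu]_(e in `[(- m0)%R, L]) period m0 e =
   \int[mu]_(t in `[0%R, (2 * pi)%R]) \int[mu]_(e in `[(- m0)%R, L]) f (e, t))%E.
  exact: (@tonelli_on _ _ _ _ _ mu mu).
apply: (@le_trans _ _ (\int[mu]_(t in `[0%R, (2 * pi)%R]) (cst (4 * Num.sqrt (L + m0))%:E t))%E).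
  apply: ge0_le_integral => //.
  - by move=> t _; apply: integral_ge0 => e _; exact: f0.
  - by apply: measurable_funTS; exact: (@measurable_integral_sectionl _ _ _ _ _ mu _ f).
  - move=> t _; rewrite /f/=.
    under eq_integral do rewrite -(opprK (m0 * cos t)).
    by apply: le_trans (integral_isq_abs _ mL) _; rewrite opprK.
rewrite integral_cst//= lebesgue_measure_itv/= lte_fin mulr_gt0 ?pi_gt0//.
by rewrite -EFinB subr0 -EFinM lee_fin.
Qed.

Let mslope D : measurable_fun D (fun e : measurableTypeR R => (slope F estar e)%:E : \bar R).
Proof. by apply/measurable_EFinP; apply: measurable_funTS; exact: measurable_slope. Qed.

Let spd0 e : (0 <= (slope F estar e)%:E)%E.
Proof. by rewrite lee_fin slope_ge0. Qed.

Let msp D : measurable_fun D (fun e : measurableTypeR R => (slope F estar e)%:E * period m0 e)%E.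
Proof.
by apply: emeasurable_funM => //; apply: measurable_funTS; exact: measurable_period.
Qed.

Let low (L : R) : - m0 <= L -> (L%:E < estar)%E ->
  (\int[mu]_(e in `[(- m0)%R, L]) ((slope F estar e)%:E * period m0 e) < +oo)%E.
Proof.
move=> mL Le.
have Lset x : x \in `[- m0, L] -> lt_set estar x.
  by rewrite in_itv/= => /andP[_ xL]; apply: le_lt_trans Le; rewrite lee_fin.
have [|c cL cmax] := @EVT_max R (fun e => `|derive1 F e|) (- m0) L mL.
  apply: continuous_in_subspaceT => x; rewrite inE => /Lset xe.
  by apply: cvg_norm; exact: (profile_C1 hF xe).2.
apply: (@le_lt_trans _ _ (\int[mu]_(e in `[(- m0)%R, L]) ((`|derive1 F c|)%:E * period m0 e))%E).
  apply: ge0_le_integral => //.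
  - by move=> e _; rewrite mule_ge0// period_ge0.
  - by apply: emeasurable_funM => //; apply: measurable_funTS; exact: measurable_period.
  - move=> e eL; rewrite lee_wpmul2r ?period_ge0// lee_fin /slope patchE mem_set ?cmax//.
    exact: Lset.
rewrite ge0_integralZl//.
- apply: (@le_lt_trans _ _ (`|derive1 F c|%:E * (4 * Num.sqrt (L + m0) * (2 * pi))%:E)%E).
    by rewrite lee_wpmul2l ?lee_fin// integral_period_itv.
  by rewrite -EFinM ltry.
- by apply: measurable_funTS; exact: measurable_period.
- by move=> e _; exact: period_ge0.
Qed.

Let intspd (A : set R) : measurable (A : set (measurableTypeR R)) -> A `<=` `]- m0, +oo[ ->
  (\int[mu]_(e in A) (slope F estar e)%:E <= S%:E)%E.
Proof.
move=> mA Am; rewrite -(integral_slope hF m0e).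
by apply: ge0_subset_integral.
Qed.

(** A bound of the period by [C * (1 + h)] is enough, as the slope has a finite
    integral; away from the separatrix [h] is 0, near it a logarithm. *)
Let high (A : set R) (h : R -> R) (C : R) :
  measurable (A : set (measurableTypeR R)) -> A `<=` `]- m0, +oo[ -> 0 <= C ->
  measurable_fun [set: R] h -> (forall e, 0 <= h e) ->
  (forall e, A e -> lt_set estar e -> (period m0 e <= (C * (1 + h e))%:E)%E) ->
  (\int[mu]_(e in A) ((slope F estar e)%:E * (h e)%:E) < +oo)%E ->
  (\int[mu]_(e in A) ((slope F estar e)%:E * period m0 e) < +oo)%E.
Proof.
move=> mA Am C0 mh h0 pC hfin.
have mhE D : measurable_fun D (fun e : measurableTypeR R => (h e)%:E : \bar R).
  by apply/measurable_EFinP; apply: measurable_funTS.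
apply: (@le_lt_trans _ _ (\int[mu]_(e in A) (C%:E * ((slope F estar e)%:E + (slope F estar e)%:E * (h e)%:E)))%E).
  apply: ge0_le_integral => //.
  - by move=> e _; rewrite mule_ge0// period_ge0.
  - apply: emeasurable_funM => //; apply: emeasurable_funD => //.
    exact: emeasurable_funM.
  - move=> e Ae; have [ee|ee] := pselect (lt_set estar e); last first.
      by rewrite /slope patchE memNset// !mul0e adde0 mule0.
    apply: (@le_trans _ _ ((slope F estar e)%:E * (C * (1 + h e))%:E)%E).
      by rewrite lee_wpmul2l// pC.
    rewrite [leRHS](_ : _ = (C * (slope F estar e + slope F estar e * h e))%:E)//.
    by rewrite -EFinM lee_fin; lra.
rewrite ge0_integralZl//; last 2 first.
- by apply: emeasurable_funD => //; exact: emeasurable_funM.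
- by move=> e _; rewrite adde_ge0// mule_ge0// lee_fin.
apply: lte_mul_pinfty => //.
rewrite ge0_integralD//; last 2 first.
- by move=> e _; rewrite mule_ge0// lee_fin.
- exact: emeasurable_funM.
by apply: lte_add_pinfty hfin; apply: le_lt_trans (intspd mA Am) _; rewrite ltry.
Qed.

(** On energies bounded away from the cutoff the slope is bounded, and the period
    is integrable. When the cutoff is above the separatrix, the higher energies
    have bounded periods. Otherwise the period near the cutoff is at most
    logarithmic in the distance to the separatrix; at a cutoff equal to the
    separatrix the hypothesis says that the logarithm is integrable. *)
Lemma integral_period_level :
  (estar = m0%:E ->
    (\int[mu]_(e in `](- m0)%R, m0[%classic) (ln (m0 - e) * derive1 F e)%:E < +oo)%E) ->
  (\int[mu]_(s in `]0%R, S[) period m0 (level hF m0 s) < +oo)%E.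
Proof.
move=> hlog; rewrite (@ge0_integral_level _ _ _ hF m0 _ measurable_period period_ge0).
suff [L [mL Le LH]] : exists L : R, [/\ - m0 <= L, (L%:E < estar)%E &
    (\int[mu]_(e in `]L, +oo[) ((slope F estar e)%:E * period m0 e) < +oo)%E].
  apply: le_lt_trans (lte_add_pinfty (low mL Le) LH).
  apply: ge0_integral_subU => //.
  - move=> e /=; rewrite !in_itv/= !andbT => me.
    by have [eL|eL] := leP e L; [left; rewrite (ltW me)|right].
  - by move=> e; rewrite mule_ge0// period_ge0.
have [em|me] := leP estar m0%:E; last first.
  (* the steady state has particles outside the separatrix *)
  have [L [mL Le]] : exists L : R, m0 < L /\ (L%:E < estar)%E.
    case: estar me => [r| |]// me; last by exists (m0 + 1); rewrite ltrDl ltry.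
    by exists ((m0 + r) / 2); rewrite lte_fin in me; rewrite lte_fin; split; lra.
  have m00 := m0_gt0; exists L; split => //; first by lra.
  apply: (@high _ (cst 0) (isq (L - m0) * (2 * pi))) => //.
  - by move=> e /=; rewrite !in_itv/= !andbT; lra.
  - by rewrite mulr_ge0 ?isq_ge0// mulr_ge0 ?pi_ge0.
  - move=> e /=; rewrite in_itv/= andbT => Lee _; rewrite addr0 mulr1.
    apply: (@le_trans _ _ (\int[mu]_(t in `[0%R, (2 * pi)%R]) (cst (isq (L - m0))%:E t))%E).
      apply: ge0_le_integral => //.
      + by move=> t _; rewrite lee_fin isq_ge0.
      + apply: measurable_funTS; apply: (measurableT_comp measurable_isqE).
        apply: measurableT_comp => //; apply: measurable_funD => //.
        apply: measurable_funM => //.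
        by apply: continuous_measurable_fun; exact: continuous_cos.
      + move=> t _; rewrite lee_fin le_isq ?subr_gt0//.
        rewrite (le_trans _ (ler_norm _))//.
        have ct := cos_geN1 t; have : 0 <= m0 * (cos t + 1) by apply: mulr_ge0; [exact: ltW|lra].
        by lra.
    rewrite integral_cst//= lebesgue_measure_itv/= lte_fin mulr_gt0 ?pi_gt0//.
    by rewrite -EFinB subr0 -EFinM lee_fin.
  - by under eq_integral do rewrite mule0; rewrite integral0 ltry.
have [r rE] : exists r : R, estar = r%:E.
  by case: estar em m0e => [r| |]// _ _; exists r.
have m00 := m0_gt0.
have mr : - m0 < r by rewrite -lte_fin -rE.
have rm : r <= m0 by rewrite -lee_fin -rE.
pose e1 := (r - m0) / 2.
have e1m : e1 < r by rewrite /e1; lra.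
have me1 : - m0 < e1 by rewrite /e1; lra.
exists e1; split; [exact: ltW|by rewrite rE lte_fin|].
have [C [C0 HC]] := period_log_bound m0_gt0 me1 (lt_le_trans e1m rm).
have mln : measurable_fun [set: R] (fun e => `|ln (m0 - e)|).
  apply: measurableT_comp => //; apply: measurableT_comp => //.
  exact: measurable_funB.
apply: (@high _ (fun e => `|ln (m0 - e)|) C) => //.
- by move=> e /=; rewrite !in_itv/= !andbT; lra.
- exact: ltW.
- move=> e /=; rewrite in_itv/= andbT => e1e; rewrite /lt_set/= rE lte_fin => er.
  by apply: HC; [exact: ltW|exact: lt_le_trans rm].
have mh D : measurable_fun D (fun e : measurableTypeR R => (slope F estar e)%:E * (`|ln (m0 - e)|)%:E)%E.
  apply: emeasurable_funM => //; apply/measurable_EFinP; exact: measurable_funTS.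
have h0 e : (0 <= (slope F estar e)%:E * (`|ln (m0 - e)|)%:E)%E.
  by rewrite mule_ge0// lee_fin.
move: rm; rewrite le_eqVlt => /orP[/eqP rm|rm].
  (* the cutoff is at the separatrix *)
  have {}hlog := hlog; rewrite rE rm in hlog.
  have {}hlog := hlog erefl.
  pose a e : \bar R := (ln (m0 - e) * derive1 F e)%:E.
  have sE e : - m0 < e -> e < m0 -> slope F estar e = `|derive1 F e|.
    by move=> _ em0; rewrite /slope patchE mem_set// /lt_set/= rE rm lte_fin.
  have ma : measurable_fun (`]- m0, m0[ : set (measurableTypeR R)) a.
    apply/measurable_EFinP; apply: measurable_funM.
      apply: measurable_funTS; apply: measurableT_comp => //; exact: measurable_funB.
    apply: subspace_continuous_measurable_fun => //.
    apply: continuous_in_subspaceT => x; rewrite inE/= in_itv/= => /andP[_ xm].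
    by apply: (profile_C1 hF _).2; rewrite /lt_set/= rE rm lte_fin.
  have neg : (\int[mu]_(e in `](- m0)%R, m0[) (a^\- e) < +oo)%E.
    apply: (@le_lt_trans _ _ (\int[mu]_(e in `](- m0)%R, m0[) ((`|ln (2 * m0)|)%:E * (slope F estar e)%:E))%E).
      apply: ge0_le_integral => //.
      - exact: measurable_funeneg.
      - exact: emeasurable_funM.
      - move=> e /=; rewrite in_itv/= => /andP[me em0].
        rewrite sE//.
        have F'0 : derive1 F e < 0 by apply: (profile_derive_lt0 hF); rewrite /lt_set/= rE rm lte_fin.
        rewrite funenegE /a -EFinN -EFin_max -EFinM lee_fin ge_max mulr_ge0//=.
        rewrite andbT -mulrN (ltr0_norm F'0).
        apply: ler_wpM2r; first by rewrite oppr_ge0 ltW.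
        apply: le_trans (ler_norm _).
        by rewrite ler_ln ?posrE; lra.
    rewrite ge0_integralZl//; apply: lte_mul_pinfty => //.
    apply: le_lt_trans (intspd _ _) _; rewrite ?ltry//.
    by move=> e /=; rewrite !in_itv/= andbT => /andP[].
  have pos : (\int[mu]_(e in `](- m0)%R, m0[) (a^\+ e) < +oo)%E.
    rewrite ltNge; apply/negP; rewrite leye_eq => /eqP poso.
    move: hlog; rewrite -/(a _) integralE poso.
    by rewrite addye ?ltxx// gt_eqF// lteNr/= ltNge; apply/negP; rewrite leye_eq => /eqP E; move: neg; rewrite E ltxx.
  have mabs : (\int[mu]_(e in `](- m0)%R, m0[) ((slope F estar e)%:E * (`|ln (m0 - e)|)%:E) < +oo)%E.
    apply: (@le_lt_trans _ _ (\int[mu]_(e in `](- m0)%R, m0[) (a^\+ e + a^\- e))%E).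
      apply: ge0_le_integral => //.
      - apply: emeasurable_funD; [exact: measurable_funepos|exact: measurable_funeneg].
      - move=> e /=; rewrite in_itv/= => /andP[me em0].
        have -> : (a^\+ e + a^\- e = `|a e|)%E by rewrite -[RHS]/((abse \o a) e) fune_abse.
        by rewrite sE// /a -EFinM lee_fin normrM mulrC.
    rewrite ge0_integralD//; [exact: lte_add_pinfty|exact: measurable_funepos|exact: measurable_funeneg].
  apply: le_lt_trans mabs.
  rewrite [leLHS](_ : _ = \int[mu]_(e in `]e1, m0[) ((slope F estar e)%:E * (`|ln (m0 - e)|)%:E))%E.
    apply: ge0_subset_integral => // e /=; rewrite !in_itv/= => /andP[ee em0].
    by rewrite em0 (lt_trans me1 ee).
  rewrite integral_mkcond [RHS]integral_mkcond; apply: eq_integral => e _.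
  rewrite !patchE.
  have [e0|e0] := pselect (e < m0).
    rewrite (_ : (e \in `]e1, +oo[%classic) = (e \in `]e1, m0[%classic))//.
    by apply/idP/idP; rewrite !inE/= !in_itv/= e0 !andbT.
  rewrite [in RHS]memNset; last by rewrite /= in_itv/= => /andP[].
  case: ifP => // _; rewrite /slope patchE memNset ?mul0e//.
  by rewrite /lt_set/= rE rm lte_fin.
(* the cutoff is below the separatrix *)
pose B := `|ln (m0 - r)| + `|ln (2 * m0)|.
apply: (@le_lt_trans _ _ (\int[mu]_(e in `]e1, +oo[) (B%:E * (slope F estar e)%:E))%E).
  apply: ge0_le_integral => //.
  - exact: emeasurable_funM.
  - move=> e /=; rewrite in_itv/= andbT => e1e.
    have [ee|ee] := pselect (lt_set estar e); last first.
      by rewrite /slope patchE memNset// mul0e mule0.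
    rewrite muleC lee_wpmul2r// lee_fin.
    move: ee; rewrite /lt_set/= rE lte_fin => er.
    have u1 : ln (m0 - e) <= ln (2 * m0) by rewrite ler_ln ?posrE; lra.
    have u2 : ln (m0 - r) <= ln (m0 - e) by rewrite ler_ln ?posrE; lra.
    have n1 := ler_norm (ln (2 * m0)); have n2 := ler_norm (- ln (m0 - r)).
    have n3 := normr_ge0 (ln (2 * m0)); have n4 := normr_ge0 (ln (m0 - r)).
    by rewrite normrN in n2; rewrite /B ler_norml; apply/andP; split; lra.
have B0 : 0 <= B by rewrite addr_ge0.
rewrite ge0_integralZl//; apply: lte_mul_pinfty => //.
apply: le_lt_trans (intspd _ _) _; rewrite ?ltry//.
by move=> e /=; rewrite !in_itv/= !andbT; lra.
Qed.
End period.

(** * Transport between the superlevels of two functions *)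

(** How far the convex function [Num.max 0] lies above its first order expansion
    at [u]; at the kink the expansion uses the slope 0. *)
Definition excess (R : realType) (u v : R) : R :=
  Num.max 0 (u + v) - Num.max 0 u - (if 0 < u then v else 0).

Lemma excess_ge0 (R : realType) (u v : R) : 0 <= excess u v.
Proof.
rewrite /excess; case: ltP => u0; case: (lerP 0 (u + v)) => uv; case: (lerP 0 u) => ?; lra.
Qed.

Lemma excess_eq0 (R : realType) (u v : R) : (0 < u) = (0 < u + v) -> excess u v = 0.
Proof.
rewrite /excess; case: (ltP 0 u) => u0 /esym; last move/negbT; rewrite -?leNgt => uv.
  by rewrite !max_r ?ltW//; ring.
by rewrite !max_l// !subr0.
Qed.

Section layers.
Context d (X : measurableType d) (R : realType).
Variable nu : {sigma_finite_measure set X -> \bar R}.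
Local Notation mu := (@lebesgue_measure R).
Local Notation pos := (`]0%R, +oo[%classic : set (measurableTypeR R)).

Definition layer (f : X -> R) (z : measurableTypeR R * X) : R := (z.1 < f z.2)%R%:R.

Lemma layer_ge0 f z : 0 <= layer f z. Proof. exact: ler0n. Qed.

Lemma measurable_layer f : measurable_fun setT f -> measurable_fun setT (layer f).
Proof.
move=> mf; rewrite (_ : layer f = fun z => if z.1 < f z.2 then 1 else 0); last first.
  by apply/funext => z; rewrite /layer; case: ifP.
apply: measurable_fun_ifT => //.
by apply: measurable_fun_ltr => //; exact: measurableT_comp.
Qed.

Let mEl f : measurable_fun setT f -> measurable_fun setT (fun z => (layer f z)%:E).
Proof. by move=> mf; apply/measurable_EFinP; exact: measurable_layer. Qed.

Definition tail (f : X -> R) (s : R) : \bar R := (\int[nu]_x (layer f (s, x))%:E)%E.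

Lemma tail_ge0 f s : (0 <= tail f s)%E.
Proof. by apply: integral_ge0 => x _; rewrite lee_fin layer_ge0. Qed.

Lemma measurable_tail f : measurable_fun setT f -> measurable_fun [set: R] (tail f).
Proof.
move=> mf; exact: (@measurable_integral_sectionr _ _ _ _ _ nu _ (fun z => (layer f z)%:E)
  measurableT (mEl mf) (fun z => ler0n _ _)).
Qed.

Lemma layer_cake (p f : X -> R) : measurable_fun setT p -> measurable_fun setT f ->
  (forall x, 0 <= p x) -> (forall x, 0 <= f x) ->
  (\int[nu]_x (p x * f x)%:E =
   \int[mu]_(s in pos) \int[nu]_x (p x * layer f (s, x))%:E)%E.
Proof.
move=> mp mf p0 f0.
pose h (z : measurableTypeR R * X) : \bar R := (p z.2 * layer f z)%:E.
have mh : measurable_fun setT h.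
  apply/measurable_EFinP; apply: measurable_funM; last exact: measurable_layer.
  exact: measurableT_comp.
have h0 z : (0 <= h z)%E by rewrite lee_fin mulr_ge0// layer_ge0.
rewrite (@tonelli_on _ _ _ _ _ mu nu _ _ (measurable_itv _) measurableT h mh h0).
apply: eq_integral => x _; rewrite /h/=.
under eq_integral do rewrite EFinM.
rewrite ge0_integralZl//; last 3 first.
- by apply: measurable_funTS; apply: (measurableT_comp (mEl mf)); exact: measurable_pair2.
- by move=> s _; rewrite lee_fin layer_ge0.
- by rewrite lee_fin.
rewrite EFinM; congr (_ * _)%E.
transitivity (mu (`]0, f x[%classic)).
  rewrite lebesgue_measure_itv/= lte_fin; case: ltP => [fx|fx].
    by rewrite -EFinB subr0.
  by have := f0 x; rewrite le_eqVlt ltNge fx orbF => /eqP <-.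
rewrite (_ : `]0, f x[%classic = `]0, f x[%classic `&` pos); last first.
  by rewrite setIidl// => s /=; rewrite !in_itv/= andbT => /andP[].
rewrite -integral_indic//; apply: eq_integral => s.
rewrite inE/= in_itv/= andbT => s0.
rewrite indicE /layer/=; congr (_%:R)%:E.
by congr nat_of_bool; apply/idP/idP; rewrite inE/= in_itv/= s0.
Qed.

Lemma tail_fin (f : X -> R) s : measurable_fun setT f -> (forall x, 0 <= f x) ->
  (\int[nu]_x (f x)%:E < +oo)%E -> 0 < s -> (tail f s < +oo)%E.
Proof.
move=> mf f0 If s0.
have : (s%:E * tail f s <= \int[nu]_x (f x)%:E)%E.
  rewrite /tail -ge0_integralZl//; last 3 first.
  - by apply: (measurableT_comp (mEl mf)); exact: measurable_pair1.
  - by move=> x _; rewrite lee_fin layer_ge0.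
  - by rewrite lee_fin ltW.
  apply: ge0_le_integral => //.
  - by move=> x _; rewrite mule_ge0// lee_fin ?layer_ge0// ltW.
  - apply: emeasurable_funM => //.
    by apply: (measurableT_comp (mEl mf)); exact: measurable_pair1.
  - exact/measurable_EFinP.
  - move=> x _; rewrite -EFinM lee_fin /layer/=.
    by case: ltP => sf; rewrite ?mulr1 ?mulr0// ltW.
move=> sT; rewrite ltey; apply/eqP => E; move: sT.
by rewrite E gt0_muley ?lte_fin// leNgt If.
Qed.

Lemma ge0_exchange_ineq (a b c e : \bar R) : (0 <= c)%E -> (c < +oo)%E ->
  (0 <= e)%E -> (e < +oo)%E ->
  (a + c <= b + e)%E -> (a <= b + maxe 0 (e - c))%E.
Proof.
move=> c0 cy e0 ey H.
have cf : c \is a fin_num by rewrite ge0_fin_numE.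
have ef : e \is a fin_num by rewrite ge0_fin_numE.
apply: (@le_trans _ _ (b + (e - c))%E).
  by rewrite addeA leeBrDr.
by rewrite leeD2l// le_max lexx orbT.
Qed.

Section comparison.
Variables f g : X -> R.
Hypotheses (mf : measurable_fun setT f) (mg : measurable_fun setT g).
Hypotheses (f0 : forall x, 0 <= f x) (g0 : forall x, 0 <= g x).
Hypotheses (If : (\int[nu]_x (f x)%:E < +oo)%E) (Ig : (\int[nu]_x (g x)%:E < +oo)%E).

Let lf := layer f.
Let lg := layer g.
Let mlf := measurable_layer mf.
Let mlg := measurable_layer mg.

(** By equimeasurability this is [|f^* - g^*|_1]. *)
Definition tail_dist : \bar R := (\int[mu]_(s in pos) `|tail f s - tail g s|)%E.

Let mpair1 s (h : measurableTypeR R * X -> R) : measurable_fun setT h ->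
  measurable_fun setT (fun x => (h (s, x))%:E).
Proof.
move=> mh; apply/measurable_EFinP.
by apply: (measurableT_comp mh); exact: measurable_pair1.
Qed.

Let mint (h : measurableTypeR R * X -> R) D : measurable_fun setT h -> (forall z, 0 <= h z) ->
  measurable_fun D (fun s => \int[nu]_x (h (s, x))%:E)%E.
Proof.
move=> mh h0; apply: measurable_funTS.
apply: (@measurable_integral_sectionr _ _ _ _ _ nu _ (fun z => (h z)%:E)) => //.
exact/measurable_EFinP.
Qed.

Let intge0 (h : measurableTypeR R * X -> R) s : (forall z, 0 <= h z) ->
  (0 <= \int[nu]_x (h (s, x))%:E)%E.
Proof. by move=> h0; apply: integral_ge0 => x _; rewrite lee_fin. Qed.

(** The function [g] decreases with the energy [eps]; [eta s] is the energy at
    which it takes the value [s]. *)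
Variables (eps : X -> R) (eta : measurableTypeR R -> R).
Hypotheses (meps : measurable_fun setT eps) (meta : measurable_fun setT eta).
Hypotheses (eps0 : forall x, 0 <= eps x) (eta0 : forall s, 0 <= eta s).
Hypothesis superlevel : forall s x, 0 < s -> (s < g x) = (eps x < eta s).

(** Where the superlevels of [f] and [g] at a value differ, the point is charged
    its distance in energy to the boundary of the superlevel of [g]. *)
Definition transport (z : measurableTypeR R * X) : R :=
  `|eps z.2 - eta z.1| * `|lf z - lg z|.

Let transport_ge0 z : 0 <= transport z.
Proof. by rewrite mulr_ge0. Qed.

Let me2 : measurable_fun setT (fun z : measurableTypeR R * X => eps z.2).
Proof. exact: measurableT_comp. Qed.

Let me1 : measurable_fun setT (fun z : measurableTypeR R * X => eta z.1).
Proof. exact: measurableT_comp. Qed.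

Lemma measurable_transport : measurable_fun setT transport.
Proof.
by apply: measurable_funM; apply: measurableT_comp => //; exact: measurable_funB.
Qed.

Definition transport_cost : \bar R :=
  (\int[mu]_(s in pos) \int[nu]_x (transport (s, x))%:E)%E.

(** Integration, one level at a time, of a pointwise inequality in which the
    two functions are exchanged against a weight that depends on the level only;
    all the terms are nonnegative so that nothing but the finite masses of the
    superlevels has to be subtracted. *)
Let exchange (L Q : measurableTypeR R * X -> R) (l : measurableTypeR R -> R) (h k : X -> R) :
  measurable_fun setT h -> measurable_fun setT k ->
  (forall x, 0 <= h x) -> (forall x, 0 <= k x) ->
  (\int[nu]_x (h x)%:E < +oo)%E -> (\int[nu]_x (k x)%:E < +oo)%E ->
  measurable_fun setT l -> (forall s, 0 <= l s) ->
  measurable_fun setT L -> (forall z, 0 <= L z) ->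
  measurable_fun setT Q -> (forall z, 0 <= Q z) ->
  (forall s x, 0 < s -> L (s, x) + l s * layer k (s, x) <= Q (s, x) + l s * layer h (s, x)) ->
  (\int[mu]_(s in pos) \int[nu]_x (L (s, x))%:E <=
    \int[mu]_(s in pos) \int[nu]_x (Q (s, x))%:E
    + \int[mu]_(s in pos) ((l s)%:E * maxe 0 (tail h s - tail k s)))%E.
Proof.
move=> mh mk h0 k0 Ih Ik ml l0 mL L0 mQ Q0 H.
have mlh := measurable_layer mh; have mlk := measurable_layer mk.
have mD D : measurable_fun D (fun s => (l s)%:E * maxe 0 (tail h s - tail k s))%E.
  apply: measurable_funTS; apply: emeasurable_funM; first exact/measurable_EFinP.
  apply: measurable_maxe => //; apply: emeasurable_funB; exact: measurable_tail.
rewrite -ge0_integralD//; last 3 first.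
- by move=> s _; exact: (intge0 _ Q0).
- exact: (@mint Q _ mQ Q0).
- by move=> s _; rewrite mule_ge0 ?lee_fin// le_max lexx.
apply: ge0_le_integral => //.
- by move=> s _; exact: (intge0 _ L0).
- exact: (@mint L _ mL L0).
- by apply: emeasurable_funD => //; exact: (@mint Q _ mQ Q0).
move=> s /=; rewrite in_itv/= andbT => s0.
have th := tail_fin mh h0 Ih s0; have tk := tail_fin mk k0 Ik s0.
rewrite (_ : ((l s)%:E * maxe 0 (tail h s - tail k s) =
   maxe 0 ((l s)%:E * tail h s - (l s)%:E * tail k s))%E); last first.
  move: th tk (tail_ge0 h s) (tail_ge0 k s).
  case: (tail h s) => [r| |]//; case: (tail k s) => [r'| |]// _ _ _ _.
  by rewrite -!EFinM -!EFinB -!EFin_max -EFinM maxr_pMr// mulr0 mulrBr.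
apply: ge0_exchange_ineq.
- by rewrite mule_ge0 ?lee_fin ?tail_ge0.
- by apply: lte_mul_pinfty; rewrite ?lee_fin.
- by rewrite mule_ge0 ?lee_fin ?tail_ge0.
- by apply: lte_mul_pinfty; rewrite ?lee_fin.
have mlx (m : X -> R) : measurable_fun setT m -> measurable_fun setT (fun x => (l s)%:E * (layer m (s, x))%:E)%E.
  by move=> mm; apply: emeasurable_funM => //; apply: mpair1; exact: measurable_layer.
have lx0 m x : (0 <= (l s)%:E * (layer m (s, x))%:E)%E by rewrite mule_ge0 ?lee_fin ?layer_ge0.
have tE m : measurable_fun setT m ->
   ((l s)%:E * tail m s = \int[nu]_x ((l s)%:E * (layer m (s, x))%:E))%E.
  move=> mm; rewrite ge0_integralZl ?lee_fin//.
  - by apply: mpair1; exact: measurable_layer.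
  - by move=> x _; rewrite lee_fin layer_ge0.
rewrite !tE//.
have Qx0 x : (0 <= (Q (s, x))%:E)%E by rewrite lee_fin.
have Lx0 x : (0 <= (L (s, x))%:E)%E by rewrite lee_fin.
have mQx := mpair1 s mQ; have mLx := mpair1 s mL.
rewrite -ge0_integralD//; [|exact: mlx].
rewrite -ge0_integralD//; [|exact: mlx].
apply: ge0_le_integral => //.
- by move=> x _; exact: adde_ge0.
- by apply: emeasurable_funD => //; exact: mlx.
- by apply: emeasurable_funD => //; exact: mlx.
by move=> x _; rewrite -!EFinM -!EFinD lee_fin; exact: H.
Qed.

Let le_double (L Q : measurableTypeR R * X -> R) :
  measurable_fun setT L -> (forall z, 0 <= L z) ->
  measurable_fun setT Q -> (forall z, 0 <= Q z) ->
  (forall s x, 0 < s -> L (s, x) <= Q (s, x)) ->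
  (\int[mu]_(s in pos) \int[nu]_x (L (s, x))%:E <=
    \int[mu]_(s in pos) \int[nu]_x (Q (s, x))%:E)%E.
Proof.
move=> mL L0 mQ Q0 H; apply: ge0_le_integral => //.
- by move=> s _; exact: (intge0 _ L0).
- exact: (@mint L _ mL L0).
- exact: (@mint Q _ mQ Q0).
move=> s /=; rewrite in_itv/= andbT => s0.
apply: ge0_le_integral => //.
- by move=> x _; rewrite lee_fin.
- exact: mpair1.
- exact: mpair1.
- by move=> x _; rewrite lee_fin; exact: H.
Qed.

Let double_add (L Q : measurableTypeR R * X -> R) :
  measurable_fun setT L -> (forall z, 0 <= L z) ->
  measurable_fun setT Q -> (forall z, 0 <= Q z) ->
  (\int[mu]_(s in pos) \int[nu]_x (L (s, x) + Q (s, x))%:E =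
    \int[mu]_(s in pos) \int[nu]_x (L (s, x))%:E +
    \int[mu]_(s in pos) \int[nu]_x (Q (s, x))%:E)%E.
Proof.
move=> mL L0 mQ Q0; rewrite -ge0_integralD//; last 4 first.
- by move=> s _; exact: (intge0 _ L0).
- exact: (@mint L _ mL L0).
- by move=> s _; exact: (intge0 _ Q0).
- exact: (@mint Q _ mQ Q0).
apply: eq_integral => s _; rewrite -ge0_integralD//.
- by move=> x _; rewrite lee_fin.
- exact: mpair1.
- by move=> x _; rewrite lee_fin.
- exact: mpair1.
Qed.

Let double_scale (c : R) (L : measurableTypeR R * X -> R) : 0 <= c ->
  measurable_fun setT L -> (forall z, 0 <= L z) ->
  (\int[mu]_(s in pos) \int[nu]_x (c * L (s, x))%:E =
    c%:E * \int[mu]_(s in pos) \int[nu]_x (L (s, x))%:E)%E.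
Proof.
move=> c0 mL L0; rewrite -(@ge0_integralZl _ (measurableTypeR R))//; last 2 first.
- exact: (@mint L _ mL L0).
- by move=> s _; exact: (intge0 _ L0).
apply: eq_integral => s _; rewrite -ge0_integralZl//.
- exact: mpair1.
- by move=> x _; rewrite lee_fin.
Qed.

Let l1 (h k : X -> R) : measurable_fun setT h -> measurable_fun setT k ->
  (forall x, 0 <= h x) -> (forall x, 0 <= k x) ->
  (\int[nu]_x (h x)%:E < +oo)%E -> (\int[nu]_x (k x)%:E < +oo)%E ->
  (\int[nu]_x (h x)%:E <= \int[nu]_x (k x)%:E
    + \int[mu]_(s in pos) maxe 0 (tail h s - tail k s))%E.
Proof.
move=> mh mk h0 k0 Ih Ik.
have E (m : X -> R) : measurable_fun setT m -> (forall x, 0 <= m x) ->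
  (\int[nu]_x (m x)%:E = \int[mu]_(s in pos) \int[nu]_x (layer m (s, x))%:E)%E.
  move=> mm m0'; have := @layer_cake (cst 1) m (measurable_cst _) mm (fun=> ler01) m0'.
  under eq_integral do rewrite mul1r.
  by under [X in _ = X -> _]eq_integral do under eq_integral do rewrite mul1r.
rewrite !E//.
have := @exchange (layer h) (layer k) (cst 1) h k mh mk h0 k0 Ih Ik (measurable_cst _)
  (fun=> ler01) (measurable_layer mh) (layer_ge0 h) (measurable_layer mk) (layer_ge0 k).
under [X in (_ -> (_ <= _ + X)%E) -> _]eq_integral do rewrite mul1e.
by apply=> s x _; rewrite !mul1r addrC.
Qed.

Let mtd (h k : X -> R) D : measurable_fun setT h -> measurable_fun setT k ->
  measurable_fun D (fun s => tail h s - tail k s)%E.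
Proof.
move=> mh mk; apply: measurable_funTS.
by apply: emeasurable_funB; exact: measurable_tail.
Qed.

Let maxe_abs (a b : \bar R) : (maxe 0 (a - b) <= `|a - b|)%E.
Proof. by rewrite ge_max abse_ge0 lee_abs. Qed.

Lemma mass_le : (\int[nu]_x (f x)%:E <= \int[nu]_x (g x)%:E + tail_dist)%E.
Proof.
apply: le_trans (l1 mf mg f0 g0 If Ig) _; rewrite leeD2l//.
apply: ge0_le_integral => //.
- by move=> s _; rewrite le_max lexx.
- by apply: measurable_maxe => //; exact: mtd.
- by apply: measurableT_comp => //; exact: mtd.
Qed.

Lemma mass_ge : (\int[nu]_x (g x)%:E <= \int[nu]_x (f x)%:E + tail_dist)%E.
Proof.
apply: le_trans (l1 mg mf g0 f0 Ig If) _; rewrite leeD2l//.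
apply: ge0_le_integral => //.
- by move=> s _; rewrite le_max lexx.
- by apply: measurable_maxe => //; exact: mtd.
- by apply: measurableT_comp => //; exact: mtd.
- move=> s /=; rewrite in_itv/= andbT => s0; rewrite -abseN.
  have th := tail_fin mf f0 If s0; have tk := tail_fin mg g0 Ig s0.
  rewrite (_ : (- (tail f s - tail g s) = tail g s - tail f s)%E); first exact: maxe_abs.
  by rewrite fin_num_oppeB ?ge0_fin_numE ?tail_ge0// addeC.
Qed.

(** Moving [g] to [f] costs the energy of [f] minus that of [g], because the
    superlevels of [g] are sublevels of the energy [eps]. *)
Lemma transport_energy :
  (transport_cost + \int[nu]_x (eps x * g x)%:E <= \int[nu]_x (eps x * f x)%:E
    + \int[mu]_(s in pos) ((eta s)%:E * maxe 0 (tail g s - tail f s)))%E.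
Proof.
have mel h : measurable_fun setT h -> measurable_fun setT (fun z : measurableTypeR R * X => eps z.2 * layer h z).
  by move=> mh; apply: measurable_funM => //; exact: measurable_layer.
have el0 h (z : measurableTypeR R * X) : 0 <= eps z.2 * layer h z.
  by rewrite mulr_ge0// layer_ge0.
rewrite !layer_cake// -ge0_integralD//; last 4 first.
- by move=> s _; exact: (intge0 _ transport_ge0).
- exact: (@mint transport _ measurable_transport transport_ge0).
- by move=> s _; exact: (intge0 s (el0 g)).
- exact: (@mint _ _ (mel _ mg) (el0 g)).
rewrite [leLHS](_ : _ = \int[mu]_(s in pos) \int[nu]_x (transport (s, x) + eps x * layer g (s, x))%:E)%E; last first.
  apply: eq_integral => s _; rewrite -ge0_integralD//.
  - by move=> x _; rewrite lee_fin.
  - exact: (mpair1 s measurable_transport).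
  - by move=> x _; rewrite lee_fin; exact: (el0 g (s, x)).
  - exact: (mpair1 s (mel _ mg)).
apply: (@exchange (fun z => transport z + eps z.2 * layer g z) (fun z => eps z.2 * layer f z) eta g f) => //.
- by apply: measurable_funD; [exact: measurable_transport|exact: mel].
- by move=> z; rewrite addr_ge0.
- exact: mel.
move=> s x s0 /=; rewrite /transport /lf /lg /layer/= superlevel//.
by case: (ltP (eps x) (eta s)) => c; case: (s < f x);
  rewrite ?subrr ?subr0 ?sub0r ?normrN ?normr1 ?normr0 ?mulr1 ?mulr0 ?addr0 ?add0r//;
  [rewrite ltr0_norm ?subr_lt0//; lra|rewrite ger0_norm ?subr_ge0//; lra].
Qed.

Definition shell (k : R) (z : measurableTypeR R * X) : R :=
  ((eta z.1 - k <= eps z.2) && (eps z.2 < eta z.1))%:R.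

Lemma measurable_shell_ind k : measurable_fun setT (shell k).
Proof.
rewrite (_ : shell k = fun z => if (eta z.1 - k <= eps z.2) && (eps z.2 < eta z.1) then 1 else 0); last first.
  by apply/funext => z; rewrite /shell; case: ifP.
apply: measurable_fun_ifT => //; apply: measurable_and.
- by apply: measurable_fun_ler => //; exact: measurable_funB.
- exact: measurable_fun_ltr.
Qed.

(** A superlevel of [g] that [f] misses lies below the level [eta] in energy,
    all of it but a thin shell by at least [k]. *)
Lemma transport_defect (k : R) : 0 < k ->
  (k%:E * \int[nu]_x (Num.max 0 (g x - f x))%:E <= transport_cost +
   k%:E * \int[mu]_(s in pos) \int[nu]_x (shell k (s, x))%:E)%E.
Proof.
move=> k0; pose q x := Num.min (f x) (g x).
have mq : measurable_fun setT q by exact: measurable_minr.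
have q0 x : 0 <= q x by rewrite le_min f0 g0.
have k0' := ltW k0.
have ms : measurable_fun setT (fun z => k * shell k z).
  by apply: measurable_funM => //; exact: measurable_shell_ind.
have ml h : measurable_fun setT h -> measurable_fun setT (fun z => k * layer h z).
  by move=> mh; apply: measurable_funM => //; exact: measurable_layer.
have s0 z : 0 <= k * shell k z by rewrite mulr_ge0.
have l0 h z : 0 <= k * layer h z by rewrite mulr_ge0// layer_ge0.
have E (h : X -> R) : measurable_fun setT h -> (forall x, 0 <= h x) ->
    (\int[mu]_(s in pos) \int[nu]_x (k * layer h (s, x))%:E = k%:E * \int[nu]_x (h x)%:E)%E.
  move=> mh h0; rewrite -(@layer_cake (cst k) h)//.
  rewrite -ge0_integralZl//.
  - exact/measurable_EFinP.
  - by move=> x _; rewrite lee_fin.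
have := @le_double (fun z => k * layer g z)
  (fun z => transport z + k * shell k z + k * layer q z)
  (ml _ mg) (l0 g).
rewrite E//.
have m1 : measurable_fun setT (fun z => transport z + k * shell k z).
  by apply: measurable_funD => //; exact: measurable_transport.
rewrite (double_add (L := fun z => transport z + k * shell k z) m1 _ (ml _ mq))//; last first.
  by move=> z; rewrite addr_ge0.
rewrite (double_add (L := transport) measurable_transport _ ms)//.
rewrite double_scale//; last exact: measurable_shell_ind.
rewrite E//.
have Dq : (\int[nu]_x (g x)%:E = \int[nu]_x (Num.max 0 (g x - f x))%:E + \int[nu]_x (q x)%:E)%E.
  rewrite -ge0_integralD//; first last.
  - exact/measurable_EFinP.
  - by move=> x _; rewrite lee_fin.
  - by apply/measurable_EFinP; apply: measurable_maxr => //; exact: measurable_funB.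
  - by move=> x _; rewrite lee_fin le_max lexx.
  apply: eq_integral => x _; rewrite -EFinD; congr EFin; rewrite /q.
  by case: (lerP (f x) (g x)) => fg; case: lerP => fg'; lra.
have qy : (\int[nu]_x (q x)%:E < +oo)%E.
  apply: le_lt_trans If; apply: ge0_le_integral => //.
  - by move=> x _; rewrite lee_fin.
  - exact/measurable_EFinP.
  - exact/measurable_EFinP.
  - by move=> x _; rewrite lee_fin ge_min lexx.
rewrite Dq ge0_muleDr; last 2 first.
- by apply: integral_ge0 => x _; rewrite lee_fin le_max lexx.
- by apply: integral_ge0 => x _; rewrite lee_fin.
rewrite leeD2rE; last first.
  by rewrite fin_numM// ge0_fin_numE// integral_ge0// => x _; rewrite lee_fin.
apply.
- apply: measurable_funD; last exact: ml.
  by apply: measurable_funD => //; exact: measurable_transport.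
- by move=> z; rewrite !addr_ge0.
move=> s x sp; rewrite /transport /lf /lg /layer /shell/= superlevel// /q lt_min superlevel//.
case: (ltP (eps x) (eta s)) => c; case: (s < f x) => /=;
  rewrite ?subrr ?subr0 ?sub0r ?normrN ?normr1 ?normr0 ?mulr1 ?mulr0 ?addr0 ?add0r ?andbT ?andbF//=.
- by rewrite lerDr mulr_ge0.
- case: (lerP (eta s - k) (eps x)) => /= c'; first by rewrite mulr1 lerDr.
  by rewrite mulr0 addr0 ltr0_norm ?subr_lt0//; lra.
- by rewrite mulr0 addr0.
- by rewrite mulr0.
Qed.

(** Since the masses nearly agree, what [f] has above [g] is nearly what it
    lacks below. *)
Lemma dist_le_defect :
  (\int[nu]_x (`|f x - g x|)%:E <=
   2%:E * \int[nu]_x (Num.max 0 (g x - f x))%:E + tail_dist)%E.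
Proof.
have mn : measurable_fun setT (fun x => (Num.max 0 (g x - f x))%:E).
  by apply/measurable_EFinP; apply: measurable_maxr => //; exact: measurable_funB.
have n0 x : (0 <= (Num.max 0 (g x - f x))%:E)%E by rewrite lee_fin le_max lexx.
have mfE : measurable_fun setT (fun x => (f x)%:E) by exact/measurable_EFinP.
have mgE : measurable_fun setT (fun x => (g x)%:E) by exact/measurable_EFinP.
have f0E x : (0 <= (f x)%:E)%E by rewrite lee_fin.
have g0E x : (0 <= (g x)%:E)%E by rewrite lee_fin.
have md : measurable_fun setT (fun x => (`|f x - g x|)%:E).
  by apply/measurable_EFinP; apply: measurableT_comp => //; exact: measurable_funB.
have E : (\int[nu]_x (`|f x - g x|)%:E + \int[nu]_x (g x)%:E =
   2%:E * \int[nu]_x (Num.max 0 (g x - f x))%:E + \int[nu]_x (f x)%:E)%E.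
  rewrite -ge0_integralZl ?lee_fin// -!ge0_integralD//; last 2 first.
  - by move=> x _; rewrite mule_ge0// lee_fin.
  - by apply: emeasurable_funM.
  apply: eq_integral => x _; rewrite -EFinM -!EFinD; congr EFin.
  by case: (lerP (f x) (g x)) => fg; case: lerP => fg'; [lra|lra|lra|lra].
have Igf : (\int[nu]_x (g x)%:E \is a fin_num)%E by rewrite ge0_fin_numE ?integral_ge0.
rewrite -(leeD2rE _ _ Igf) E -addeA leeD2l// addeC; exact: mass_le.
Qed.

(** What convexity leaves of a first order comparison of [f] and [g] when the
    levels of [g] are displaced by [t] times the test function [p], recentred by
    [l] at each value. *)
Definition remainder (p : X -> R) (l : measurableTypeR R -> R) (t : R)
    (z : measurableTypeR R * X) : R :=
  excess (eta z.1 - eps z.2) (t * (p z.2 - l z.1)).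

Lemma remainder_ge0 p l t z : 0 <= remainder p l t z. Proof. exact: excess_ge0. Qed.

Lemma measurable_remainder p l t : measurable_fun setT p -> measurable_fun setT l ->
  measurable_fun setT (remainder p l t).
Proof.
move=> mp ml; rewrite /remainder /excess.
have mu1 : measurable_fun setT (fun z : measurableTypeR R * X => eta z.1 - eps z.2).
  exact: measurable_funB.
have mv : measurable_fun setT (fun z : measurableTypeR R * X => t * (p z.2 - l z.1)).
  by apply: measurable_funM => //; apply: measurable_funB; exact: measurableT_comp.
apply: measurable_funB.
  apply: measurable_funB; apply: measurable_maxr => //; exact: measurable_funD.
apply: measurable_fun_ifT => //; exact: measurable_fun_ltr.
Qed.

Let pointwise (u v : R) (a : bool) :
  v * (a%:R - (0 < u)%R%:R) <= `|u| * `|a%:R - (0 < u)%R%:R| +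
    (Num.max 0 (u + v) - Num.max 0 u - (if 0 < u then v else 0)).
Proof.
by case: a; case: (ltP 0 u) => u0;
  rewrite ?subrr ?subr0 ?sub0r ?normrN ?normr1 ?normr0 ?mulr1 ?mulr0 ?mulrN1
    ?(gtr0_norm u0) ?(ler0_norm u0);
  case: (lerP 0 (u + v)) => uv; case: (lerP 0 u) => u1; lra.
Qed.

Let test_aux (p : X -> R) (l : measurableTypeR R -> R) (t c : R) (h k : X -> R) :
  measurable_fun setT p -> measurable_fun setT l ->
  (forall x, 0 <= p x) -> (forall s, 0 <= l s <= 2) -> 0 <= c ->
  measurable_fun setT h -> measurable_fun setT k ->
  (forall x, 0 <= h x) -> (forall x, 0 <= k x) ->
  (\int[nu]_x (h x)%:E < +oo)%E -> (\int[nu]_x (k x)%:E < +oo)%E ->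
  (forall s, 0 < s -> (maxe 0 (tail h s - tail k s) <= `|tail f s - tail g s|)%E) ->
  (forall s x, 0 < s -> c * (p x * layer h (s, x)) + c * l s * layer k (s, x) <=
     transport (s, x) + remainder p l t (s, x) + c * (p x * layer k (s, x)) + c * l s * layer h (s, x)) ->
  (c%:E * \int[nu]_x (p x * h x)%:E
   <= transport_cost + \int[mu]_(s in pos) \int[nu]_x (remainder p l t (s, x))%:E
      + c%:E * \int[nu]_x (p x * k x)%:E + (2 * c)%:E * tail_dist)%E.
Proof.
move=> mp ml p0 l02 c0 mh mk h0 k0 Ih Ik dist H.
have mpl m : measurable_fun setT m -> measurable_fun setT (fun z : measurableTypeR R * X => p z.2 * layer m z).
  move=> mm; apply: measurable_funM; last exact: measurable_layer.
  exact: measurableT_comp.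
have mcpl m : measurable_fun setT m -> measurable_fun setT (fun z : measurableTypeR R * X => c * (p z.2 * layer m z)).
  by move=> mm; apply: measurable_funM => //; exact: mpl.
have pl0 m (z : measurableTypeR R * X) : 0 <= p z.2 * layer m z by rewrite mulr_ge0// layer_ge0.
have cpl0 m (z : measurableTypeR R * X) : 0 <= c * (p z.2 * layer m z) by rewrite mulr_ge0.
have mr := measurable_remainder t mp ml.
have r0 := remainder_ge0 p l t.
have mt := measurable_transport.
have E (m : X -> R) : measurable_fun setT m -> (forall x, 0 <= m x) ->
  (c%:E * \int[nu]_x (p x * m x)%:E =
    \int[mu]_(s in pos) \int[nu]_x (c * (p x * layer m (s, x)))%:E)%E.
  by move=> mm m0; rewrite layer_cake// -(double_scale c0 (mpl _ mm)).
rewrite !E//.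
have cl0 s : 0 <= c * l s by rewrite mulr_ge0//; have /andP[] := l02 s.
have mcl : measurable_fun setT (fun s => c * l s) by exact: measurable_funM.
have := @exchange (fun z => c * (p z.2 * layer h z))
  (fun z => transport z + remainder p l t z + c * (p z.2 * layer k z)) (fun s => c * l s) h k
  mh mk h0 k0 Ih Ik mcl cl0 (mcpl _ mh) (cpl0 h).
have m1 : measurable_fun setT (fun z => transport z + remainder p l t z) by exact: measurable_funD.
rewrite (double_add (L := fun z => transport z + remainder p l t z) m1 _ (mcpl _ mk))//; last first.
  by move=> z; rewrite addr_ge0.
rewrite (double_add (L := transport))// => X1.
apply: le_trans (X1 _ _ H) _.
- by apply: measurable_funD => //; exact: mcpl.
- by move=> z; apply: addr_ge0 => //; exact: addr_ge0.
rewrite leeD2l// /tail_dist -ge0_integralZl ?lee_fin ?mulr_ge0//; last first.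
  by apply: measurableT_comp => //; exact: mtd.
apply: ge0_le_integral => //.
- by move=> s _; rewrite mule_ge0 ?lee_fin// le_max lexx.
- apply: emeasurable_funM; first by apply/measurable_EFinP; exact: measurable_funTS.
  by apply: measurable_maxe => //; exact: mtd.
- apply: emeasurable_funM => //.
  by apply: measurableT_comp => //; exact: mtd.
move=> s /=; rewrite in_itv/= andbT => s0.
apply: lee_pmul; rewrite ?lee_fin//; last exact: dist.
- by rewrite le_max lexx.
- by rewrite mulrC ler_wpM2r//; have /andP[] := l02 s.
Qed.

(** For a point that lies at the signed distance [u] inside the superlevel of
    [g], and a displacement [v] of the boundary, [v] times the difference of the
    indicators of the two superlevels is at most the cost [|u|] of that
    difference plus [excess u v]. The recentring only acts on the difference of
    the volumes of the superlevels, hence the multiple of [tail_dist]. *)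
Lemma transport_test (p : X -> R) (l : measurableTypeR R -> R) (t : R) :
  measurable_fun setT p -> measurable_fun setT l ->
  (forall x, 0 <= p x) -> (forall s, 0 <= l s <= 2) ->
  (\int[nu]_x (p x * f x)%:E < +oo)%E -> (\int[nu]_x (p x * g x)%:E < +oo)%E ->
  ((t * (fine (\int[nu]_x (p x * f x)%:E) - fine (\int[nu]_x (p x * g x)%:E)))%:E
   <= transport_cost + \int[mu]_(s in pos) \int[nu]_x (remainder p l t (s, x))%:E
      + (2 * `|t|)%:E * tail_dist)%E.
Proof.
move=> mp ml p0 l02 Ipf Ipg.
have pI (m : X -> R) : (forall x, 0 <= m x) -> (\int[nu]_x (p x * m x)%:E < +oo)%E ->
    exists2 r : R, (\int[nu]_x (p x * m x)%:E = r%:E)%E & True.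
  move=> m0 H; exists (fine (\int[nu]_x (p x * m x)%:E)) => //.
  by rewrite fineK// ge0_fin_numE// integral_ge0// => x _; rewrite lee_fin mulr_ge0.
have [rf Ef _] := pI f f0 Ipf; have [rg Eg _] := pI g g0 Ipg.
have finish (a b c e : R) (y z : \bar R) : c * a - c * b = e ->
   ((c * a)%:E <= y + (c * b)%:E + z -> e%:E <= y + z)%E.
  by move=> <-; rewrite EFinB leeBlDr// addeAC.
case: (lerP 0 t) => t0.
  have := @test_aux p l t t f g mp ml p0 l02 t0 mf mg f0 g0 If Ig.
  rewrite Ef Eg/= -!EFinM => X1; apply: (finish rf rg t); first by rewrite mulrBr.
  rewrite ger0_norm//; apply: X1 => [s s0|s x s0]; first exact: maxe_abs.
  rewrite /transport /lf /lg /layer /remainder /excess /= superlevel// subr_gt0.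
  set u := eta s - eps x; rewrite -[eps x - _]opprB normrN -/u -subr_gt0 -/u.
  by have := @pointwise u (t * (p x - l s)) (s < f x); set rem := _ - _ - _; lra.
have t0' : 0 <= - t by lra.
have := @test_aux p l t (- t) g f mp ml p0 l02 t0' mg mf g0 f0 Ig If.
rewrite Ef Eg/= -!EFinM => X1; apply: (finish rg rf (- t)); first by ring.
rewrite ltr0_norm//; apply: X1 => [s s0|s x s0].
  have th := tail_fin mf f0 If s0; have tk := tail_fin mg g0 Ig s0.
  rewrite -abseN (_ : (- (tail f s - tail g s) = tail g s - tail f s)%E); first exact: maxe_abs.
  by rewrite fin_num_oppeB ?ge0_fin_numE ?tail_ge0// addeC.
rewrite /transport /lf /lg /layer /remainder /excess /= superlevel// subr_gt0.
set u := eta s - eps x; rewrite -[eps x - _]opprB normrN -/u -subr_gt0 -/u.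
by have := @pointwise u (t * (p x - l s)) (s < f x); set rem := _ - _ - _; lra.
Qed.

End comparison.
End layers.

(** * Velocity integrals of the excess *)

Section excess.
Context {R : realType}.
Local Notation mu := (@lebesgue_measure R).

Lemma measurable_excess (v : R) : measurable_fun [set: R] (fun u : R => excess u v).
Proof.
rewrite /excess; apply: measurable_funB; last first.
  by apply: measurable_fun_ifT => //; exact: measurable_fun_ltr.
by apply: measurable_funB; apply: measurable_maxr => //; exact: measurable_funD.
Qed.

Let mexcessE (c v : R) : measurable_fun [set: R] (fun y : R => (excess (c - y) v)%:E).
Proof.
apply/measurable_EFinP; apply: (measurableT_comp (measurable_excess v)).
exact: measurable_funB.
Qed.

Let e0 (c v y : R) : (0 <= (excess (c - y) v)%:E)%E.
Proof. by rewrite lee_fin excess_ge0. Qed.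

Let tent (a : R) : 0 <= a ->
  (\int[mu]_(x in `[0%R, a]) x%:E <= (a ^+ 2 / 2)%:E)%E.
Proof.
rewrite le_eqVlt => /orP[/eqP <-|a0].
  by rewrite set_itv1 integral_set1 lee_fin expr0n/= mul0r.
have D (x : R) : is_derive x 1 (fun x : R => x ^+ 2 / 2) x.
  by apply: is_derive_eq; rewrite /GRing.scale/=; lra.
have cf : continuous (fun x : R => x ^+ 2 / 2).
  move=> x; apply: differentiable_continuous; apply/derivable1_diffP; exact: (@ex_derive _ _ _ _ _ _ _ (D x)).
rewrite (@continuous_FTC2 _ id (fun x => x ^+ 2 / 2))//.
- by rewrite expr0n/= mul0r sube0.
- by apply: continuous_subspaceT => x; exact: cvg_id.
- split.
  + by move=> x _; exact: (@ex_derive _ _ _ _ _ _ _ (D x)).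
  + by apply: cvg_at_right_filter; exact: cf.
  + by apply: cvg_at_left_filter; exact: cf.
- by move=> x _; rewrite derive1E; exact: (@derive_val _ _ _ _ _ _ _ (D x)).
Qed.

(** As a function of [u], the excess is a right triangle of height and base [|v|]. *)
Lemma integral_excess (v : R) : (\int[mu]_u (excess u v)%:E <= (v ^+ 2 / 2)%:E)%E.
Proof.
have mE : measurable_fun [set: R] (fun u : R => (excess u v)%:E).
  by apply/measurable_EFinP; exact: measurable_excess.
have E0 (u : R) : (0 <= (excess u v)%:E)%E by rewrite lee_fin excess_ge0.
have key (h : R -> R) : measurable_fun setT h ->
    (forall x, excess (h x) v <= (id \_ `[0, `|v|]) x) ->
    (\int[mu]_x (excess (h x) v)%:E <= (v ^+ 2 / 2)%:E)%E.
  move=> mh H; rewrite -(real_normK (num_real v)).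
  apply: le_trans (tent (normr_ge0 v)).
  rewrite [leRHS]integral_mkcond; apply: ge0_le_integral => //.
  - by apply/measurable_EFinP; apply: (measurableT_comp (measurable_excess v)).
  - by apply/(measurable_restrictT _ _).1 => //; exact/measurable_EFinP.
  - by move=> x _; apply: le_trans (_ : (((id \_ `[0, `|v|]) x)%:E <= _)%E);
      rewrite ?lee_fin// !patchE; case: ifP.
have [v0|v0] := lerP 0 v.
  rewrite -(@ge0_integral_translate _ (fun u => (excess u v)%:E) v)//.
  apply: key; first exact: measurable_funB.
  move=> x; rewrite ger0_norm// patchE; case: ifPn => [|/negP]; rewrite inE/= in_itv/= /excess; last move/negP.
    by move=> /andP[x0 xv]; case: ltP => u0; case: (lerP 0 (x - v + v)) => uv; case: (lerP 0 (x - v)) => ?; lra.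
  rewrite (_ : point = 0 :> R)// negb_and -!ltNge -/(excess _ _) => /orP[] H.
    by rewrite excess_eq0//; apply/idP/idP => ?; lra.
  by rewrite excess_eq0//; apply/idP/idP => ?; lra.
rewrite -(@ge0_integral_reflect _ (fun u => (excess u v)%:E) (- v))//.
apply: key; first exact: measurable_funB.
move=> x; rewrite ltr0_norm// patchE; case: ifPn => [|/negP]; rewrite inE/= in_itv/= /excess; last move/negP.
  by move=> /andP[x0 xv]; case: ltP => u0; case: (lerP 0 (- v - x + v)) => uv; case: (lerP 0 (- v - x)) => ?; lra.
rewrite (_ : point = 0 :> R)// negb_and -!ltNge -/(excess _ _) => /orP[] H.
  by rewrite excess_eq0//; apply/idP/idP => ?; lra.
by rewrite excess_eq0//; apply/idP/idP => ?; lra.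
Qed.

(** The kinetic energies that contribute are at least [a], where their density
    is at most the density at [a]. *)
Lemma integral_excess_kinetic (a w d : R) : 0 < a -> a <= w -> a <= w + d ->
  (\int[mu]_v (excess (w - v ^+ 2 / 2) d)%:E <= (Num.sqrt 2 * isq a * (d ^+ 2 / 2))%:E)%E.
Proof.
move=> a0 aw awd.
rewrite (@ge0_integral_kinetic _ (fun y => (excess (w - y) d)%:E))//.
rewrite EFinM; apply: (@le_trans _ _ ((Num.sqrt 2 * isq a)%:E * \int[mu]_y (excess (w - y) d)%:E)%E); last first.
  rewrite lee_pmul2l ?lte_fin ?mulr_gt0 ?isq_gt0 ?sqrtr_gt0//.
  rewrite (@ge0_integral_reflect _ (fun u => (excess u d)%:E))//; first exact: integral_excess.
  - by apply/measurable_EFinP; exact: measurable_excess.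
  - by move=> y; rewrite lee_fin excess_ge0.
rewrite -ge0_integralZl//; last by rewrite lee_fin mulr_ge0 ?isq_ge0.
apply: ge0_le_integral => //.
- by move=> y _; rewrite mule_ge0 ?lee_fin ?excess_ge0// mulr_ge0 ?isq_ge0.
- apply: emeasurable_funM; last exact: mexcessE.
  by apply/measurable_EFinP; apply: measurable_funM => //; exact: measurable_isq.
- by apply: emeasurable_funM => //; exact: mexcessE.
move=> y _; rewrite -!EFinM lee_fin.
have [ay|ya] := lerP a y.
  by rewrite ler_wpM2r ?excess_ge0// ler_wpM2l ?le_isq.
rewrite (_ : excess _ _ = 0) ?mulr0//; rewrite /excess.
by case: ltP => u0; case: (lerP 0 (w - y + d)) => uv; case: (lerP 0 (w - y)) => ?; lra.
all: exact: mexcessE.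
Qed.

(** Only the kinetic energies between [p] and [q] contribute, each at most
    [|d|]. *)
Lemma integral_excess_shell (p q w d : R) : p <= q ->
  (forall y, 0 <= y -> y < p -> excess (w - y) d = 0) -> (forall y, 0 <= y -> q <= y -> excess (w - y) d = 0) ->
  (\int[mu]_v (excess (w - v ^+ 2 / 2) d)%:E <= (`|d| * (2 * Num.sqrt 2 * (Num.sqrt q - Num.sqrt p)))%:E)%E.
Proof.
move=> pq lo hi; rewrite EFinM.
set A : set (measurableTypeR R) := [set v : R | (p <= v ^+ 2 / 2) && (v ^+ 2 / 2 < q)].
have mA : measurable A := measurable_shell p q.
apply: (@le_trans _ _ (`|d|%:E * mu A)%E); last first.
  by rewrite lee_wpmul2l ?lee_fin// shell_measure.
rewrite -integral_cst// integral_mkcond; apply: ge0_le_integral => //.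
- have mk : measurable_fun [set: R] (fun v : R => v ^+ 2 / 2) by apply: measurable_funM.
  exact: (measurableT_comp (mexcessE w d) mk).
- exact/(measurable_restrictT _ _).1.
move=> v _; rewrite patchE; case: ifPn.
  move=> _; rewrite lee_fin /excess; have := ler_norm d; have := ler_norm (- d); rewrite normrN.
  set u := w - _.
  by case: (ltP 0 u) => u0; case: (lerP 0 (u + d)) => uv; case: (lerP 0 u) => ?; lra.
rewrite notin_setE /A/= => H; rewrite lee_fin.
have v0 : 0 <= v ^+ 2 / 2 by rewrite divr_ge0 ?sqr_ge0.
have [vp|vp] := ltP (v ^+ 2 / 2) p; first by rewrite lo.
by have [vq|vq] := ltP (v ^+ 2 / 2) q; [case: H; rewrite vp vq|rewrite hi].
Qed.

(** The coefficient of [sqrt 2 * e ^+ 2] in a bound for the velocity integral of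
    the excess, uniform in displacements [e] up to [d]. Away from the boundary
    [w = 0] of the well the density of the kinetic energy is nearly constant over
    the displacement, and the coefficient tends to its exact value [isq w / 2];
    near the boundary it is only right up to a constant factor. *)
Definition curvature (d w : R) : R :=
  if w < 0 then if `|w| < d then 2 * isq `|w| else 0
  else if 2 * d <= w then isq (w - d) / 2 else 2 * isq w.

Lemma integral_excess_curvature (d e w : R) : w != 0 -> `|e| <= d ->
  (\int[mu]_v (excess (w - v ^+ 2 / 2) e)%:E <= (Num.sqrt 2 * e ^+ 2 * curvature d w)%:E)%E.
Proof.
move=> w0 ed; rewrite /curvature.
have [e1 e2] : e <= d /\ - e <= d by split; apply: le_trans ed; [exact: ler_norm|rewrite -normrN ler_norm].
have s2 : 0 <= Num.sqrt 2 :> R by exact: sqrtr_ge0.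
have ex0 (u v : R) : (u <= 0 /\ u + v <= 0) \/ (0 < u /\ 0 <= u + v) -> excess u v = 0.
  by rewrite /excess; case: ltP => u0; case: (lerP 0 (u + v)) => uv; case: (lerP 0 u) => ?; lra.
case: ifPn => [wn|]; last rewrite -leNgt le_eqVlt eq_sym (negbTE w0)/= => wp.
  pose q := Num.max 0 (w + e).
  have q0 : 0 <= q by rewrite le_max lexx.
  apply: le_trans (@integral_excess_shell 0 q w e q0 _ _) _.
  - by move=> y y0; rewrite ltNge y0.
  - by move=> y y0; rewrite ge_max => /andP[_ yq]; apply: ex0; left; lra.
  rewrite lee_fin sqrtr0 subr0 /q.
  rewrite (ltr0_norm wn); have [we|we] := lerP 0 (w + e); last first.
    rewrite sqrtr0 !mulr0 mulr_ge0 ?(mulr_ge0 s2) ?sqr_ge0//.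
    by case: ifP => // _; rewrite mulr_ge0 ?isq_ge0.
  have e0' : 0 < e by lra.
  rewrite (gtr0_norm e0').
  case: ifPn => [wd|]; last first.
    rewrite -leNgt => dw; have -> : w + e = 0 by lra.
    by rewrite sqrtr0 !mulr0.
  rewrite (_ : e * _ = Num.sqrt 2 * e * (2 * Num.sqrt (w + e))); last by ring.
  rewrite expr2 !mulrA -[leRHS]mulrA -!(mulrA (Num.sqrt 2 * e)) ler_wpM2l ?mulr_ge0 ?(ltW e0')//.
  rewrite mulrCA ler_pM2l// /isq ler_pdivlMr ?sqrtr_gt0; last by lra.
  have w1 : 0 <= - w by lra.
  have := sqr_sqrtr we; have := sqr_sqrtr w1.
  set a := Num.sqrt (- w); set b := Num.sqrt (w + e) => ha hb.
  by have := sqr_ge0 (a - b); rewrite sqrrB; nra.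
have d0 : 0 <= d := le_trans (normr_ge0 e) ed.
case: ifPn => [dw|_].
  rewrite (_ : Num.sqrt 2 * e ^+ 2 * (isq (w - d) / 2) = Num.sqrt 2 * isq (w - d) * (e ^+ 2 / 2)); last by ring.
  have [->|e0'] := eqVneq e 0.
    rewrite (_ : (fun _ => _) = cst 0%E) ?integral0; last first.
      by apply/funext => v /=; rewrite ex0//; case: (lerP 0 (w - v ^+ 2 / 2)); lra.
    by rewrite lee_fin expr0n/= mul0r mulr0.
  have e3 : 0 < `|e| by rewrite normr_gt0.
  by apply: integral_excess_kinetic; lra.
have [e3|e3] := lerP 0 e.
  apply: le_trans (@integral_excess_shell w (w + e) w e _ _ _) _; first by lra.
  - by move=> y y0 yw; apply: ex0; right; lra.
  - by move=> y y0 yw; apply: ex0; left; lra.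
  rewrite lee_fin ger0_norm//.
  have : Num.sqrt (w + e) - Num.sqrt w <= e * isq w.
    have we : 0 < w + e by lra.
    have := @sqrt_shell _ (w + e) e we e3; rewrite addrK => /le_trans; apply.
    by rewrite ler_wpM2l// le_isq//; lra.
  set z := Num.sqrt _ - _ => ze.
  rewrite (_ : e * _ = Num.sqrt 2 * e * 2 * z); last by ring.
  rewrite (_ : Num.sqrt 2 * e ^+ 2 * _ = Num.sqrt 2 * e * 2 * (e * isq w)); last by ring.
  by rewrite ler_wpM2l// !mulr_ge0.
apply: le_trans (@integral_excess_shell (w + e) w w e _ _ _) _; first by lra.
- by move=> y y0 yw; apply: ex0; right; lra.
- by move=> y y0 yw; apply: ex0; left; lra.
rewrite lee_fin ltr0_norm//.
have : Num.sqrt w - Num.sqrt (w + e) <= - e * isq w.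
  by have := @sqrt_shell _ w (- e) wp; rewrite opprK; apply; lra.
set z := Num.sqrt _ - _ => ze.
rewrite (_ : - e * _ = Num.sqrt 2 * - e * 2 * z); last by ring.
rewrite (_ : Num.sqrt 2 * e ^+ 2 * _ = Num.sqrt 2 * - e * 2 * (- e * isq w)); last by ring.
by rewrite ler_wpM2l// !mulr_ge0//; lra.
Qed.

Lemma curvature_ge0 (d w : R) : 0 <= curvature d w.
Proof.
by rewrite /curvature; case: ifP => _; case: ifP => // _; rewrite ?divr_ge0 ?mulr_ge0 ?isq_ge0.
Qed.

Lemma curvature_le (d w : R) : 0 <= d -> curvature d w <= 2 * isq `|w|.
Proof.
move=> d0; rewrite /curvature; case: ltP => w0; first by case: ifP => // _; rewrite mulr_ge0 ?isq_ge0.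
rewrite ger0_norm//; case: ifP => // dw; move: w0; rewrite le_eqVlt => /orP[/eqP wE|wp].
  by rewrite -wE in dw *; rewrite !isq_le0; lra.
rewrite ler_pdivrMr// (_ : 2 * _ * 2 = 2 * (2 * isq w)); last by ring.
apply: (@le_trans _ _ (2 * isq w)); last by rewrite ler_peMl ?mulr_ge0 ?isq_ge0 ?ler1n.
rewrite (_ : 2 * isq w = isq (w / 4)); first by apply: le_isq; lra.
rewrite isqM ?(ltW wp)// mulrC; congr (_ * _).
rewrite (_ : 4^-1 = (2^-1) ^+ 2 :> R); last by lra.
by rewrite /isq sqrtr_sqr ger0_norm ?invrK// invr_ge0.
Qed.

Lemma curvature_cvg (d : R^nat) (w : R) : w != 0 -> d @ \oo --> (0 : R) ->
  curvature (d n) w @[n --> \oo] --> isq w / 2.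
Proof.
move=> w0 d0; have w1 : 0 < `|w| by rewrite normr_gt0.
have nd : \forall n \near \oo, d n < `|w| / 2.
  by apply: cvgr_lt d0 _ _; lra.
have [wn|wp] := ltP w 0.
  rewrite [isq w]isq_le0 ?ltW// mul0r.
  apply: cvg_near_cst; near=> n; rewrite /curvature wn ifF//.
  apply/negbTE; rewrite -leNgt.
  have : d n < `|w| / 2 by near: n. lra.
have wp' : 0 < w by rewrite lt_neqAle eq_sym w0.
have E : \forall n \near \oo, isq (w - d n) / 2 = curvature (d n) w.
  near=> n; rewrite /curvature ltNge wp/= ifT//.
  have : d n < `|w| / 2 by near: n.
  by rewrite ger0_norm//; lra.
apply: cvg_trans (near_eq_cvg E) _.
apply: cvgMl; rewrite /isq; apply: cvgV; first by rewrite gt_eqF// sqrtr_gt0.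
apply: continuous_cvg; first exact: sqrt_continuous.
by rewrite -[X in _ --> X]subr0; apply: cvgB => //; exact: cvg_cst.
Unshelve. all: by end_near.
Qed.

Lemma measurable_curvature (d : R) : measurable_fun [set: R] (curvature d).
Proof.
have mi (f : R -> R) : measurable_fun setT f -> measurable_fun setT (fun x => isq (f x)).
  by move=> mf; exact: (measurableT_comp measurable_isq).
apply: measurable_fun_ifT.
- exact: measurable_fun_ltr.
- apply: measurable_fun_ifT => //; first exact: measurable_fun_ltr.
  by apply: measurable_funM => //; apply: mi.
- apply: measurable_fun_ifT => //; first exact: measurable_fun_ler.
  + by apply: measurable_funM => //; apply: mi; exact: measurable_funB.
  + by apply: measurable_funM => //; apply: mi.
Qed.

End excess.

(** * The stability criterion bounds the quadratic remainder *)

(** Monotonicity holds without measurability, for the integral of a nonnegative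
   function is a supremum over the simple functions below it. *)
Lemma ge0_integral_mono d (T : measurableType d) (R : realType)
    (mu : {measure set T -> \bar R}) (D : set T) (f g : T -> \bar R) :
  (forall x, D x -> (0 <= f x)%E) -> (forall x, D x -> (f x <= g x)%E) ->
  (\int[mu]_(x in D) f x <= \int[mu]_(x in D) g x)%E.
Proof.
move=> f0 fg.
have h0 x : (0 <= (f \_ D) x)%E by rewrite patchE; case: ifP => // /set_mem; exact: f0.
have hg x : ((f \_ D) x <= (g \_ D) x)%E.
  by rewrite !patchE; case: ifP => // /set_mem; exact: fg.
rewrite !(integral_mkcond D) !ge0_integralTE//; last first.
  by move=> x; exact: le_trans (hg x).
apply: ereal_sup_le => _ [h /= hf <-]; 
by exists h => // x; exact: le_trans (hf x) (hg x).
Qed.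

Section well_averages.
Context {R : realType}.
Local Notation mu := (@lebesgue_measure R).
Local Notation T := (measurableTypeR R).
Variable m0 : R.

Let f (z : T * T) : R := isq (z.1 + m0 * cos z.2).

Lemma measurable_isq_well : measurable_fun setT f.
Proof.
apply: (measurableT_comp measurable_isq); apply: measurable_funD => //.
apply: measurable_funM => //.
apply: measurableT_comp => //.
by apply: continuous_measurable_fun; exact: continuous_cos.
Qed.

Let g (z : T * T) : R := (1 + cos z.2) * f z.

Let cos1 (t : R) : 0 <= 1 + cos t <= 2.
Proof. by have := cos_geN1 t; have := cos_le1 t; lra. Qed.

Let g0 z : 0 <= g z.
Proof. by rewrite mulr_ge0 ?isq_ge0//; have /andP[] := cos1 z.2. Qed.

Let mcos2 : measurable_fun setT (fun z : T * T => 1 + cos z.2).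
Proof.
apply: measurable_funD => //.
apply: measurableT_comp => //.
by apply: continuous_measurable_fun; exact: continuous_cos.
Qed.

Let mg : measurable_fun setT g.
Proof. by apply: measurable_funM => //; exact: measurable_isq_well. Qed.

Definition well_period (e : R) : \bar R :=
  (\int[mu]_(t in `[0%R, (2 * pi)%R]) (isq (e + m0 * cos t))%:E)%E.

Definition well_moment (e : R) : \bar R :=
  (\int[mu]_(t in `[0%R, (2 * pi)%R]) ((1 + cos t) * isq (e + m0 * cos t))%:E)%E.

(** The average of [1 + cos] in time over the orbit of energy [e]. *)
Definition center (e : R) : R := fine (well_moment e) / fine (well_period e).

Lemma well_period_ge0 e : (0 <= well_period e)%E.
Proof. by apply: integral_ge0 => t _; rewrite lee_fin isq_ge0. Qed.

Lemma well_moment_ge0 e : (0 <= well_moment e)%E.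
Proof. by apply: integral_ge0 => t _; rewrite lee_fin (g0 (e, t)). Qed.

Lemma measurable_well_period : measurable_fun [set: R] well_period.
Proof.
apply: (@measurable_integral_sectionr _ _ _ _ _ mu _ (fun z => (f z)%:E)) => //.
  by apply/measurable_EFinP; exact: measurable_isq_well.
by move=> z; rewrite lee_fin isq_ge0.
Qed.

Let mwm : measurable_fun [set: R] well_moment.
Proof.
apply: (@measurable_integral_sectionr _ _ _ _ _ mu _ (fun z => (g z)%:E)) => //.
by apply/measurable_EFinP.
Qed.

Lemma measurable_center : measurable_fun [set: R] center.
Proof.
apply: measurable_funM; first by apply: measurableT_comp.
have -> : (fun x => (fine (well_period x))^-1) = (fun x => isq (fine (well_period x)) ^+ 2).
  apply/funext => x; rewrite sqr_isq (max_idPr _)// fine_ge0// well_period_ge0//.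
apply: measurable_funX; apply: (measurableT_comp measurable_isq).
by apply: measurableT_comp => //; exact: measurable_well_period.
Qed.

Let m1 (h : T * T -> R) e : measurable_fun setT h ->
  measurable_fun `[0%R, (2 * pi)%R] (fun t : T => (h (e, t))%:E).
Proof.
move=> mh; apply/measurable_EFinP; apply: measurable_funTS.
by apply: (measurableT_comp mh); exact: measurable_pair1.
Qed.

Lemma well_moment_le e : (well_moment e <= 2%:E * well_period e)%E.
Proof.
rewrite -ge0_integralZl//; last 2 first.
- exact: m1 measurable_isq_well.
- by move=> t _; rewrite lee_fin isq_ge0.
apply: ge0_le_integral => //.
- by move=> t _; rewrite lee_fin (g0 (e, t)).
- exact: (m1 _ mg).
- by apply: emeasurable_funM => //; exact: m1 measurable_isq_well.
- by move=> t _; rewrite -EFinM lee_fin ler_wpM2r ?isq_ge0//; have /andP[] := cos1 t.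
Qed.

Lemma center_itv e : 0 <= center e <= 2.
Proof.
have M0 := well_moment_ge0 e; have P0 := well_period_ge0 e.
rewrite divr_ge0 ?fine_ge0//=.
have := well_moment_le e; rewrite /center; move: M0 P0.
case: (well_period e) => [p| |]// M0; last by rewrite /= invr0 mulr0.
rewrite lee_fin le_eqVlt => /orP[/eqP <-|p0]; first by rewrite /= invr0 mulr0.
by move: M0; case: (well_moment e) => [m| |]//= _; rewrite -EFinM lee_fin ler_pdivrMr.
Qed.

Definition quotient (e t : R) : R :=
  if ((0 < well_period e) && (well_period e < +oo))%E then 1 + cos t - center e else 0.

Hypothesis m0_gt0 : 0 < m0.

(** The quotient of the stability criterion is the deviation of the cosine from
    its average over the orbit. When the period is zero or infinite, the
    left-hand side is a division by zero. *)
Lemma well_quotientE (x : R * R) :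
  (\int[leb]_(t in wells m0 x) ((cos x.1 - cos t) * inv_speed m0 x t)) /
  (\int[leb]_(t in wells m0 x) inv_speed m0 x t) = quotient (e0 m0 x) x.1.
Proof.
set e := e0 m0 x.
have wE : wells m0 x = `[0, 2 * pi]%classic `&` [set t | 0 < e + m0 * cos t].
  by apply/seteqP; split => t [h1 h2]; split => //; move: h2; rewrite /= /phi0 -/e; lra.
have iE t : 0 < e + m0 * cos t -> inv_speed m0 x t = isq (e + m0 * cos t).
  by move=> t0; rewrite /inv_speed /isq /phi0 -/e powRN mulNr opprK powR12_sqrt// ltW.
have red (h : R -> R) (k : R -> R) :
   (forall t, 0 < e + m0 * cos t -> h t = k t) ->
   (forall t, e + m0 * cos t <= 0 -> k t = 0) ->
   \int[leb]_(t in wells m0 x) h t = \int[leb]_(t in `[0, 2 * pi]) k t.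
  move=> h1 h2; rewrite /Rintegral wE integral_mkcondr; congr fine.
  apply: eq_integral => t _; rewrite patchE; case: ifPn.
    by move=> /set_mem/= t0; rewrite h1.
  by rewrite notin_setE/= => /negP; rewrite -leNgt => t0; rewrite h2.
rewrite (red (inv_speed m0 x) (fun t => isq (e + m0 * cos t)) iE)//; last by move=> t; exact: isq_le0.
rewrite (red (fun t => (cos x.1 - cos t) * inv_speed m0 x t) (fun t => (1 + cos x.1) * isq (e + m0 * cos t) - (1 + cos t) * isq (e + m0 * cos t))); first last.
- by move=> t t0; rewrite isq_le0// !mulr0 subr0.
- by move=> t t0; rewrite iE//; lra.
rewrite {2}/Rintegral -/(well_period e) /quotient.
have P0 := well_period_ge0 e; have M0 := well_moment_ge0 e.
case: ifPn => [/andP[p0 py]|]; last first.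
  move: P0; case: (well_period e) => [p| |]// p0; last by rewrite /= invr0 mulr0.
  rewrite ltry andbT -leNgt lee_fin => p0'; rewrite lee_fin in p0.
  by rewrite (_ : p = 0) /= ?invr0 ?mulr0//; apply/eqP; rewrite eq_le p0 p0'.
have My : (well_moment e < +oo)%E.
  by apply: le_lt_trans (well_moment_le e) _; rewrite lte_mul_pinfty ?lee_fin.
have i1 : leb.-integrable `[0, 2 * pi] (EFin \o (fun t : R => isq (e + m0 * cos t))).
  apply/integrableP; split; first exact: m1 measurable_isq_well.
  apply: le_lt_trans py; apply: ge0_le_integral => //.
  - by apply: measurableT_comp => //; exact: m1 measurable_isq_well.
  - exact: m1 measurable_isq_well.
  - by move=> t _; rewrite gee0_abs// lee_fin isq_ge0.
have i2 : leb.-integrable `[0, 2 * pi] (EFin \o (fun t : R => (1 + cos t) * isq (e + m0 * cos t))).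
  apply/integrableP; split; first exact: m1 mg.
  apply: le_lt_trans My; apply: ge0_le_integral => //.
  - by apply: measurableT_comp => //; exact: m1 mg.
  - exact: m1 mg.
  - by move=> t _; rewrite gee0_abs// lee_fin (g0 (e, t)).
rewrite RintegralB//; last first.
  rewrite (_ : _ \o _ = fun t => (1 + cos x.1)%:E * (EFin \o (fun t : R => isq (e + m0 * cos t))) t)%E//.
  exact: integrableZl.
rewrite RintegralZl// {1}/Rintegral -/(well_period e) {1}/Rintegral -/(well_moment e) mulrBl mulfK//.
by rewrite gt_eqF// fine_gt0// p0 py.
Qed.

End well_averages.

Section curvature_bound.
Context {R : realType}.
Local Notation mu := (@lebesgue_measure R).
Local Notation T := (measurableTypeR R).
Variables (F : R -> R) (estar : \bar R) (m0 : R).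
Hypothesis hF : profile_with_cutoff F estar.
Hypothesis m0_gt0 : 0 < m0.
Hypothesis m0e : ((- m0)%:E < estar)%E.
Hypothesis hlog : estar = m0%:E ->
    (\int[mu]_(e in `](- m0)%R, m0[%classic) (ln (m0 - e) * derive1 F e)%:E < +oo)%E.

Let S := F (- m0).
Local Notation lev := (level hF m0).
Local Notation tor := (`[0%R, (2 * pi)%R]%classic : set T).

Let mlev : measurable_fun [set: R] lev. Proof. exact: measurable_level. Qed.

(** The recentring by the orbit average is the choice that makes the quadratic
    remainder smallest. *)
Definition recentred (s t : R) : R := 1 + cos t - center m0 (lev s).

Lemma recentred_le s t : `|recentred s t| <= 2.
Proof.
have := center_itv m0 (lev s); rewrite /recentred.
by have := cos_geN1 t; have := cos_le1 t; rewrite ler_norml; lra.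
Qed.

Let recentred_sqr s t : recentred s t ^+ 2 <= 4.
Proof.
rewrite -[recentred s t ^+ 2]ger0_norm ?sqr_ge0// normrX (_ : 4 = 2 ^+ 2); last by lra.
by rewrite ler_pXn2r ?nnegrE// recentred_le.
Qed.

Let mw : measurable_fun setT (fun z : T * T => lev z.1 + m0 * cos z.2).
Proof.
apply: measurable_funD; first exact: measurableT_comp.
apply: measurable_funM => //; apply: measurableT_comp => //.
by apply: continuous_measurable_fun; exact: continuous_cos.
Qed.

Lemma measurable_recentred : measurable_fun setT (fun z : T * T => recentred z.1 z.2).
Proof.
apply: measurable_funB.
  apply: measurable_funD => //; apply: measurableT_comp => //.
  by apply: continuous_measurable_fun; exact: continuous_cos.
apply: (measurableT_comp (measurable_center m0)); exact: measurableT_comp.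
Qed.

(** Half of this is the coefficient of the quadratic remainder. *)
Definition orbit_variance : \bar R :=
  (\int[mu]_(s in `]0%R, S[) \int[mu]_(t in tor)
     (Num.sqrt 2 * recentred s t ^+ 2 * isq (lev s + m0 * cos t))%:E)%E.

Let V (z : T * T) : R := Num.sqrt 2 * recentred z.1 z.2 ^+ 2 * isq (lev z.1 + m0 * cos z.2).

Let mV : measurable_fun setT V.
Proof.
apply: measurable_funM; last exact: (measurableT_comp measurable_isq).
by apply: measurable_funM => //; apply: measurable_funX; exact: measurable_recentred.
Qed.

Let V0 z : 0 <= V z. Proof. by rewrite /V mulr_ge0 ?isq_ge0// mulr_ge0 ?sqr_ge0. Qed.

Let period_fin : {ae mu, forall s, `]0, S[%classic s -> (well_period m0 (lev s) < +oo)%E}.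
Proof.
have i : mu.-integrable `]0, S[ (fun s : T => period m0 (lev s)).
  apply/integrableP; split.
    apply: measurable_funTS; apply: (measurableT_comp (measurable_period m0)); exact: mlev.
  under eq_integral do rewrite gee0_abs ?period_ge0//.
  exact: integral_period_level.
have mS : measurable (`]0, S[%classic : set T) by exact: measurable_itv.
have := integrable_ae mS i; apply: filterS => s H sS.
have : (period m0 (lev s) < +oo)%E by rewrite -ge0_fin_numE ?period_ge0// H.
apply: le_lt_trans; apply: ge0_integral_mono => t _; first by rewrite lee_fin isq_ge0.
rewrite lee_fin; set w := lev s + _.
have [w0|w0] := lerP w 0; first by rewrite (isq_le0 w0) isq_ge0.
by rewrite gtr0_norm.
Qed.

Let Q (e t : R) : R := Num.sqrt 2 * isq (e + m0 * cos t) * quotient m0 e t ^+ 2.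

Let mQ : measurable_fun setT (fun z : T * T => Q z.1 z.2).
Proof.
apply: measurable_funM.
  by apply: measurable_funM => //; exact: measurable_isq_well.
apply: measurable_funX.
have mP : measurable_fun setT (fun z : T * T => well_period m0 z.1).
  by apply: (measurableT_comp (measurable_well_period m0)).
apply: measurable_fun_ifT => //.
  apply: measurable_and; first exact: measurable_fun_lte.
  exact: measurable_fun_lte.
apply: measurable_funB.
  apply: measurable_funD => //; apply: measurableT_comp => //.
  by apply: continuous_measurable_fun; exact: continuous_cos.
by apply: (measurableT_comp (measurable_center m0)).
Qed.

Let Q0 e t : 0 <= Q e t.
Proof. by rewrite mulr_ge0 ?sqr_ge0// mulr_ge0 ?isq_ge0. Qed.

(** The substitutions [s = F e] and [e = v^2 / 2 + phi0] turn one double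
    integral into the other; the orbits of infinite period belong to a null set
    of values. *)
Lemma orbit_variance_le_kappa0 : (orbit_variance <= kappa0 F m0)%E.
Proof.
apply: (@le_trans _ _ (\int[mu]_(s in `]0%R, S[) \int[mu]_(t in tor) (Q (lev s) t)%:E)%E).
  apply: ae_ge0_le_integral => //.
  - by move=> s _; apply: integral_ge0 => t _; rewrite lee_fin (V0 (s, t)).
  - apply: measurable_funTS; apply: (@measurable_integral_sectionr _ _ _ _ _ mu _ (fun z => (V z)%:E)) => //.
      exact/measurable_EFinP.
  - by move=> s _; apply: integral_ge0 => t _; rewrite lee_fin.
  - have mI : measurable_fun [set: R] (fun e => \int[mu]_(t in tor) (Q e t)%:E)%E.
      apply: (@measurable_integral_sectionr _ _ _ _ _ mu _ (fun z => (Q z.1 z.2)%:E)) => //.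
        exact/measurable_EFinP.
      by move=> z; rewrite lee_fin.
    by apply: measurable_funTS; exact: (measurableT_comp mI mlev).
  - case: period_fin => N [mN N0 NS]; exists N; split => // s /= Hs; apply: NS => /= H.
    apply: Hs => sS; have {}H := H sS.
    have [P0|P0] := ltP 0%E (well_period m0 (lev s)).
      rewrite le_eqVlt; apply/orP; left; apply/eqP; apply: eq_integral => t _.
      by rewrite /Q /quotient P0 H /= /recentred mulrAC.
    apply: (@le_trans _ _ 0%E); last by apply: integral_ge0 => t _; rewrite lee_fin.
    apply: (@le_trans _ _ ((Num.sqrt 2 * 4)%:E * well_period m0 (lev s))%E); last first.
      by rewrite mule_ge0_le0// lee_fin mulr_ge0.
    have mi : measurable_fun tor (fun t : T => (isq (lev s + m0 * cos t))%:E).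
      apply/measurable_EFinP; apply: measurable_funTS.
      apply: (measurableT_comp measurable_isq); apply: measurable_funD => //; apply: measurable_funM => //.
      by apply: continuous_measurable_fun; exact: continuous_cos.
    rewrite -ge0_integralZl ?lee_fin ?mulr_ge0//; last by move=> t _; rewrite lee_fin isq_ge0.
    apply: ge0_integral_mono => t _; first by rewrite lee_fin (V0 (s, t)).
    by rewrite -EFinM lee_fin ler_wpM2r ?isq_ge0// ler_wpM2l// recentred_sqr.
have mslope : measurable_fun [set: R] (fun e => (slope F estar e)%:E).
  by apply/measurable_EFinP; exact: measurable_slope.
have sp0 e : (0 <= (slope F estar e)%:E)%E by rewrite lee_fin slope_ge0.
pose K (z : T * T) : \bar R := (slope F estar (e0 m0 z) * quotient m0 (e0 m0 z) z.1 ^+ 2)%:E.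
have K0 z : (0 <= K z)%E by rewrite lee_fin mulr_ge0 ?slope_ge0 ?sqr_ge0.
have mcos : measurable_fun [set: R] (@cos R).
  by apply: continuous_measurable_fun; exact: continuous_cos.
have me0 : measurable_fun setT (e0 m0 : T * T -> R).
  apply: measurable_funD; first by apply: measurable_funM => //; exact: measurable_funX.
  by apply: measurable_funM => //; exact: measurableT_comp.
have mquot : measurable_fun setT (fun z : T * T => quotient m0 z.1 z.2).
  have mP : measurable_fun setT (fun z : T * T => well_period m0 z.1).
    by apply: (measurableT_comp (measurable_well_period m0)).
  apply: measurable_fun_ifT => //.
    by apply: measurable_and; exact: measurable_fun_lte.
  apply: measurable_funB.
    by apply: measurable_funD => //; apply: measurableT_comp.
  by apply: (measurableT_comp (measurable_center m0)).
have mK : measurable_fun setT K.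
  apply/measurable_EFinP; apply: measurable_funM.
    by apply: (measurableT_comp _ me0); exact: measurable_slope.
  apply: measurable_funX.
  apply: (measurableT_comp mquot (g := fun z : T * T => (e0 m0 z, z.1))).
  exact: measurable_fun_pair.
apply: (@le_trans _ _ (\int[leb2]_(x in strip) K x)%E); last first.
  apply: ge0_integral_mono => // x _.
  rewrite lee_fin well_quotientE// ler_wpM2r ?sqr_ge0// /slope patchE.
  by rewrite (_ : point = 0 :> R)//; case: ifP.
rewrite (@tonelli_on1 _ _ _ _ _ mu mu _ _ (measurable_itv _) measurableT K mK K0).
rewrite (@tonelli_on _ _ _ _ _ mu mu _ _ (measurable_itv _) (measurable_itv _)
  (fun z => (Q (lev z.1) z.2)%:E)); first last.
- by move=> z; rewrite lee_fin.
- apply/measurable_EFinP; apply: (measurableT_comp mQ (g := fun z : T * T => (lev z.1, z.2))).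
  by apply: measurable_fun_pair => //; exact: measurableT_comp.
apply: ge0_integral_mono => t _.
  by apply: integral_ge0 => s _; rewrite lee_fin.
have mQt : measurable_fun [set: R] (fun e : R => (Q e t)%:E).
  apply/measurable_EFinP; apply: (measurableT_comp mQ (g := fun e : T => (e, t))).
  exact: measurable_fun_pair.
rewrite (@ge0_integral_level _ _ _ hF m0 _ mQt); last by move=> e; rewrite lee_fin.
pose G (e : R) := ((slope F estar e)%:E * (Q e t)%:E)%E.
have mG : measurable_fun [set: R] G by exact: emeasurable_funM.
have G0 e : (0 <= G e)%E by rewrite mule_ge0// lee_fin.
apply: (@le_trans _ _ (\int[mu]_e G e)%E).
  have mI : measurable (`](- m0)%R, +oo[%classic : set T) by exact: measurable_itv.
  apply: (@le_trans _ _ (\int[mu]_(e in `](- m0)%R, +oo[) G e)%E) => //.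
  by apply: ge0_subset_integral => //; exact: measurableT.
rewrite -(@ge0_integral_translate _ G (m0 * cos t))//.
pose g (y : R) := (slope F estar (y - m0 * cos t) * quotient m0 (y - m0 * cos t) t ^+ 2)%:E.
rewrite [leRHS](_ : _ = \int[mu]_v g ((v ^+ 2 / 2)%R))%E; last first.
  by apply: eq_integral => v _; rewrite /K /g /e0 /phi0/= mulNr.
rewrite (@ge0_integral_kinetic _ g); last 2 first.
- apply/measurable_EFinP; apply: measurable_funM.
    apply: measurableT_comp; first exact: measurable_slope.
    exact: measurable_funB.
  apply: measurable_funX.
  apply: (measurableT_comp mquot (g := fun y : T => (y - m0 * cos t, t))).
  by apply: measurable_fun_pair => //; exact: measurable_funB.
- by move=> y; rewrite lee_fin mulr_ge0 ?slope_ge0 ?sqr_ge0.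
rewrite le_eqVlt; apply/orP; left; apply/eqP; apply: eq_integral => y _.
rewrite /G /g /Q -!EFinM subrK; congr EFin; ring.
Qed.

(** The velocity integral of the excess is controlled off the boundary of the
    well only; the cosine takes each value at most twice per turn. *)
Let boundary_null (c : R) : {ae mu, forall t, tor t -> c + m0 * cos t != 0}.
Proof.
pose b := acos (- c / m0).
exists ([set b] `|` [set 2 * pi - b]); split.
- by apply: measurableU; exact: measurable_set1.
- apply: null_set_setU; try exact: measurable_set1; exact: lebesgue_measure_set1.
move=> t /= /not_implyP[]; rewrite in_itv/= => /andP[t0 tpi] /negP; rewrite negbK => /eqP ct.
have ct' : cos t = - c / m0 by apply: (mulIf (lt0r_neq0 m0_gt0)); rewrite divfK ?gt_eqF//; lra.
have [tp|tp] := leP t pi.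
  by left; rewrite /b -ct' cosK// in_itv/= t0.
have cE : cos t = cos (2 * pi - t).
  by rewrite cosB (_ : 2 * pi = pi *+ 2) ?cos2pi ?sin2pi ?mul1r ?mul0r ?addr0// mulr_natl.
by right; rewrite /b -ct' cE cosK; [lra|rewrite in_itv/=; lra].
Qed.

Let Ex (t : R) (s a v : R) : \bar R :=
  (excess (lev s + m0 * cos a - v ^+ 2 / 2) (t * recentred s a))%:E.

(** Divided by [t ^+ 2], the velocity integrals of the excess are bounded by
    quantities that converge, as [t] tends to 0, to a function whose integral is
    half the orbit variance, less than [1 / 2]; the period dominates the
    convergence. *)
Lemma quadratic_excess : (kappa0 F m0 < 1)%E ->
  exists d q : R, [/\ 0 < d, 0 <= q, q < 1 / 2 & forall t : R, `|t| <= d ->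
    (\int[mu]_(s in `]0%R, S[) \int[mu]_(a in tor) \int[mu]_v Ex t s a v <= (q * t ^+ 2)%:E)%E].
Proof.
move=> kappa1.
pose d_ (n : nat) : R := n.+1%:R^-1.
have d_0 n : 0 <= d_ n by rewrite invr_ge0.
pose w (z : T * T) := lev z.1 + m0 * cos z.2.
pose A (d : R) (z : T * T) := Num.sqrt 2 * recentred z.1 z.2 ^+ 2 * curvature d (w z).
pose dom (z : T * T) : \bar R := (8 * Num.sqrt 2 * isq `|w z|)%:E.
pose D := (`]0, S[%classic : set T) `*` tor.
have mD : measurable D by apply: measurableX; exact: measurable_itv.
have A0 d z : 0 <= A d z.
  by rewrite mulr_ge0 ?curvature_ge0// mulr_ge0 ?sqr_ge0.
have mA d : measurable_fun setT (A d).
  apply: measurable_funM; last by apply: (measurableT_comp (measurable_curvature d)).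
  by apply: measurable_funM => //; apply: measurable_funX; exact: measurable_recentred.
have Adom d z : 0 <= d -> ((A d z)%:E <= dom z)%E.
  move=> d0; rewrite lee_fin (_ : 8 * _ * _ = Num.sqrt 2 * 4 * (2 * isq `|w z|)); last by ring.
  apply: ler_pM; rewrite ?curvature_ge0 ?curvature_le//.
    by rewrite mulr_ge0 ?sqr_ge0.
  by rewrite ler_wpM2l// recentred_sqr.
have mdom : measurable_fun setT dom.
  apply/measurable_EFinP; apply: measurable_funM => //.
  apply: (measurableT_comp measurable_isq); exact: measurableT_comp.
have dom0 z : (0 <= dom z)%E by rewrite lee_fin !mulr_ge0 ?isq_ge0.
have idom : (mu \x mu)%E.-integrable D dom.
  apply/integrableP; split; first exact: measurable_funTS.
  under eq_integral do rewrite gee0_abs//.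
  rewrite (@tonelli_on1 _ _ _ _ _ mu mu _ _ (measurable_itv _) (measurable_itv _) dom mdom dom0).
  rewrite (_ : integral _ _ _ = (8 * Num.sqrt 2)%:E * \int[mu]_(s in `]0%R, S[) period m0 (lev s))%E.
    by rewrite lte_mul_pinfty ?lee_fin ?mulr_ge0//; exact: integral_period_level.
  rewrite -ge0_integralZl ?lee_fin ?mulr_ge0//; last 2 first.
  - by apply: measurable_funTS; apply: (measurableT_comp (measurable_period m0)); exact: mlev.
  - by move=> s _; exact: period_ge0.
  apply: eq_integral => s _; rewrite /period -ge0_integralZl ?lee_fin ?mulr_ge0//.
  - apply/measurable_EFinP; apply: measurable_funTS; apply: (measurableT_comp measurable_isq).
    apply: measurableT_comp => //; apply: measurable_funD => //; apply: measurable_funM => //.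
    by apply: continuous_measurable_fun; exact: continuous_cos.
  - by move=> t _; rewrite lee_fin isq_ge0.
have C := @dominated_cvg _ _ _ (mu \x mu)%E D mD (fun n z => (A (d_ n) z)%:E)
  (fun z => (V z / 2)%:E) dom
  (fun n => measurable_funTS ((measurable_EFinP _ _).2 (mA (d_ n)))).
have {}C : (\int[mu \x mu]_(z in D) (A (d_ n) z)%:E)%E @[n --> \oo] -->
   (\int[mu \x mu]_(z in D) (V z / 2)%:E)%E.
  apply: C => //.
  - move=> z _; apply: cvg_EFin; first by near=> n.
    rewrite /V /A -[X in _ --> X]mulrA; apply: cvgMr.
    have d0 : d_ @ \oo --> (0 : R) by exact: cvg_harmonic.
    have [w0|w0] := eqVneq (w z) 0; last exact: curvature_cvg.
    rewrite -/(w z) w0 isq_le0// mul0r; apply: cvg_near_cst; near=> n.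
    rewrite /curvature ltxx (isq_le0 (lexx 0)) mulr0 (@isq_le0 _ (0 - _)) ?mul0r ?if_same//.
    by rewrite sub0r oppr_le0.
  - by move=> n z _; rewrite gee0_abs ?lee_fin//; exact: Adom.
have mAE d' : measurable_fun setT (fun z => (A d' z)%:E) by exact/measurable_EFinP.
have A0E d' z : (0 <= (A d' z)%:E)%E by rewrite lee_fin.
have half : (\int[mu \x mu]_(z in D) (V z / 2)%:E < (1 / 2)%:E)%E.
  rewrite (_ : integral _ _ _ = (2^-1)%:E * orbit_variance)%E.
    apply: (@lt_le_trans _ _ ((2^-1)%:E * 1%:E)%E); last by rewrite -EFinM lee_fin; lra.
    rewrite lte_pmul2l ?lte_fin//; exact: le_lt_trans orbit_variance_le_kappa0 kappa1.
  rewrite /orbit_variance -(@tonelli_on1 _ _ _ _ _ mu mu _ _ (measurable_itv _) (measurable_itv _) (fun z => (V z)%:E)); last 2 first.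
  - exact/measurable_EFinP.
  - by move=> z; rewrite lee_fin.
  rewrite -ge0_integralZl ?lee_fin ?invr_ge0//; last 2 first.
  - by apply: measurable_funTS; exact/measurable_EFinP.
  - by move=> z _; rewrite lee_fin.
  by apply: eq_integral => z _; rewrite -EFinM mulrC.
have [n Hn] : exists n, (\int[mu \x mu]_(z in D) (A (d_ n) z)%:E < (1 / 2)%:E)%E.
  have [n _ Hn] : \forall n \near \oo, (\int[mu \x mu]_(z in D) (A (d_ n) z)%:E < (1 / 2)%:E)%E.
    have U : nbhs (\int[mu \x mu]_(z in D) (V z / 2)%:E)%E [set y | (y < (1 / 2)%:E)%E].
      by apply: open_nbhs_nbhs; split => //; exact: open_ereal_lt_ereal.
    exact: (C _ U).
  by exists n; exact: Hn (leqnn n).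
set I := integral _ _ _ in Hn.
have I0 : (0 <= I)%E by apply: integral_ge0 => z _.
have If : I \is a fin_num by rewrite ge0_fin_numE// (lt_trans Hn)// ltry.
exists (d_ n / 2), (fine I); split.
- by rewrite divr_gt0// invr_gt0.
- exact: fine_ge0.
- by rewrite -lte_fin fineK.
move=> t td; rewrite (mulrC (fine I)) EFinM fineK// /I.
rewrite (@tonelli_on1 _ _ _ _ _ mu mu _ _ (measurable_itv _) (measurable_itv _) _ (mAE (d_ n)) (A0E (d_ n))).
have t0 : (0 <= (t ^+ 2)%:E)%E by rewrite lee_fin sqr_ge0.
rewrite -ge0_integralZl//; last 2 first.
- apply: measurable_funTS.
  exact: (@measurable_integral_sectionr _ _ _ _ _ mu _ _ (measurable_itv _) (mAE (d_ n)) (A0E (d_ n))).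
- by move=> s _; apply: integral_ge0 => a _.
have Ex0 s a v : (0 <= Ex t s a v)%E by rewrite lee_fin excess_ge0.
apply: ge0_integral_mono => s _.
  by apply: integral_ge0 => a _; apply: integral_ge0 => v _.
have mAs : measurable_fun tor (fun a => (A (d_ n) (s, a))%:E).
  by apply: measurable_funTS; apply: (measurableT_comp (mAE (d_ n))); exact: measurable_pair1.
rewrite -ge0_integralZl//.
apply: ae_ge0_le_integral => //.
- by move=> a _; apply: integral_ge0 => v _.
- apply: measurable_funTS.
  apply: (@measurable_integral_sectionr _ _ _ _ _ mu _ (fun z : T * T => Ex t s z.1 z.2)) => //.
  apply/measurable_EFinP; rewrite /excess.
  have m1 : measurable_fun setT (fun z : T * T => lev s + m0 * cos z.1 - z.2 ^+ 2 / 2).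
    apply: measurable_funB.
      apply: measurable_funD => //; apply: measurable_funM => //; apply: measurableT_comp => //.
      by apply: continuous_measurable_fun; exact: continuous_cos.
    by apply: measurable_funM => //; exact: measurable_funX.
  have m2 : measurable_fun setT (fun z : T * T => t * recentred s z.1).
    apply: measurable_funM => //.
    apply: (measurableT_comp measurable_recentred (g := fun z : T * T => (s, z.1))).
    exact: measurable_fun_pair.
  apply: measurable_funB.
    by apply: measurable_funB; apply: measurable_maxr => //; exact: measurable_funD.
  by apply: measurable_fun_ifT => //; exact: measurable_fun_ltr.
- by move=> a _; rewrite mule_ge0.
- exact: emeasurable_funM.
case: (boundary_null (lev s)) => N [mN N0 NS]; exists N; split => // a /= Ha; apply: NS => /= H.
apply: Ha => aT; have {}H := H aT.
have rd : `|t * recentred s a| <= d_ n.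
  rewrite normrM (_ : d_ n = d_ n / 2 * 2); last by lra.
  by apply: ler_pM => //; exact: recentred_le.
apply: le_trans (integral_excess_curvature H rd) _.
rewrite -EFinM lee_fin le_eqVlt; apply/orP; left; apply/eqP.
by rewrite /A /w/=; ring.
Unshelve. all: by end_near.
Qed.

End curvature_bound.

(** * Lebesgue measure on the cylinder *)

Section shift.
Context {R : realType}.
Local Notation mu := (@lebesgue_measure R).
Local Notation T := (measurableTypeR R).

Lemma ge0_integral_translate_on (g : R -> \bar R) (c : R) (A B : set T) :
  measurable A -> measurable B ->
  measurable_fun [set: R] g -> (forall x, (0 <= g x)%E) ->
  (forall x, A x <-> B (x - c)) ->
  (\int[mu]_(x in A) g (x - c)%R = \int[mu]_(x in B) g x)%E.
Proof.
move=> mA mB mg g0 AB.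
rewrite integral_mkcond [RHS]integral_mkcond.
rewrite -[RHS](@ge0_integral_translate _ (g \_ B) c); last 2 first.
- by apply/(measurable_restrictT _ _).1 => //; exact: measurable_funTS.
- by move=> x; rewrite patchE; case: ifP.
apply: eq_integral => x _; rewrite !patchE.
have -> : (x \in A) = (x - c \in B) by apply/idP/idP; rewrite !inE AB.
by case: ifP.
Qed.

(** A period may be cut at any point. *)
Lemma ge0_integral_shift (g : R -> \bar R) (P c : R) : 0 <= c <= P ->
  measurable_fun [set: R] g -> (forall x, (0 <= g x)%E) ->
  (forall x, g (x + P) = g x) ->
  (\int[mu]_(x in `[0%R, P]) g (x - c)%R = \int[mu]_(x in `[0%R, P]) g x)%E.
Proof.
move=> /andP[c0 cP] mg g0 per.
have mgc : measurable_fun [set: R] (fun x => g (x - c)).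
  by apply: (measurableT_comp mg); exact: measurable_funB.
rewrite -!integral_itv_bndo_bndc; [|exact: measurable_funTS|exact: measurable_funTS].
rewrite (@ge0_integral_translate_on g c _ (`[- c, P - c[)) //; last first.
  by move=> x /=; rewrite !in_itv/=; split => ?; lra.
have split_ (a b d : R) : a <= b <= d ->
  (\int[mu]_(x in `[a, d[) g x = \int[mu]_(x in `[a, b[) g x + \int[mu]_(x in `[b, d[) g x)%E.
  move=> /andP[ab bd].
  have -> : (`[a, d[ = `[a, b[ `|` `[b, d[)%classic.
    by rewrite -itv_bndbnd_setU// bnd_simp.
  apply: ge0_integral_setU => //; first exact: measurable_funTS.
  by apply/disj_setPS => x [/=]; rewrite !in_itv/= => /andP[_ xb] /andP[]; rewrite leNgt xb.
rewrite (split_ (- c) 0 (P - c)) ?(split_ 0 (P - c) P); [|lra|lra].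
rewrite addeC; congr (_ + _)%E.
rewrite -(@ge0_integral_translate_on g P `[P - c, P[ `[- c, 0[)//; last first.
  by move=> x /=; rewrite !in_itv/=; split => ?; lra.
by apply: eq_integral => x _; rewrite -(per (x - P)) subrK.
Qed.

End shift.

Section strip_measure.
Context {R : realType}.
Local Notation mu := (@lebesgue_measure R).
Local Notation T := (measurableTypeR R).

Lemma measurable_strip : measurable (@strip R : set (T * T)).
Proof. by apply: measurableX => //; exact: measurable_itv. Qed.

Definition strip_measure : set (T * T) -> \bar R := mrestr (@leb2 R) measurable_strip.

HB.instance Definition _ := Measure.on strip_measure.

Let strip_measure_sigma_finite : sigma_finite setT strip_measure.
Proof.
have /sigma_finiteP[G [TG ndG Goo]] := @sigma_finiteT _ T R mu.
exists (fun n => G n `*` G n).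
  rewrite -setXTT TG predeqE => -[x y]; split.
    move=> [/= [n _ Gnx] [k _ Gky]]; exists (maxn n k) => //; split.
    - by move: x Gnx; exact/subsetPset/ndG/leq_maxl.
    - by move: y Gky; exact/subsetPset/ndG/leq_maxr.
  by move=> [n _ [/= ? ?]]; split; exists n.
move=> n; have [mGn Gn] := Goo n; split; first exact: measurableX.
apply: (@le_lt_trans _ _ ((mu \x mu)%E (G n `*` G n))); last first.
  by rewrite product_measure1E// lte_mul_pinfty// ge0_fin_numE.
rewrite /strip_measure /mrestr; apply: le_measure; rewrite ?inE//; last exact: measurableX.
by apply: measurableI; [exact: measurableX|exact: measurable_strip].
Qed.

HB.instance Definition _ := Measure_isSigmaFinite.Build _ _ _ strip_measure
  strip_measure_sigma_finite.

Lemma integral_strip_measure (f : T * T -> \bar R) :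
  measurable_fun setT f -> (forall z, (0 <= f z)%E) ->
  (\int[strip_measure]_x f x = \int[leb2]_(x in strip) f x)%E.
Proof. by move=> mf f0; rewrite -(ge0_integral_mrestr _ measurable_strip). Qed.

Lemma tonelli_strip (f : T * T -> \bar R) :
  measurable_fun setT f -> (forall z, (0 <= f z)%E) ->
  (\int[leb2]_(x in strip) f x =
   \int[mu]_(t in `[0%R, (2 * pi)%R]) \int[mu]_v f (t, v))%E.
Proof.
move=> mf f0.
exact: (@tonelli_on1 _ _ _ _ _ mu mu _ _ (measurable_itv _) measurableT f mf f0).
Qed.

Lemma ge0_integral_strip_shift (f : T * T -> \bar R) (c : R) : torus c ->
  measurable_fun setT f -> (forall z, (0 <= f z)%E) ->
  (forall t v, f (t + 2 * pi, v) = f (t, v)) ->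
  (\int[leb2]_(x in strip) f (x.1 - c, x.2)%R = \int[leb2]_(x in strip) f x)%E.
Proof.
rewrite /torus/= in_itv/= => ctor mf f0 per.
rewrite [RHS]tonelli_strip// [LHS]tonelli_strip; last 2 first.
- apply: (measurableT_comp mf (g := fun x : T * T => (x.1 - c, x.2))).
  by apply: measurable_fun_pair => //; exact: measurable_funB.
- by move=> z; exact: f0.
apply: (@ge0_integral_shift _ (fun t => \int[mu]_v f (t, v))%E) => //.
- exact: (@measurable_integral_sectionr _ _ _ _ _ mu _ _ measurableT mf f0).
- by move=> t; apply: integral_ge0.
- by move=> t; apply: eq_integral => v _.
Qed.

End strip_measure.

(** * The levels of the pendulum energy *)

Section hmf_levels.
Context {R : realType}.
Local Notation mu := (@lebesgue_measure R).
Local Notation T := (measurableTypeR R).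
Local Notation pos := (`]0%R, +oo[%classic : set T).
Local Notation tor := (`[0%R, (2 * pi)%R]%classic : set T).
Variables (F : R -> R) (estar : \bar R) (m0 : R).
Hypothesis hF : profile_with_cutoff F estar.
Hypothesis m0_gt0 : 0 < m0.
Hypothesis m0e : ((- m0)%:E < estar)%E.
Hypothesis hlog : estar = m0%:E ->
    (\int[mu]_(e in `](- m0)%R, m0[%classic) (ln (m0 - e) * derive1 F e)%:E < +oo)%E.

Let S := F (- m0).
Local Notation lev := (level hF m0).

(** Energy measured from the bottom of the well. *)
Definition height (x : T * T) : R := x.2 ^+ 2 / 2 + m0 * (1 - cos x.1).

Definition height_level (s : T) : R := ((fun s => lev s + m0) \_ `]0, S[) s.

(** The direction in which a displacement increases the magnetization, made
    nonnegative. *)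
Definition tilt (x : T * T) : R := 1 + cos x.1.

(** Above the maximum of the steady state the superlevels are empty; the value
    2, which [tilt] takes at the bottom of the well, keeps them empty after a
    small displacement. *)
Definition tilt_level (s : T) : R :=
  if s \in `]0, S[ then center m0 (lev s) else 2.

Definition turn (c : R) (x : T * T) : T * T := (x.1 - c, x.2).

Lemma measurable_turn c : measurable_fun setT (turn c).
Proof. by apply: measurable_fun_pair => //; exact: measurable_funB. Qed.

Let mcos : measurable_fun setT (fun x : T * T => cos x.1).
Proof.
apply: measurableT_comp => //.
by apply: continuous_measurable_fun; exact: continuous_cos.
Qed.

Lemma measurable_height : measurable_fun setT height.
Proof.
apply: measurable_funD; first by apply: measurable_funM => //; exact: measurable_funX.
by apply: measurable_funM => //; exact: measurable_funB.
Qed.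

Lemma height_ge0 x : 0 <= height x.
Proof.
by rewrite addr_ge0 ?divr_ge0 ?sqr_ge0// mulr_ge0 ?(ltW m0_gt0)// subr_ge0 cos_le1.
Qed.

Lemma measurable_height_level : measurable_fun setT height_level.
Proof.
apply/(measurable_restrictT _ _).1; first exact: measurable_itv.
by apply: measurable_funTS; apply: measurable_funD => //; exact: measurable_level.
Qed.

Lemma height_level_ge0 s : 0 <= height_level s.
Proof.
rewrite /height_level patchE; case: ifP => // /set_mem sS.
by have := level_gt hF sS; lra.
Qed.

Lemma height_level_high s : S <= s -> height_level s = 0.
Proof.
by move=> Ss; rewrite /height_level patchE memNset//= in_itv/= -/S [_ < S]ltNge Ss andbF.
Qed.

Lemma measurable_tilt : measurable_fun setT tilt.
Proof. exact: measurable_funD. Qed.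

Lemma tilt_ge0 x : 0 <= tilt x.
Proof. by rewrite /tilt; have := cos_geN1 x.1; lra. Qed.

Lemma measurable_tilt_level : measurable_fun setT tilt_level.
Proof.
apply: measurable_fun_ifT => //.
- have mS : measurable (`]0, S[%classic : set T) by exact: measurable_itv.
  apply: (@measurable_fun_bool _ _ _ _ true).
  rewrite setTI (_ : _ @^-1` _ = `]0, S[%classic)//.
- by apply: (measurableT_comp (measurable_center m0)); exact: measurable_level.
Qed.

Lemma tilt_level_itv s : 0 <= tilt_level s <= 2.
Proof. by rewrite /tilt_level; case: ifP => _; [exact: center_itv|rewrite lexx ler0n]. Qed.

Lemma profile_superlevel (s : R) (x : R * R) : 0 < s ->
  (s < F (e0 m0 x)) = (height x < height_level s).
Proof.
move=> s0; have hE : e0 m0 x = height x - m0 by rewrite /e0 /phi0 /height; ring.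
rewrite hE /height_level patchE; case: ifPn => [/set_mem sS|].
  by rewrite (@profile_lt _ _ _ hF m0)// ltrBlDr.
rewrite notin_setE/= in_itv/= s0/= => /negP; rewrite -leNgt => Ss.
rewrite (_ : point = 0 :> R)// [RHS]ltNge height_ge0/=.
apply/negbTE; rewrite -leNgt; apply: le_trans Ss.
by apply: (profile_noninc hF); have := height_ge0 x; lra.
Qed.

Let eps c := height \o turn c.

Let meps c : measurable_fun setT (eps c).
Proof. exact: (measurableT_comp measurable_height (measurable_turn c)). Qed.

(** Above the maximum of the steady state there is nothing to move. *)
Let restrict_levels (H : T -> \bar R) : (forall s, S <= s -> H s = 0%E) ->
  (\int[mu]_(s in pos) H s = \int[mu]_(s in `]0%R, S[) H s)%E.
Proof.
move=> HS; rewrite integral_mkcond [RHS]integral_mkcond; apply: eq_integral => s _.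
rewrite !patchE; case: ifPn => [/set_mem|]; case: ifPn => //.
- rewrite notin_setE/= !in_itv/= => /negP nS; rewrite andbT => s0.
  by move: nS; rewrite s0/= -leNgt => /HS ->.
- by move=> /set_mem/=; rewrite in_itv/= => /andP[s0 _]; rewrite notin_setE/= in_itv/= s0.
Qed.

Let level_integral (H : T * (T * T) -> R) (c : R) (s : T) : torus c ->
  measurable_fun setT H -> (forall z, 0 <= H z) ->
  (forall t v, H (s, (t + 2 * pi, v)) = H (s, (t, v))) ->
  (\int[@strip_measure R]_x (H (s, turn c x))%:E =
   \int[mu]_(t in tor) \int[mu]_v (H (s, (t, v)))%:E)%E.
Proof.
move=> ct mH H0 per.
have mHs : measurable_fun setT (fun x => (H (s, x))%:E).
  apply/measurable_EFinP; apply: (measurableT_comp mH); exact: measurable_pair1.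
rewrite integral_strip_measure//; last 2 first.
- by apply: (measurableT_comp mHs); exact: measurable_turn.
- by move=> x; rewrite lee_fin.
rewrite (@ge0_integral_strip_shift _ (fun x => (H (s, x))%:E))//; last 2 first.
- by move=> x; rewrite lee_fin.
- by move=> t v; rewrite per.
by rewrite tonelli_strip// => x; rewrite lee_fin.
Qed.

Let cosP (t : R) : cos (t + 2 * pi) = cos t.
Proof. by rewrite mulr_natl cosD2pi. Qed.

(** All orbits near the boundary of a superlevel are traversed in a time that
    is integrable over the levels. *)
Lemma shell_bound : exists2 K : R, 0 <= K & forall c k, torus c -> 0 < k ->
  (\int[mu]_(s in pos) \int[@strip_measure R]_x (shell (eps c) height_level k (s, x))%:E
    <= (k * K)%:E)%E.
Proof.
pose P := (\int[mu]_(s in `]0%R, S[) period m0 (lev s))%E.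
have P0 : (0 <= P)%E by apply: integral_ge0 => s _; exact: period_ge0.
have Pf : P \is a fin_num.
  by rewrite ge0_fin_numE//; exact: integral_period_level.
exists (2 * Num.sqrt 2 * fine P); first by rewrite mulr_ge0 ?fine_ge0// mulr_ge0.
move=> c k ct k0.
have mperiod : measurable_fun [set: R] (period m0 \o lev).
  by apply: (measurableT_comp (measurable_period m0)); exact: measurable_level.
rewrite restrict_levels; last first.
  move=> s Ss; apply: integral0_eq => x _; rewrite /shell height_level_high//=.
  by rewrite [X in _ && X]ltNge height_ge0 andbF.
rewrite mulrA EFinM fineK// /P -ge0_integralZl//; last 3 first.
- exact: measurable_funTS.
- by move=> s _; exact: period_ge0.
- by rewrite lee_fin !mulr_ge0// ltW.
apply: ge0_integral_mono => s /= sS.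
  by apply: integral_ge0 => x _; rewrite lee_fin ler0n.
rewrite (_ : (\int[_]_x _ = \int[@strip_measure R]_x (shell height height_level k (s, turn c x))%:E)%E)//.
rewrite (@level_integral (shell height height_level k))//; last 2 first.
- exact: measurable_shell_ind measurable_height measurable_height_level k.
- by move=> t v; rewrite /shell /height/= cosP.
rewrite /period -ge0_integralZl//; last 3 first.
- apply/measurable_EFinP; apply: measurable_funTS.
  apply: (measurableT_comp measurable_isq); apply: measurableT_comp => //.
  apply: measurable_funD => //; apply: measurable_funM => //.
  by apply: continuous_measurable_fun; exact: continuous_cos.
- by move=> t _; rewrite lee_fin isq_ge0.
- by rewrite lee_fin !mulr_ge0// ltW.
apply: ge0_integral_mono => t _; first by apply: integral_ge0 => v _; rewrite lee_fin ler0n.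
set w := lev s + m0 * cos t.
pose A : set T := [set v : R | (w - k <= v ^+ 2 / 2) && (v ^+ 2 / 2 < w)].
have mA : measurable A := measurable_shell (w - k) w.
rewrite (_ : (\int[mu]_v _ = \int[mu]_v (\1_A v)%:E)%E); last first.
  apply: eq_integral => v _; rewrite indicE /shell /height/= /height_level patchE mem_set//.
  congr (_%:R)%:E; congr nat_of_bool.
  apply/idP/idP; rewrite inE /A/= /w => /andP[h1 h2]; apply/andP; split; lra.
rewrite integral_indic// setIT; apply: le_trans (shell_measure _) _; first by lra.
rewrite -EFinM lee_fin (_ : k * _ * _ = 2 * Num.sqrt 2 * (k * isq `|w|)); last by ring.
rewrite ler_wpM2l ?mulr_ge0//.
have [w0|w0] := lerP w 0.
  rewrite (ler0_sqrtr w0) (@ler0_sqrtr _ (w - k)) ?subr0 ?mulr_ge0 ?isq_ge0 ?(ltW k0)//; lra.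
by rewrite gtr0_norm// sqrt_shell// ltW.
Qed.

Lemma remainder_bound : (kappa0 F m0 < 1)%E ->
  exists d q : R, [/\ 0 < d, 0 <= q, q < 1 / 2 & forall c t : R, torus c -> `|t| <= d ->
    (\int[mu]_(s in pos) \int[@strip_measure R]_x
       (remainder (eps c) height_level (tilt \o turn c) tilt_level t (s, x))%:E
     <= (q * t ^+ 2)%:E)%E].
Proof.
move=> /(quadratic_excess hF m0_gt0 m0e hlog)[d [q [d0 q0 q1 H]]].
exists (Num.min d m0), q; split => //; first by rewrite lt_min d0.
move=> c t ct; rewrite le_min => /andP[td tm].
pose Rem := remainder height height_level tilt tilt_level t.
have mRem : measurable_fun setT Rem.
  apply: measurable_remainder.
  - exact: measurable_height.
  - exact: measurable_height_level.
  - exact: measurable_tilt.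
  - exact: measurable_tilt_level.
rewrite (_ : (\int[mu]_(s in pos) _ = \int[mu]_(s in pos) \int[@strip_measure R]_x (Rem (s, turn c x))%:E)%E)//.
rewrite restrict_levels; last first.
  move=> s Ss; apply: integral0_eq => x _.
  have sN : s \notin `]0, S[ by rewrite in_itv/= -/S [_ < S]ltNge Ss andbF.
  rewrite /Rem /remainder height_level_high//= /tilt_level (negbTE sN) /excess.
  set y := turn c x.
  have h0 := height_ge0 y; have t1 : - t <= m0 by apply: le_trans tm; rewrite -normrN ler_norm.
  have v0 : 0 <= y.2 ^+ 2 / 2 by rewrite divr_ge0 ?sqr_ge0.
  have c1 := cos_le1 y.1.
  have h1 : 0 - height y + t * (tilt y - 2) <= 0 by rewrite /height /tilt; nra.
  rewrite (max_idPl h1) (max_idPl _) ?ifF ?subr0//; last by lra.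
  by apply/negbTE; rewrite -leNgt; lra.
apply: le_trans (H t td); apply: ge0_integral_mono => s /= sS.
  by apply: integral_ge0 => x _; rewrite lee_fin remainder_ge0.
rewrite level_integral; last 4 first.
- exact: ct.
- exact: mRem.
- by move=> z; exact: remainder_ge0.
- by move=> a v; rewrite /Rem /remainder /height /tilt/= cosP.
rewrite le_eqVlt; apply/orP; left; apply/eqP; apply: eq_integral => a _.
apply: eq_integral => v _; rewrite /Rem /remainder /=; congr (excess _ _)%:E.
  by rewrite /height_level patchE mem_set// /height/=; ring.
by rewrite /tilt_level sS /tilt /recentred.
Qed.

End hmf_levels.

(** * The volumes of discs in the cylinder *)

Section discs.
Context {R : realType}.
Local Notation mu := (@lebesgue_measure R).
Local Notation T := (measurableTypeR R).
Local Notation tor := (`[0%R, (2 * pi)%R]%classic : set T).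

Definition disc_volume (r : R) : R := fine (@leb2 R (disc r `&` strip)).

Lemma measurable_euclid : measurable_fun setT (@euclid R : T * T -> R).
Proof.
apply: (@measurableT_comp _ _ _ _ _ _ (@Num.sqrt R)).
  by apply: continuous_measurable_fun; exact: sqrt_continuous.
by apply: measurable_funD; exact: measurable_funX.
Qed.

Let measurable_disc (r : R) : measurable (disc r : set (T * T)).
Proof.
rewrite (_ : disc r = setT `&` @euclid R @^-1` `]-oo, r[%classic).
  by apply: measurable_euclid => //; exact: measurable_itv.
by rewrite setTI; apply/seteqP; split => x; rewrite /disc /= in_itv.
Qed.

Let measurable_disc_strip (r : R) : measurable (disc r `&` strip : set (T * T)).
Proof. by apply: measurableI; [exact: measurable_disc|exact: measurable_strip]. Qed.

Lemma strip_fibers (A : set (T * T)) : measurable A ->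
  @leb2 R (A `&` strip) = (\int[mu]_(t in tor) \int[mu]_v (\1_A (t, v))%:E)%E.
Proof.
move=> mA; rewrite -(@tonelli_strip _ (fun z => (\1_A z)%:E)) ?integral_indic//.
- exact: measurable_strip.
- exact/measurable_EFinP.
Qed.

Lemma strip_box (A B : set T) : measurable A -> measurable B -> A `<=` tor ->
  @leb2 R ((A `*` B) `&` strip) = (mu A * mu B)%E.
Proof.
move=> mA mB At; rewrite setIidl; last by move=> x [xA xB]; split => //; exact: At.
exact: product_measure1E.
Qed.

Lemma torus_measure : mu tor = (2 * pi)%:E.
Proof.
have p0 := pi_gt0 R.
by rewrite lebesgue_measure_itv/= lte_fin mulr_gt0// -EFinB subr0.
Qed.

Let euclid_ge0 (x : R * R) : 0 <= euclid x. Proof. exact: sqrtr_ge0. Qed.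

Let annulus (r r' : R) : set (T * T) := [set x | r <= euclid x /\ euclid x < r'].

Let measurable_annulus r r' : measurable (annulus r r').
Proof.
rewrite (_ : annulus r r' = setT `&` @euclid R @^-1` `[r, r'[%classic).
  by apply: measurable_euclid => //; exact: measurable_itv.
by rewrite setTI; apply/seteqP; split => x; rewrite /annulus /= in_itv/= => /andP.
Qed.

(** Each vertical section is the set of the velocities in a shell of kinetic
    energy. *)
Let annulus_measure (r r' : R) : 0 <= r -> r <= r' ->
  (@leb2 R (annulus r r' `&` strip) <= (4 * pi * Num.sqrt (r' ^+ 2 - r ^+ 2))%:E)%E.
Proof.
move=> r0 rr'; rewrite strip_fibers//.
pose c := 2 * Num.sqrt (r' ^+ 2 - r ^+ 2).
apply: (@le_trans _ _ (\int[mu]_(t in tor) (cst c%:E) t)%E); last first.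
  rewrite integral_cst// [X in (_ * X <= _)%E](_ : _ = (2 * pi)%:E); last exact: torus_measure.
  by rewrite -EFinM lee_fin /c le_eqVlt; apply/orP; left; apply/eqP; ring.
apply: ge0_integral_mono => t _; first by apply: integral_ge0 => v _; rewrite lee_fin.
pose p := (r ^+ 2 - t ^+ 2) / 2; pose q := (r' ^+ 2 - t ^+ 2) / 2.
have pq : p <= q by rewrite /p /q ler_pM2r// lerD2r ler_pXn2r// nnegrE// (le_trans r0).
pose A : set T := [set v : R | (p <= v ^+ 2 / 2) && (v ^+ 2 / 2 < q)].
have mA : measurable A := measurable_shell p q.
rewrite (_ : (\int[mu]_v _ = \int[mu]_v (\1_A v)%:E)%E); last first.
  apply: eq_integral => v _; rewrite !indicE; congr (_%:R)%:E; congr nat_of_bool.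
  have e2 : euclid (t, v) ^+ 2 = t ^+ 2 + v ^+ 2.
    by rewrite /euclid sqr_sqrtr// addr_ge0 ?sqr_ge0.
  have r'0 := le_trans r0 rr'.
  apply/idP/idP; rewrite !inE /A /annulus /=.
    move=> [h1 h2]; rewrite -ler_sqr ?nnegrE// in h1; rewrite -ltr_sqr ?nnegrE// in h2.
    by rewrite e2 in h1 h2; apply/andP; rewrite /p /q; split; lra.
  rewrite /p /q => /andP[h1 h2]; split.
    by rewrite -ler_sqr ?nnegrE// e2; lra.
  by rewrite -ltr_sqr ?nnegrE// e2; lra.
rewrite integral_indic// setIT; apply: le_trans (shell_measure pq) _.
rewrite lee_fin /c -mulrA ler_pM2l//.
have -> : r' ^+ 2 - r ^+ 2 = 2 * (q - p) by rewrite /p /q; lra.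
rewrite (@sqrtrM _ 2 (q - p))//; apply: ler_wpM2l; [exact: sqrtr_ge0|exact: sqrtrB_le].
Qed.

Let disc_fin r : @leb2 R (disc r `&` strip) \is a fin_num.
Proof.
rewrite ge0_fin_numE ?measure_ge0//.
apply: (@le_lt_trans _ _ (@leb2 R (annulus 0 (Num.max 0 r) `&` strip))).
  apply: le_measure; rewrite ?inE//.
    by apply: measurableI => //; exact: measurable_strip.
  by move=> x [xr xs]; split => //; split => //; rewrite lt_max [X in _ || X]xr orbT.
by apply: le_lt_trans (annulus_measure _ _) _; rewrite ?le_max ?lexx// ltry.
Qed.

Lemma disc_volumeE r : (disc_volume r)%:E = @leb2 R (disc r `&` strip).
Proof. exact: fineK. Qed.

Lemma le_disc_volume r r' : r <= r' -> disc_volume r <= disc_volume r'.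
Proof.
move=> rr'; rewrite -lee_fin !disc_volumeE; apply: le_measure; rewrite ?inE//.
by move=> x [xr xs]; split => //; exact: lt_le_trans rr'.
Qed.

Lemma disc_volume0 : disc_volume 0 = 0.
Proof.
rewrite /disc_volume (_ : disc 0 `&` strip = set0) ?measure0//.
by apply/seteqP; split => // x [] ; rewrite /disc/= ltNge euclid_ge0.
Qed.

Let disc_volumeB r r' : 0 <= r -> r <= r' ->
  disc_volume r' - disc_volume r <= 4 * pi * Num.sqrt (r' ^+ 2 - r ^+ 2).
Proof.
move=> r0 rr'; rewrite lerBlDl -lee_fin EFinD !disc_volumeE.
apply: le_trans (leeD2l _ (annulus_measure r0 rr')).
apply: le_trans (measureU2 _ _ _); rewrite ?inE//; last first.
  by apply: measurableI => //; exact: measurable_strip.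
apply: le_measure; rewrite ?inE//.
  by apply: measurableU => //; apply: measurableI => //; exact: measurable_strip.
move=> x [xr xs]; have [h|h] := ltP (euclid x) r; first by left.
by right.
Qed.

Lemma continuous_disc_volume : continuous (fun r : R => disc_volume `|r|).
Proof.
have B (r r' : R) : `|disc_volume `|r| - disc_volume `|r'| | <= 4 * pi * Num.sqrt `|r' ^+ 2 - r ^+ 2|.
  wlog rr' : r r' / `|r| <= `|r'|.
    move=> H; have [/H//|/ltW/H] := leP `|r| `|r'|.
    by rewrite distrC [X in Num.sqrt X]distrC.
  rewrite distrC ger0_norm ?subr_ge0 ?le_disc_volume//.
  apply: le_trans (disc_volumeB _ rr') _ => //.
  by rewrite !real_normK ?num_real// ler_wpM2l ?mulr_ge0 ?pi_ge0// ler_wsqrtr// ler_norm.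
move=> r; apply/cvgrPdist_le => e e0.
have C : 4 * pi * Num.sqrt `|r' ^+ 2 - r ^+ 2| @[r' --> r] --> (0 : R).
  rewrite -[X in _ --> X](mulr0 (4 * pi)); apply: cvgMr.
  rewrite -[X in _ --> X]sqrtr0; apply: continuous_cvg; first exact: sqrt_continuous.
  rewrite -[X in _ --> X](normr0 R); apply: cvg_norm.
  rewrite -[X in _ --> X](subrr (r ^+ 2)); apply: cvgB; last exact: cvg_cst.
  by rewrite !expr2; apply: cvgM; exact: cvg_id.
near=> r'; apply: le_trans (B r r') _; apply: ltW.
by near: r'; exact: cvgr_lt _ C _ e0.
Unshelve. all: by end_near.
Qed.

Lemma disc_volume_surj (m : R) : 0 <= m -> exists2 r, 0 <= r & disc_volume r = m.
Proof.
move=> m0; pose b := 2 * pi + m.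
have p2 := pi_ge2 R.
have b0 : 0 <= b by rewrite /b; lra.
have Vb : m <= disc_volume b.
  rewrite -lee_fin disc_volumeE.
  apply: (@le_trans _ _ (@leb2 R ((tor `*` `[0, m[) `&` strip))).
    rewrite strip_box ?torus_measure//; try exact: measurable_itv.
    rewrite lebesgue_measure_itv/= lte_fin; case: ltP => m1; last by rewrite mule0 lee_fin.
    by rewrite -EFinB -EFinM lee_fin; nra.
  apply: le_measure; rewrite ?inE//.
    apply: measurableI; last exact: measurable_strip.
    by apply: measurableX; exact: measurable_itv.
  move=> [t v] [[/=]]; rewrite !in_itv/= => /andP[t0 tp] /andP[v0 vm] st; split => //.
  rewrite /disc/= /euclid/=.
  apply: (@le_lt_trans _ _ (t + v)); last by rewrite /b; lra.
  rewrite -ler_sqr ?nnegrE ?sqrtr_ge0 ?addr_ge0// sqr_sqrtr ?addr_ge0 ?sqr_ge0//.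
  by have := mulr_ge0 t0 v0; nra.
have cV : {within `[0, b], continuous (fun r : R => disc_volume `|r|)}.
  exact: continuous_subspaceT continuous_disc_volume.
have [|r rb <-] := IVT b0 cV (v := m).
  by rewrite normr0 disc_volume0 (ger0_norm b0) ge_min m0 le_max Vb orbT.
by exists `|r|.
Qed.

Let vol (x : R * R) : R := disc_volume (euclid x).

Lemma measurable_disc_volume : measurable_fun setT (vol : T * T -> R).
Proof.
have -> : (vol : T * T -> R) = (fun r => disc_volume `|r|) \o @euclid R.
  by apply/funext => x; rewrite /= ger0_norm.
apply: measurableT_comp; last exact: measurable_euclid.
exact: continuous_measurable_fun continuous_disc_volume.
Qed.

Let ball (m : \bar R) : set (T * T) := [set x | (strip x /\ (vol x)%:E < m)%E].

Let measurable_ball m : measurable (ball m).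
Proof.
rewrite (_ : ball m = strip `&` (fun x => (vol x)%:E) @^-1` [set y | (y < m)%E]).
  have mv : measurable_fun (@strip R : set (T * T)) (fun x => (vol x)%:E).
    by apply/measurable_EFinP; apply: measurable_funTS; exact: measurable_disc_volume.
  apply: mv; first exact: measurable_strip.
  rewrite (_ : [set y | _] = `]-oo, m[%classic); first exact: emeasurable_itv.
  by apply/seteqP; split => y; rewrite /= in_itv.
by apply/seteqP; split => x.
Qed.

(** The volume of the disc through a point is uniformly distributed, because it
    grows continuously from 0 to infinity with the radius. *)
Lemma disc_volume_lt (m : \bar R) : (0 <= m)%E ->
  @leb2 R [set x | (strip x /\ (disc_volume (euclid x))%:E < m)%E] = m.
Proof.
move=> m0; apply/eqP; rewrite eq_le; apply/andP; split.
  case: m m0 => [a| |]//; last by move=> _; rewrite leey.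
  rewrite lee_fin => /disc_volume_surj[r r0 <-].
  rewrite [leRHS]disc_volumeE; apply: le_measure; rewrite ?inE//; first exact: (measurable_ball _).
  move=> x [xs]; rewrite lte_fin => xr; split => //.
  by rewrite /disc/= ltNge; apply/negP => /le_disc_volume; rewrite leNgt xr.
rewrite leNgt; apply/negP; set B := leb2 _ => Bm.
have B0 : (0 <= B)%E by exact: measure_ge0.
have [m' Bm' m'm] : exists2 m' : R, (B < m'%:E)%E & (m'%:E < m)%E.
  move: B0 Bm; case: B => [b| |]// _; case: m m0 => [a| |]// _.
  - by rewrite lte_fin => ba; exists ((b + a) / 2); rewrite lte_fin; lra.
  - by move=> _; exists (b + 1); rewrite ?ltry// lte_fin ltrDl.
have m'0 : 0 <= m' by rewrite -lee_fin ltW// (le_lt_trans B0).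
have [r r0 rm] := disc_volume_surj m'0.
move: Bm'; rewrite -rm disc_volumeE ltNge => /negP; apply.
apply: le_measure; rewrite ?inE//; first exact: (measurable_ball _).
move=> x [xr xs]; split => //; apply: le_lt_trans m'm.
by rewrite -rm lee_fin le_disc_volume// ltW.
Qed.

Lemma disc_volume_itv (a b : R) : 0 <= a -> a <= b ->
  @leb2 R [set x | strip x /\ a <= disc_volume (euclid x) < b] = (b - a)%:E.
Proof.
move=> a0 ab; have b0 := le_trans a0 ab.
rewrite (_ : [set x | _] = ball b%:E `\` ball a%:E); last first.
  apply/seteqP; split => x.
    move=> [xs /andP[h1 h2]]; split; first by split => //; rewrite lte_fin.
    by move=> [_]; rewrite lte_fin ltNge h1.
  move=> [[xs]]; rewrite lte_fin => h1 h2; split => //; rewrite h1 andbT leNgt.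
  by apply/negP => h3; apply: h2; split => //; rewrite lte_fin.
have bE m : (0 <= m)%E -> leb2 (ball m) = m := @disc_volume_lt m.
transitivity (leb2 (ball b%:E) - leb2 (ball b%:E `&` ball a%:E))%E.
  by apply: measureD; rewrite ?inE//; rewrite -/(@leb2 R) [X in (X < _)%E]bE// ltry.
rewrite (_ : ball b%:E `&` ball a%:E = ball a%:E); last first.
  apply/seteqP; split => [x []//|x [xs xa]]; split => //; split => //.
  by apply: lt_le_trans xa _; rewrite lee_fin.
by rewrite !bE.
Qed.

End discs.

(** * Symmetric rearrangements *)

Section superlevels.
Context {R : realType}.
Local Notation mu := (@lebesgue_measure R).
Local Notation T := (measurableTypeR R).
Local Notation nu := (@strip_measure R).

(** The part of a function that its rearrangement sees; it is measurable and
    nonnegative everywhere when the function is integrable over the strip. *)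
Definition core (f : R * R -> R) : T * T -> R := (fun x => Num.max 0 (f x)) \_ strip.

Variable f : R * R -> R.
Hypothesis mf : measurable_fun setT (core f).
Hypothesis If : (\int[nu]_x (core f x)%:E < +oo)%E.

Lemma core_ge0 x : 0 <= core f x.
Proof. by rewrite /core patchE; case: ifP => // _; rewrite le_max lexx. Qed.

Let lt_core (s : R) x : 0 <= s -> (strip x /\ s < f x) <-> s < core f x.
Proof.
move=> s0; rewrite /core patchE; case: ifPn => [/set_mem xs|].
  by rewrite lt_max [s < 0]ltNge s0/=; split => [[]|].
rewrite notin_setE => xs; split => [[]//|].
by rewrite (_ : point = 0 :> R)// ltNge s0.
Qed.

Let msup (s : R) : measurable ([set x | s < core f x] : set (T * T)).
Proof.
rewrite (_ : [set _ | _] = setT `&` core f @^-1` `]s, +oo[%classic).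
  by apply: mf => //; exact: measurable_itv.
by rewrite setTI; apply/seteqP; split => x; rewrite /= in_itv/= andbT.
Qed.

Let supE s : 0 <= s -> distribution_function f s = leb2 [set x | s < core f x].
Proof.
move=> s0; rewrite /distribution_function; congr (leb2 _).
by apply/seteqP; split => x; rewrite /= lt_core.
Qed.

Lemma distribution_tail s : 0 <= s -> distribution_function f s = tail nu (core f) s.
Proof.
move=> s0; rewrite supE// /tail integral_strip_measure//; first last.
- by move=> x; rewrite lee_fin ler0n.
- by apply/measurable_EFinP; apply: (measurableT_comp (measurable_layer mf)); exact: measurable_pair1.
transitivity (\int[leb2]_(x in strip) (\1_[set x | (s < core f x)%R] x)%:E)%E.
  rewrite integral_indic//; last exact: measurable_strip.
  by congr (leb2 _); apply/esym/setIidl => x /= /(lt_core _ s0)[].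
apply: eq_integral => x _; rewrite indicE /layer/=; congr (_%:R)%:E.
by congr nat_of_bool; apply/idP/idP; rewrite inE.
Qed.

Lemma distribution_ge0 s : (0 <= distribution_function f s)%E.
Proof. exact: measure_ge0. Qed.

Lemma le_distribution s t : 0 <= s -> s <= t ->
  (distribution_function f t <= distribution_function f s)%E.
Proof.
move=> s0 st; rewrite !supE ?(le_trans s0)//; apply: le_measure; rewrite ?inE//.
by move=> x /=; exact: le_lt_trans.
Qed.

(** Right-continuity, for the superlevels are unions of the higher ones. *)
Let distribution_right s u : 0 <= s -> (u < distribution_function f s)%E ->
  exists2 t, s < t & (u < distribution_function f t)%E.
Proof.
move=> s0 us.
pose E (n : nat) : set (T * T) := [set x | s + n.+1%:R^-1 < core f x].
have EU : \bigcup_n E n = [set x | s < core f x].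
  apply/seteqP; split => x.
    by move=> [n _]; apply: le_lt_trans; rewrite lerDl invr_ge0.
  move=> /= sx; have d0 : 0 < core f x - s by rewrite subr_gt0.
  have [n _ /= H] := near_infty_natSinv_lt (PosNum d0).
  by exists n => //; rewrite /E/= -ltrBrDl; exact: (H n (leqnn n)).
have ndE : nondecreasing_seq E.
  move=> n m nm; apply/subsetPset => x; apply: le_lt_trans.
  by rewrite lerD2l lef_pV2 ?posrE// ler_nat.
have C := @nondecreasing_cvg_mu _ _ _ (@leb2 R) E (fun n => msup _) _ ndE.
move: us; rewrite supE// -EU => us.
have mU : measurable (\bigcup_n E n) by rewrite EU.
have U : nbhs (leb2 (\bigcup_n E n)) [set y | (u < y)%E].
  by apply: open_nbhs_nbhs; split => //; exact: open_ereal_gt_ereal.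
have [n _ /(_ n (leqnn n)) Hn] := C mU _ U.
have n0 : 0 < n.+1%:R^-1 :> R by rewrite invr_gt0.
by exists (s + n.+1%:R^-1); rewrite ?ltrDl// supE// addr_ge0// ltW.
Qed.

(** The strict Galois connection between a right-continuous nonincreasing
    function and its generalized inverse. *)
Lemma lt_rearr s x : 0 <= s ->
  (s%:E < rearr f x)%E = ((disc_volume (euclid x))%:E < distribution_function f s)%E.
Proof.
move=> s0; rewrite /rearr -/(disc_volume _) /sharp; set u := disc_volume _.
apply/idP/idP => [H|us].
  rewrite ltNge; apply/negP => su; move: H; rewrite ltNge => /negP; apply.
  by apply: ereal_inf_lbound; exists s.
have [t st ut] := distribution_right s0 us.
apply: (@lt_le_trans _ _ t%:E); first by rewrite lte_fin.
apply: le_ereal_inf_tmp => _ [r /= [r0 ru] <-]; rewrite lee_fin leNgt; apply/negP => rt.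
by have := le_lt_trans ru ut; rewrite ltNge le_distribution// ltW.
Qed.

Lemma rearr_ge0 x : (0 <= rearr f x)%E.
Proof. by apply: le_ereal_inf_tmp => _ [r /= [r0 _] <-]; rewrite lee_fin. Qed.

End superlevels.

Section rearrangement_distance.
Context {R : realType}.
Local Notation mu := (@lebesgue_measure R).
Local Notation T := (measurableTypeR R).
Local Notation nu := (@strip_measure R).
Local Notation pos := (`]0%R, +oo[%classic : set T).
Variables f g : R * R -> R.
Hypotheses (mf : measurable_fun setT (core f)) (mg : measurable_fun setT (core g)).
Hypothesis If : (\int[nu]_x (core f x)%:E < +oo)%E.
Hypothesis Ig : (\int[nu]_x (core g x)%:E < +oo)%E.

Let gap (a b : \bar R) (u : R) : R := `|(u%:E < a)%E%:R - (u%:E < b)%E%:R|.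

Let gapC a b u : gap a b u = gap b a u. Proof. exact: distrC. Qed.

Let gap_itv (a b : \bar R) u : (a <= b)%E ->
  gap a b u = ((a <= u%:E)%E && (u%:E < b)%E)%:R.
Proof.
move=> ab; rewrite /gap; case: (ltP u%:E a) => ua.
  by rewrite (lt_le_trans ua ab) subrr normr0.
by rewrite sub0r normrN; case: (_ < _)%E; rewrite ?normr1 ?normr0.
Qed.

Let integral_gap (a b : \bar R) : (0 <= a)%E -> (0 <= b)%E ->
  (\int[mu]_(s in pos) (gap a b s)%:E <= `|a - b|)%E.
Proof.
have key (p q : R) : p <= q ->
    (\int[mu]_(s in pos) (gap p%:E q%:E s)%:E <= (q - p)%:E)%E.
  move=> pq; apply: (@le_trans _ _ (mu (`[p, q[%classic))); last first.
    by rewrite lebesgue_measure_itv/= lte_fin; case: ltP => // _; rewrite lee_fin subr_ge0.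
  have mI : measurable (`[p, q[%classic : set T) by exact: measurable_itv.
  rewrite -(setIT `[p, q[%classic) -(integral_indic _ measurableT mI).
  rewrite [leLHS]integral_mkcond; apply: ge0_integral_mono => s _.
    by rewrite patchE; case: ifP => // _; rewrite lee_fin normr_ge0.
  rewrite patchE; case: ifP => _; last by rewrite lee_fin.
  rewrite lee_fin gap_itv// lee_fin lte_fin indicE.
  by rewrite (_ : (s \in _) = (p <= s < q)) //; apply/idP/idP; rewrite inE/= in_itv.
case: a b => [a| |]// [b| |]// _ _; rewrite ?leey//.
rewrite -EFinB /=; have [ab|/ltW ba] := leP a b.
  by rewrite distrC ger0_norm ?subr_ge0// key.
under eq_integral do rewrite gapC.
by rewrite ger0_norm ?subr_ge0// key.
Qed.

Let tf := tail nu (core f).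
Let tg := tail nu (core g).
Let V (x : T * T) : R := disc_volume (euclid x).
Let G (z : T * (T * T)) : \bar R := (gap (tf z.1) (tg z.1) (V z.2))%:E.

Let G0 z : (0 <= G z)%E. Proof. by rewrite lee_fin normr_ge0. Qed.

Let mG : measurable_fun setT G.
Proof.
have mV : measurable_fun setT (fun z : T * (T * T) => (V z.2)%:E).
  apply/measurable_EFinP; apply: (measurableT_comp (@measurable_disc_volume R)).
  exact: measurable_snd.
have mt (h : R * R -> R) : measurable_fun setT (core h) ->
    measurable_fun setT (fun z : T * (T * T) => ((V z.2)%:E < tail nu (core h) z.1)%E%:R : R).
  move=> mh.
  rewrite (_ : (fun z => _) = fun z => if ((V z.2)%:E < tail nu (core h) z.1)%E then 1 else 0); last first.
    by apply/funext => z; case: ifP.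
  apply: measurable_fun_ifT => //; apply: measurable_fun_lte => //.
  by apply: (measurableT_comp (measurable_tail _ mh)).
apply/measurable_EFinP; apply: measurableT_comp => //.
by apply: measurable_funB; exact: mt.
Qed.

Let fin_tail (h : R * R -> R) s : measurable_fun setT (core h) ->
  (\int[nu]_x (core h x)%:E < +oo)%E -> 0 < s ->
  tail nu (core h) s = (fine (tail nu (core h) s))%:E.
Proof.
move=> mh Ih s0; rewrite fineK// ge0_fin_numE ?tail_ge0//.
by apply: tail_fin => //; exact: core_ge0.
Qed.

Let lt_rearr_tail (h : R * R -> R) s x : measurable_fun setT (core h) -> 0 < s ->
  (s%:E < rearr h x)%E = ((V x)%:E < tail nu (core h) s)%E.
Proof. by move=> mh s0; rewrite (lt_rearr mh x (ltW s0)) (distribution_tail mh (ltW s0)). Qed.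

Let gap_measure (s : R) : 0 < s ->
  (\int[nu]_x G (s, x) = `|tf s - tg s|)%E.
Proof.
move=> s0.
have mGs : measurable_fun setT (fun x => G (s, x)).
  by apply: (measurableT_comp mG); exact: measurable_pair1.
rewrite (integral_strip_measure mGs (fun x => G0 (s, x))) {mGs}.
change (\int[leb2]_(x in strip) (gap (tf s) (tg s) (V x))%:E = `|tf s - tg s|)%E.
have key (a b : R) : 0 <= a -> a <= b ->
    (\int[leb2]_(x in strip) (gap a%:E b%:E (V x))%:E = (b - a)%:E)%E.
  move=> a0 ab; rewrite -disc_volume_itv//.
  set A := [set x | _].
  have mA : measurable (A : set (T * T)).
    rewrite (_ : A = strip `&` V @^-1` `[a, b[%classic).
      have mV : measurable_fun (@strip R : set (T * T)) V.
        by apply: measurable_funTS; exact: measurable_disc_volume.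
      by apply: mV; [exact: measurable_strip|exact: measurable_itv].
    by apply/seteqP; split => x [xs]; rewrite /= in_itv.
  transitivity (\int[leb2]_(x in strip) (\1_A x)%:E)%E.
    apply: eq_integral => x /set_mem xs; rewrite indicE gap_itv// lee_fin lte_fin.
    congr (_%:R)%:E; congr nat_of_bool; apply/idP/idP; rewrite inE => H; last by case: H.
    by split.
  rewrite integral_indic//; last exact: measurable_strip.
  by congr (leb2 _); apply: setIidl => x [].
rewrite /tf /tg (fin_tail mf If s0) (fin_tail mg Ig s0) -EFinB.
set a := fine _; set b := fine _.
have a0 : 0 <= a by rewrite fine_ge0 ?tail_ge0.
have b0 : 0 <= b by rewrite fine_ge0 ?tail_ge0.
have [ab|ba] := leP a b.
  by rewrite key//= distrC ger0_norm ?subr_ge0.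
under eq_integral do rewrite gapC.
by rewrite key ?(ltW ba)//= ger0_norm ?subr_ge0 ?(ltW ba).
Qed.

(** The rearrangements are stacked out of the same discs, so that their
    distance is that of the distribution functions. *)
Lemma tail_dist_le_rearr :
  (tail_dist nu (core f) (core g) <= norm1 (fun x => rearr f x - rearr g x))%E.
Proof.
rewrite (_ : tail_dist _ _ _ = \int[mu]_(s in pos) \int[nu]_x G (s, x))%E; last first.
  by apply: eq_integral => s; rewrite inE/= in_itv/= andbT => s0; rewrite gap_measure.
rewrite (@tonelli_on _ _ _ _ _ mu nu _ _ (measurable_itv _) measurableT G mG G0).
rewrite integral_strip_measure; last 2 first.
- exact: (@measurable_integral_sectionl _ _ _ _ _ mu _ _ (measurable_itv _) mG G0).
- by move=> x; apply: integral_ge0 => s _.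
apply: ge0_integral_mono => x _; first by apply: integral_ge0 => s _.
apply: le_trans (integral_gap (rearr_ge0 f x) (rearr_ge0 g x)).
rewrite le_eqVlt; apply/orP; left; apply/eqP; apply: eq_integral => s.
rewrite inE/= in_itv/= andbT => s0.
by congr (`|_%:R - _%:R|)%:E; congr nat_of_bool; apply/esym; exact: lt_rearr_tail.
Qed.

(** The points whose disc has a volume between the two distribution functions
    contribute. *)
Lemma beta_ge (s : R) : 0 < s ->
  (maxe 0 (distribution_function g s - distribution_function f s)
   <= beta (rearr f) (rearr g) s)%E.
Proof.
move=> s0; rewrite ge_max measure_ge0/= (distribution_tail mf (ltW s0)) (distribution_tail mg (ltW s0)).
rewrite (fin_tail mf If s0) (fin_tail mg Ig s0) -EFinB.
have a0 : 0 <= fine (tail nu (core f) s) by rewrite fine_ge0 ?tail_ge0.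
have [ab|ba] := leP (fine (tail nu (core f) s)) (fine (tail nu (core g) s)); last first.
  by apply: (@le_trans _ _ 0%E); rewrite ?measure_ge0// lee_fin subr_le0 ltW.
rewrite -disc_volume_itv// le_eqVlt; apply/orP; left; apply/eqP.
congr (leb2 _); apply/seteqP; split => x.
  move=> [xs /andP[h1 h2]]; split => //.
    by rewrite leNgt (lt_rearr_tail x mf s0) (fin_tail mf If s0) lte_fin -leNgt.
  by rewrite (lt_rearr_tail x mg s0) (fin_tail mg Ig s0) lte_fin.
move=> [xs]; rewrite leNgt [X in ~~ X](lt_rearr_tail x mf s0) => h1.
rewrite [X in is_true X](lt_rearr_tail x mg s0); move: h1.
rewrite (fin_tail mf If s0) (fin_tail mg Ig s0) !lte_fin -leNgt => h1 h2.
by split => //; apply/andP; split.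
Qed.

End rearrangement_distance.

(** * Mass, kinetic energy and magnetization *)

Section moments.
Context {R : realType}.
Local Notation mu := (@lebesgue_measure R).
Local Notation T := (measurableTypeR R).
Local Notation nu := (@strip_measure R).
Variable a : R * R -> R.
Hypothesis La : weightedL1 a.

Let weight (x : T * T) : R := 1 + x.2 ^+ 2.

Let weight_ge1 x : 1 <= weight x. Proof. by rewrite lerDl sqr_ge0. Qed.

Let mweight : measurable_fun setT weight.
Proof. by apply: measurable_funD => //; exact: measurable_funX. Qed.

Lemma measurable_on_strip : measurable_fun (@strip R : set (T * T)) (a : T * T -> R).
Proof.
have /measurable_EFinP mwa := measurable_int _ La.
rewrite (_ : a = fun x => (isq (weight x) ^+ 2) * (weight x * a x)); last first.
  apply/funext => x; have w0 : 0 < weight x := lt_le_trans ltr01 (weight_ge1 x).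
  by rewrite sqr_isq (max_idPr (ltW w0)) mulrA mulVf ?mul1r ?gt_eqF.
apply: measurable_funM => //; apply: measurable_funTS; apply: measurable_funX.
exact: (measurableT_comp measurable_isq mweight).
Qed.

Let ma := measurable_on_strip.

Lemma measurable_core : measurable_fun setT (core a).
Proof.
apply/(measurable_restrictT _ _).1; first exact: measurable_strip.
by apply: measurable_maxr => //; exact: measurable_on_strip.
Qed.

Let core_le x : core a x <= `|a x|.
Proof.
rewrite /core patchE; case: ifP => _; last by rewrite (_ : point = 0 :> R).
by rewrite ge_max normr_ge0 ler_norm.
Qed.

Let bounded_moment (k : T * T -> R) : measurable_fun setT k ->
  (forall x, 0 <= k x <= weight x) -> (\int[nu]_x (k x * core a x)%:E < +oo)%E.
Proof.
move=> mk k0.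
rewrite integral_strip_measure; last 2 first.
- by apply/measurable_EFinP; apply: measurable_funM => //; exact: measurable_core.
- by move=> x; rewrite lee_fin mulr_ge0 ?core_ge0//; have /andP[] := k0 x.
have /integrableP[_] := La; apply: le_lt_trans; apply: ge0_integral_mono => x _.
  by rewrite lee_fin mulr_ge0 ?core_ge0//; have /andP[] := k0 x.
rewrite /= lee_fin normrM (ger0_norm (le_trans ler01 (weight_ge1 x))).
by apply: ler_pM; rewrite ?core_ge0//; have /andP[] := k0 x.
Qed.

Lemma core_mass_fin : (\int[nu]_x (core a x)%:E < +oo)%E.
Proof.
have := @bounded_moment (cst 1) (measurable_cst _).
by under eq_integral do rewrite mul1r; apply => x /=; rewrite ler01 weight_ge1.
Qed.

Lemma core_kinetic_fin : (\int[nu]_x (x.2 ^+ 2 * core a x)%:E < +oo)%E.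
Proof.
apply: (@bounded_moment (fun x => x.2 ^+ 2)); first exact: measurable_funX.
by move=> x; rewrite sqr_ge0 /weight lerDr ler01.
Qed.

Let b : T * T -> R := a \_ strip.

Let ia : (@leb2 R).-integrable strip (EFin \o a).
Proof.
apply: (le_integrable measurable_strip _ _ La); first exact/measurable_EFinP.
move=> x _ /=; rewrite lee_fin normrM ler_peMl ?normr_ge0//.
by rewrite (ger0_norm (le_trans ler01 (weight_ge1 x))) weight_ge1.
Qed.

Let ib : (mu \x mu)%E.-integrable setT (EFin \o b).
Proof.
have -> : EFin \o b = (EFin \o a) \_ (@strip R).
  by apply/funext => x; rewrite /b /= !patchE; case: ifP.
by have [H _] := @integrable_mkcond _ _ _ (@leb2 R) _ (EFin \o a) measurable_strip; exact: H.
Qed.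

Let fubini_density (w : T -> R) : measurable_fun setT w -> (forall t, `|w t| <= 1) ->
  \int[leb]_(t in torus) (density a t * w t) = \int[leb2]_(x in strip) (a x * w x.1).
Proof.
move=> mw w1.
pose bw (x : T * T) : R := b x * w x.1.
have mb : measurable_fun setT b by apply/measurable_EFinP; exact: measurable_int ib.
have ibw : (mu \x mu)%E.-integrable setT (EFin \o bw).
  apply: (le_integrable measurableT _ _ ib).
    apply/measurable_EFinP; apply: measurable_funM => //; exact: measurableT_comp.
  by move=> x _ /=; rewrite lee_fin normrM ler_piMr.
rewrite /Rintegral; congr fine.
transitivity (\int[mu \x mu]_x (EFin \o bw) x)%E; last first.
  rewrite [RHS]integral_mkcond; apply: eq_integral => x _.
  by rewrite /bw /b /= !patchE; case: ifP => //; rewrite (_ : point = 0 :> R)// mul0r.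
rewrite -(integral12_prod_meas1 ibw).
have mF := measurable_fubini_F ibw; have mFb := measurable_fubini_F ib.
have densE t : torus t -> (density a t)%:E = (fine (fubini_F mu (EFin \o b) t))%:E.
  move=> tt; rewrite /density /Rintegral; congr (fine _)%:E; apply: eq_integral => v _.
  by rewrite /b /= patchE mem_set.
rewrite integral_mkcond; apply: ae_eq_integral => //.
  apply/(measurable_restrictT _ _).1; first exact: measurable_itv.
  apply: (@eq_measurable_fun _ _ _ _ _ (fun t => (fine (fubini_F mu (EFin \o b) t) * w t)%:E)).
    by move=> t /set_mem/densE [->].
  apply/measurable_EFinP; apply: measurable_funTS; apply: measurable_funM => //.
  exact: measurableT_comp.
have [N [mN N0 NS]] := ae_integrable1 ib.
exists N; split => // t /= Ht; apply: NS => /= it; apply: Ht => _.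
rewrite patchE; case: ifPn => [/set_mem tt|]; last first.
  rewrite notin_setE => tt; rewrite /fubini_F (_ : point = 0%E)//.
  apply/esym; apply: integral0_eq => v _; rewrite /bw /b /= patchE memNset ?mul0r//.
  by move=> [].
rewrite EFinM densE// fineK; last exact: integrable_fin_num it.
rewrite /fubini_F muleC -integralZl//; apply: eq_integral => v _.
by rewrite /bw /= -EFinM mulrC.
Qed.

Hypothesis a0 : nonnegative a.

Let ae_core (w : T * T -> R) : measurable_fun setT w ->
  \int[leb2]_(x in strip) (a x * w x) = \int[leb2]_(x in strip) (core a x * w x).
Proof.
move=> mw; rewrite /Rintegral; congr fine; apply: ae_eq_integral => //.
- exact: measurable_strip.
- by apply/measurable_EFinP; apply: measurable_funM => //; exact: measurable_funTS.
- apply/measurable_EFinP; apply: measurable_funTS.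
  by apply: measurable_funM => //; exact: measurable_core.
have [N [mN N0 NS]] := a0.
exists N; split => // x /= Hx; apply: NS => /= ax; apply: Hx => xs.
by rewrite /core patchE mem_set// (max_idPr _)// ax.
Qed.

Definition mass : R := fine (\int[nu]_x (core a x)%:E)%E.
Definition kinetic : R := fine (\int[nu]_x (x.2 ^+ 2 * core a x)%:E)%E.
(** The mass and the component of the magnetization in the direction [c], added
    so as to integrate a nonnegative function. *)
Definition tilted_mass (c : R) : R := fine (\int[nu]_x (tilt (turn c x) * core a x)%:E)%E.

Let mtilt c : measurable_fun setT (fun x : T * T => tilt (turn c x)).
Proof. exact: (measurableT_comp (@measurable_tilt R) (measurable_turn c)). Qed.

Lemma tilted_mass_fin c : (\int[nu]_x (tilt (turn c x) * core a x)%:E < +oo)%E.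
Proof.
apply: (@le_lt_trans _ _ (2%:E * \int[nu]_x (core a x)%:E)%E); last first.
  by rewrite lte_mul_pinfty// core_mass_fin.
rewrite -ge0_integralZl//; last 2 first.
- by apply/measurable_EFinP; exact: measurable_core.
- by move=> x _; rewrite lee_fin core_ge0.
apply: ge0_integral_mono => x _; first by rewrite lee_fin mulr_ge0 ?tilt_ge0 ?core_ge0.
by rewrite -EFinM lee_fin ler_wpM2r ?core_ge0// /tilt; have := cos_le1 (turn c x).1; lra.
Qed.

Lemma kineticE : \int[leb2]_(x in strip) (x.2 ^+ 2 * a x) = kinetic.
Proof.
have mk : measurable_fun setT (fun x : T * T => x.2 ^+ 2) by exact: measurable_funX.
rewrite /kinetic integral_strip_measure; last 2 first.
- by apply/measurable_EFinP; apply: measurable_funM => //; exact: measurable_core.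
- by move=> x; rewrite lee_fin mulr_ge0 ?sqr_ge0 ?core_ge0.
rewrite -/(Rintegral _ _ _).
under eq_Rintegral do rewrite mulrC.
by rewrite ae_core//; under eq_Rintegral do rewrite mulrC.
Qed.

Let core_integrable (k : T * T -> R) : measurable_fun setT k ->
  (forall x, 0 <= k x) -> (\int[nu]_x (k x * core a x)%:E < +oo)%E ->
  (@leb2 R).-integrable strip (EFin \o (fun x => k x * core a x)) /\
  \int[leb2]_(x in strip) (k x * core a x) = fine (\int[nu]_x (k x * core a x)%:E)%E.
Proof.
move=> mk k0; have mkc : measurable_fun setT (fun x => (k x * core a x)%:E).
  by apply/measurable_EFinP; apply: measurable_funM => //; exact: measurable_core.
have kc0 x : (0 <= (k x * core a x)%:E)%E by rewrite lee_fin mulr_ge0 ?core_ge0.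
rewrite (integral_strip_measure mkc kc0) => H; split => //.
apply/integrableP; split; first exact: measurable_funTS.
rewrite (eq_integral (fun x => (k x * core a x)%:E))// => x _.
by rewrite /= ger0_norm// mulr_ge0 ?core_ge0.
Qed.

Lemma magnetization_dot c :
  (magnetization a).1 * cos c + (magnetization a).2 * sin c = tilted_mass c - mass.
Proof.
have mcos : measurable_fun [set: R] (@cos R).
  by apply: continuous_measurable_fun; exact: continuous_cos.
have msin : measurable_fun [set: R] (@sin R).
  by apply: continuous_measurable_fun; exact: continuous_sin.
rewrite /magnetization /= !fubini_density//; last 2 first.
- by move=> t; rewrite ler_norml sin_geN1 sin_le1.
- by move=> t; rewrite ler_norml cos_geN1 cos_le1.
have iw (w : R -> R) : measurable_fun [set: R] w -> (forall t, `|w t| <= 1) ->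
    (@leb2 R).-integrable strip (EFin \o (fun x => a x * w x.1)).
  move=> mw w1; apply: (le_integrable measurable_strip _ _ ia).
    apply/measurable_EFinP; apply: measurable_funM => //.
    by apply: measurable_funTS; exact: measurableT_comp.
  by move=> x _ /=; rewrite lee_fin normrM ler_piMr.
have ic : (@leb2 R).-integrable strip (EFin \o (fun x => a x * cos x.1)).
  by apply: iw => // t; rewrite ler_norml cos_geN1 cos_le1.
have is_ : (@leb2 R).-integrable strip (EFin \o (fun x => a x * sin x.1)).
  by apply: iw => // t; rewrite ler_norml sin_geN1 sin_le1.
have mS := @measurable_strip R.
have E1 := RintegralZr (cos c) mS ic; have E2 := RintegralZr (sin c) mS is_.
have ic' : (@leb2 R).-integrable strip (EFin \o (fun x => a x * cos x.1 * cos c)).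
  exact: (integrableZr mS (cos c) ic).
have is' : (@leb2 R).-integrable strip (EFin \o (fun x => a x * sin x.1 * sin c)).
  exact: (integrableZr mS (sin c) is_).
have E3 := RintegralD mS ic' is'.
rewrite E1 E2 in E3; apply: etrans (esym E3) _; clear E1 E2 E3.
under eq_Rintegral do rewrite -!mulrA -mulrDr -cosB.
rewrite (@ae_core (fun x => cos (x.1 - c))); last first.
  by apply: measurableT_comp => //; exact: measurable_funB.
have [it tE] := core_integrable (mtilt c) (fun x => tilt_ge0 _) (tilted_mass_fin c).
have im1 : (\int[nu]_x (cst 1 x * core a x)%:E < +oo)%E.
  by under eq_integral do rewrite mul1r; exact: core_mass_fin.
have [im mE] := @core_integrable (cst 1) (measurable_cst _) (fun=> ler01) im1.
have mE' : mass = \int[leb2]_(x in strip) (cst 1 x * core a x).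
  by rewrite mE /mass; congr fine; apply: eq_integral => x _; rewrite mul1r.
rewrite mE' /tilted_mass -tE; apply: (etrans _ (RintegralB mS it im)); clear.
by apply: eq_Rintegral => x _; rewrite /tilt /turn /=; ring.
Qed.

End moments.

(** * The stability estimate for distribution functions *)

Lemma tail_dist_le_mass d (X : measurableType d) (R : realType)
    (nu : {sigma_finite_measure set X -> \bar R}) (f g : X -> R) :
  measurable_fun setT f -> measurable_fun setT g ->
  (forall x, 0 <= f x) -> (forall x, 0 <= g x) ->
  (tail_dist nu f g <= \int[nu]_x (f x)%:E + \int[nu]_x (g x)%:E)%E.
Proof.
move=> mf mg f0 g0.
have E (m : X -> R) : measurable_fun setT m -> (forall x, 0 <= m x) ->
  (\int[nu]_x (m x)%:E = \int[lebesgue_measure]_(s in `]0%R, +oo[) tail nu m s)%E.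
  move=> mm m0'; have := @layer_cake _ _ _ nu (cst 1) m (measurable_cst _) mm (fun=> ler01) m0'.
  under eq_integral do rewrite mul1r.
  by under [X in _ = X -> _]eq_integral do under eq_integral do rewrite mul1r.
rewrite !E// -ge0_integralD//; last 4 first.
- by move=> s _; exact: tail_ge0.
- by apply: measurable_funTS; exact: measurable_tail.
- by move=> s _; exact: tail_ge0.
- by apply: measurable_funTS; exact: measurable_tail.
apply: ge0_integral_mono => s _; first exact: abse_ge0.
apply: le_trans (lee_abs_sub _ _) _.
by rewrite !gee0_abs ?tail_ge0.
Qed.

Lemma dot_difference (R : realType) (x1 x2 y1 y2 u v A B I : R) :
  y1 * u + y2 * v = B -> x1 * u + x2 * v = I + A - I ->
  A - B = (x1 - y1) * u + (x2 - y2) * v.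
Proof. by move=> ? ?; lra. Qed.

Lemma energy_balance (R : realType) (m0 If Ig Kf Kg M D T W : R) :
  0 <= m0 -> If - Ig <= D ->
  T + (Kg / 2 + m0 * (2 * Ig - (Ig + m0)))
    <= Kf / 2 + m0 * (2 * If - (If + M)) + (2 * m0 * D + W) ->
  T <= Kf / 2 - Kg / 2 - M ^+ 2 / 2 + m0 ^+ 2 / 2 + (M - m0) ^+ 2 / 2 + 3 * m0 * D + W.
Proof.
move=> m00 ID; have : m0 * (If - Ig) <= m0 * D by rewrite ler_wpM2l.
by rewrite !expr2; lra.
Qed.

Lemma tilt_balance (R : realType) (m0 If Ig M D T Q : R) (h := M - m0) :
  `|If - Ig| <= D ->
  h * (If + M - (Ig + m0)) <= T + Q + 2 * `|h| * D ->
  h ^+ 2 <= T + Q + 3 * `|h| * D.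
Proof.
move=> ID; have : - (`|h| * D) <= h * (If - Ig).
  have : `|h * (If - Ig)| <= `|h| * D by rewrite normrM ler_wpM2l.
  by rewrite ler_norml => /andP[].
have -> : h * (If + M - (Ig + m0)) = h ^+ 2 + h * (If - Ig) by rewrite /h; ring.
by move: h `|h| => h a; lra.
Qed.

Definition energy_const (R : realType) (K q : R) : R :=
  32 * (K + 1) * (1 + (1 - 2 * q)^-1) + 1.

Definition mass_const (R : realType) (m0 d I0 : R) : R := 3 * m0 + 3 * d + 2 + 2 * I0.

(** With [h] the gap of the magnetizations, [T] the transport cost, [N] the mass
    that the perturbation lacks below the steady state and [L] their distance:
    as [q < 1 / 2], the last hypothesis absorbs the quadratic term of the bound
    for [T]; the optimal [k] then gives [N ^+ 2 <= 4 (K + 1) T]. The mass enters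
    because [D ^+ 2] is traded for [(I + I0) * D]. *)
Lemma combine_estimates (R : realType) (K q m0 d H h I I0 D W T N L : R) :
  0 <= K -> 0 <= q -> q < 1 / 2 -> 0 < m0 -> 0 <= d -> `|h| <= d ->
  0 <= D -> 0 <= W -> 0 <= T -> 0 <= N -> 0 <= L -> 0 <= I -> 0 <= I0 -> D <= I + I0 ->
  T <= H + h ^+ 2 / 2 + 3 * m0 * D + W ->
  (forall k, 0 < k -> k * N <= T + k ^+ 2 * K) ->
  L <= 2 * N + D ->
  h ^+ 2 <= T + q * h ^+ 2 + 3 * `|h| * D ->
  L ^+ 2 <= energy_const K q * (H + mass_const m0 d I0 * (1 + I) * D + W).
Proof.
move=> K0 q0 q1 m00 d0 hd D0 W0 T0 N0 L0 I_0 I00 DI TH NT LN hT.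
pose B := H + (3 * m0 + 3 * d) * D + W; set r := (1 - 2 * q)^-1.
have q2 : 0 < 1 - 2 * q by lra.
have r0 : 0 < r by rewrite invr_gt0.
have rE : r * (1 - 2 * q) = 1 by rewrite mulVf// gt_eqF.
have hD : 3 * `|h| * D <= 3 * d * D by rewrite ler_wpM2r// ler_wpM2l.
have hB : h ^+ 2 * (1 - 2 * q) <= 2 * B by rewrite /B; lra.
have B0 : 0 <= B by have := sqr_ge0 h; nra.
have h2 : h ^+ 2 <= 2 * B * r.
  apply: le_trans (ler_wpM2r (ltW r0) hB).
  by rewrite -mulrA (mulrC (1 - 2 * q)) rE mulr1.
have TB : T <= B * (1 + r).
  apply: le_trans TH _; rewrite /B in h2 *.
  have : 0 <= d * D by rewrite mulr_ge0.
  lra.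
have N2 : N ^+ 2 <= 4 * (K + 1) * T.
  have K1 : 0 < K + 1 by lra.
  move: N0; rewrite le_eqVlt => /orP[/eqP <-|Np]; first by rewrite expr0n/= !mulr_ge0//; lra.
  (* the width of the shell for which the defect and the shell balance *)
  pose k := N / (2 * (K + 1)).
  have kp : 0 < k by rewrite divr_gt0//; lra.
  have NE : N = 2 * (K + 1) * k by rewrite /k mulrC divfK// gt_eqF//; lra.
  have := NT k kp; rewrite NE; have := sqr_ge0 k; nra.
have L2 : L ^+ 2 <= 8 * N ^+ 2 + 2 * D ^+ 2.
  have : L ^+ 2 <= (2 * N + D) ^+ 2 by rewrite ler_pXn2r// nnegrE// addr_ge0 ?mulr_ge0.
  by have := sqr_ge0 (2 * N - D); rewrite !expr2; nra.
have D2 : D ^+ 2 <= (I + I0) * D by rewrite expr2 ler_wpM2r.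
have E0 : 0 <= 32 * (K + 1) * (1 + r) by rewrite !mulr_ge0//; lra.
apply: (@le_trans _ _ (energy_const K q * (B + 2 * (I + I0) * D))).
  rewrite /energy_const -/r.
  have ID : 0 <= 2 * (I + I0) * D by rewrite mulr_ge0//; lra.
  have E1 := mulr_ge0 E0 ID.
  have N3 : 8 * N ^+ 2 <= 32 * (K + 1) * (1 + r) * B.
    apply: (@le_trans _ _ (32 * (K + 1) * T)); first by lra.
    rewrite -(mulrA (32 * (K + 1)) (1 + r)); apply: ler_wpM2l; first by rewrite mulr_ge0//; lra.
    by rewrite mulrC.
  rewrite mulrDl mul1r mulrDr; lra.
rewrite ler_wpM2l ?addr_ge0// /B /mass_const.
have ID := mulr_ge0 I_0 D0; have mID := mulr_ge0 (ltW m00) ID; have dID := mulr_ge0 d0 ID.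
have IID := mulr_ge0 I00 ID; lra.
Qed.

Section steady.
Context {R : realType}.
Local Notation mu := (@lebesgue_measure R).
Local Notation T := (measurableTypeR R).
Local Notation nu := (@strip_measure R).
Local Notation pos := (`]0%R, +oo[%classic : set T).
Local Notation tor := (`[0%R, (2 * pi)%R]%classic : set T).
Variables (F : R -> R) (estar : \bar R) (m0 : R) (f0 : R * R -> R).
Hypothesis hF : profile_with_cutoff F estar.
Hypothesis m0_gt0 : 0 < m0.
Hypothesis f0E : forall x : R * R, f0 x = F (e0 m0 x).
Hypothesis Lf0 : weightedL1 f0.
Hypothesis steady : forall theta : R, torus theta -> potential f0 theta = phi0 m0 theta.

Let f0_ge0 x : 0 <= f0 x. Proof. by rewrite f0E (profile_ge0 hF). Qed.

Let mF : measurable_fun [set: R] F.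
Proof. exact: continuous_measurable_fun (profile_continuous hF). Qed.

Let me0 : measurable_fun setT (e0 m0 : T * T -> R).
Proof.
apply: measurable_funD; first by apply: measurable_funM => //; exact: measurable_funX.
apply: measurable_funM => //; apply: measurableT_comp => //.
by apply: continuous_measurable_fun; exact: continuous_cos.
Qed.

Let mf0 : measurable_fun setT (f0 : T * T -> R).
Proof.
rewrite (_ : f0 = F \o e0 m0); last exact/funext.
exact: (measurableT_comp mF me0).
Qed.

(** The values of the potential at the angles 0 and [pi / 2] are the components
    of the magnetization, up to sign. *)
Lemma steady_magnetization : magnetization f0 = (m0, 0).
Proof.
have p0 := pi_gt0 R.
have t0 : torus (0 : R) by rewrite /torus/= in_itv/= lexx mulr_ge0// ltW.
have t1 : torus (pi / 2 : R) by rewrite /torus/= in_itv/=; lra.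
rewrite /magnetization; congr pair.
  have := steady t0; rewrite /potential /phi0 cos0 mulr1 => /oppr_inj <-.
  by apply: eq_Rintegral => t _; rewrite sub0r cosN.
have := steady t1; rewrite /potential /phi0 cos_pihalf mulr0 => /eqP.
rewrite oppr_eq0 => /eqP <-; apply: eq_Rintegral => t _.
by rewrite cosB cos_pihalf sin_pihalf mul0r add0r mul1r.
Qed.

(** Otherwise the steady state vanishes, and its magnetization with it. *)
Lemma cutoff_above : ((- m0)%:E < estar)%E.
Proof.
rewrite ltNge; apply/negP => em; move: steady_magnetization => [+ _].
have d0 t : density f0 t = 0.
  rewrite /density /Rintegral integral0_eq// => v _.
  rewrite f0E (profile_eq0 hF)//.
  apply: le_trans em _; rewrite lee_fin /e0 /phi0 /=.
  have v0 : 0 <= v ^+ 2 / 2 by rewrite divr_ge0 ?sqr_ge0.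
  have : 0 <= m0 * (1 - cos t) by rewrite mulr_ge0 ?(ltW m0_gt0)// subr_ge0 cos_le1.
  by move: (v ^+ 2 / 2) v0 (cos t) => w v0 c H; lra.
rewrite /Rintegral integral0_eq => [H|t _]; last by rewrite d0 mul0r.
by move: m0_gt0; rewrite -H ltxx.
Qed.

Let m0e := cutoff_above.

(** A superlevel that reaches the height [2 * m0 + y] contains, at every angle,
    the velocities with [v ^+ 2 < y]. *)
Lemma height_level_le (s : R) : 0 < s ->
  ((height_level m0 hF s)%:E <= (2 * m0)%:E + distribution_function f0 s ^+ 2)%E.
Proof.
move=> s0; set y := height_level m0 hF s - 2 * m0.
have D0 : (0 <= distribution_function f0 s)%E by exact: measure_ge0.
have [y0|y0] := leP y 0.
  apply: (@le_trans _ _ (2 * m0)%:E); first by rewrite lee_fin; move: y0; rewrite /y; lra.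
  by rewrite leeDl// expe_ge0.
have p2 := pi_ge2 R.
suff H : ((Num.sqrt y)%:E <= distribution_function f0 s)%E.
  rewrite (_ : height_level _ _ _ = 2 * m0 + Num.sqrt y ^+ 2); last first.
    by rewrite sqr_sqrtr ?(ltW y0)// /y; ring.
  rewrite EFinD leeD2l// EFin_expe.
  by rewrite !expe2; apply: lee_pmul; rewrite ?lee_fin ?sqrtr_ge0.
apply: (@le_trans _ _ (@leb2 R ((tor `*` `[0, Num.sqrt y[) `&` strip))).
  rewrite strip_box ?torus_measure//; try exact: measurable_itv.
  rewrite lebesgue_measure_itv/= lte_fin sqrtr_gt0 y0 -EFinB -EFinM lee_fin subr0.
  by rewrite ler_peMl ?sqrtr_ge0//; lra.
apply: le_measure; rewrite ?inE//.
- apply: measurableI; last exact: measurable_strip.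
  by apply: measurableX; exact: measurable_itv.
- rewrite (_ : [set x | _] = strip `&` f0 @^-1` `]s, +oo[%classic).
    have mfs : measurable_fun (@strip R : set (T * T)) (f0 : T * T -> R) by exact: measurable_funTS.
    by apply: mfs; [exact: measurable_strip|exact: measurable_itv].
  by apply/seteqP; split => x; rewrite /= in_itv/= andbT.
move=> [t v] [[/= _]]; rewrite in_itv/= => /andP[v0 vy] st; split => //.
rewrite f0E (@profile_superlevel _ _ _ _ hF m0_gt0)// /height/=.
have vy' : v ^+ 2 < y by rewrite -(sqr_sqrtr (ltW y0)) ltr_pXn2r// nnegrE// sqrtr_ge0.
have v2 := sqr_ge0 v.
have : 0 <= m0 * (1 + cos t) by rewrite mulr_ge0 ?(ltW m0_gt0)//; have := cos_geN1 t; lra.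
move: vy' v2; rewrite /y; move: (v ^+ 2) (cos t) (height_level _ _ _) => w c h; lra.
Qed.

Lemma compact_distribution : compactly_supported f0 ->
  exists2 V : R, 0 <= V & forall s, 0 <= s -> (distribution_function f0 s <= V%:E)%E.
Proof.
move=> /compact_bounded[M [_ HM]].
pose B := Num.max 1 (M + 1).
have B1 : 1 <= B by rewrite le_max lexx.
have MB : M < B by rewrite lt_max ltrDl ltr01 orbT.
have p0 := pi_gt0 R.
exists (2 * pi * (2 * B)); first by rewrite !mulr_ge0// ?ltW//; lra.
move=> s s0.
apply: (@le_trans _ _ (@leb2 R ((tor `*` `[- B, B]) `&` strip))); last first.
  rewrite strip_box ?torus_measure//; try exact: measurable_itv.
  have BB : - B < B by lra.
  rewrite lebesgue_measure_itv/= lte_fin BB.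
  by rewrite -EFinB -EFinM lee_fin opprK; lra.
apply: le_measure; rewrite ?inE//.
- rewrite (_ : [set x | _] = strip `&` f0 @^-1` `]s, +oo[%classic).
    have mfs : measurable_fun (@strip R : set (T * T)) (f0 : T * T -> R) by exact: measurable_funTS.
    by apply: mfs; [exact: measurable_strip|exact: measurable_itv].
  by apply/seteqP; split => x; rewrite /= in_itv/= andbT.
- apply: measurableI; last exact: measurable_strip.
  by apply: measurableX; exact: measurable_itv.
move=> x [xs sx]; split => //; split; first by case: xs.
have : `|x| <= B.
  apply: HM => //; apply: subset_closure; split => //.
  by rewrite gt_eqF// (le_lt_trans s0).
by rewrite prod_normE ge_max => /andP[_]; rewrite ler_norml /= in_itv.
Qed.

Let G (x : T * T) : R := F (e0 m0 x).

Let mG : measurable_fun setT G. Proof. exact: (measurableT_comp mF me0). Qed.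

Let G0 x : 0 <= G x. Proof. exact: (profile_ge0 hF). Qed.

Let coreE x : strip x -> core f0 x = G x.
Proof. by move=> xs; rewrite /core patchE mem_set// f0E; apply/max_idPr; exact: G0. Qed.

Let Gper t v : G (t + 2 * pi, v) = G (t, v).
Proof. by rewrite /G /e0 /phi0 /= mulr_natl cosD2pi. Qed.

Section turned.
Variable c : R.
Hypothesis ct : torus c.

Let g (x : T * T) : R := G (turn c x).

Let mg : measurable_fun setT g.
Proof. exact: (measurableT_comp mG (measurable_turn c)). Qed.

Let g0 x : 0 <= g x. Proof. exact: G0. Qed.

Let f0c := translate f0 c.

Let f0cE x : f0c x = g x. Proof. by rewrite /f0c /translate f0E. Qed.

Let core_gE x : strip x -> core f0c x = g x.
Proof. by move=> xs; rewrite /core patchE mem_set// f0cE; apply/max_idPr; exact: g0. Qed.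

(** Moments of the translate, in the frame that moves with it. *)
Let moment_turn (k : T * T -> R) : measurable_fun setT k -> (forall x, 0 <= k x) ->
  (forall t v, k (t + 2 * pi, v) = k (t, v)) ->
  (\int[nu]_x (k (turn c x) * g x)%:E = \int[nu]_x (k x * core f0 x)%:E)%E.
Proof.
move=> mk k0 per.
have mkG : measurable_fun setT (fun x => (k x * G x)%:E).
  by apply/measurable_EFinP; exact: measurable_funM.
rewrite integral_strip_measure; last 2 first.
- by apply: (measurableT_comp mkG); exact: measurable_turn.
- by move=> x; rewrite lee_fin mulr_ge0.
rewrite [RHS]integral_strip_measure; last 2 first.
- by apply/measurable_EFinP; apply: measurable_funM => //; exact: measurable_core Lf0.
- by move=> x; rewrite lee_fin mulr_ge0 ?core_ge0.
rewrite (@ge0_integral_strip_shift _ (fun x => (k x * G x)%:E))//; last 2 first.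
- by move=> x; rewrite lee_fin mulr_ge0.
- by move=> t v; rewrite per Gper.
by apply: eq_integral => x /set_mem xs; rewrite coreE.
Qed.

Let nonneg_f0c : nonnegative f0c.
Proof. by apply: aeW => x _; rewrite f0cE. Qed.

Let L_f0c : weightedL1 f0c.
Proof.
have mw : measurable_fun setT (fun x : T * T => 1 + x.2 ^+ 2).
  by apply: measurable_funD => //; exact: measurable_funX.
have mwg : measurable_fun setT (fun x : T * T => ((1 + x.2 ^+ 2) * f0c x)%:E).
  rewrite (_ : (fun x => _) = (fun x : T * T => ((1 + x.2 ^+ 2) * g x)%:E)).
    by apply/measurable_EFinP; exact: measurable_funM.
  by apply/funext => x; rewrite f0cE.
apply/integrableP; split; first exact: measurable_funTS.
have w0 (x : T * T) : 0 <= 1 + x.2 ^+ 2 by rewrite addr_ge0 ?sqr_ge0.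
have := moment_turn mw w0 (fun t v => erefl).
rewrite integral_strip_measure; last 2 first.
- by apply/measurable_EFinP; exact: measurable_funM.
- by move=> x; rewrite lee_fin mulr_ge0 ?w0.
rewrite (eq_integral (fun x : T * T => `|((1 + x.2 ^+ 2) * f0c x)%:E|%E)); last first.
  by move=> x _; rewrite gee0_abs f0cE ?lee_fin ?mulr_ge0 ?w0.
move=> ->.
rewrite integral_strip_measure; last 2 first.
- by apply/measurable_EFinP; apply: measurable_funM => //; exact: measurable_core Lf0.
- by move=> x; rewrite lee_fin mulr_ge0 ?core_ge0.
have /integrableP[_] := Lf0; apply: le_lt_trans; apply: ge0_integral_mono => x xs.
  by rewrite lee_fin mulr_ge0 ?core_ge0.
by rewrite coreE// /G -f0E lee_abs.
Qed.

Let moment_core (k : T * T -> R) : measurable_fun setT k -> (forall x, 0 <= k x) ->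
  (\int[nu]_x (k x * core f0c x)%:E = \int[nu]_x (k x * g x)%:E)%E.
Proof.
move=> mk k0.
rewrite integral_strip_measure; last 2 first.
- by apply/measurable_EFinP; apply: measurable_funM => //; exact: measurable_core L_f0c.
- by move=> x; rewrite lee_fin mulr_ge0 ?core_ge0.
rewrite [RHS]integral_strip_measure; last 2 first.
- by apply/measurable_EFinP; exact: measurable_funM.
- by move=> x; rewrite lee_fin mulr_ge0.
by apply: eq_integral => x /set_mem xs; rewrite core_gE.
Qed.

Let mtilt_turn : measurable_fun setT (fun x : T * T => tilt (turn c x)).
Proof. exact: (measurableT_comp (@measurable_tilt R) (measurable_turn c)). Qed.

Let fin_moment (y : \bar R) : (0 <= y)%E -> (y < +oo)%E -> y = (fine y)%:E.
Proof. by move=> y0 yy; rewrite fineK// ge0_fin_numE. Qed.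

Let mass_g : (\int[nu]_x (g x)%:E = (mass f0)%:E)%E.
Proof.
rewrite /mass -fin_moment ?(core_mass_fin Lf0)//; last first.
  by apply: integral_ge0 => x _; rewrite lee_fin core_ge0.
have := @moment_turn (cst 1) (measurable_cst _) (fun=> ler01) (fun _ _ => erefl).
by under eq_integral do rewrite mul1r; under [RHS]eq_integral do rewrite mul1r.
Qed.

Let kinetic_g : (\int[nu]_x (x.2 ^+ 2 * g x)%:E = (kinetic f0)%:E)%E.
Proof.
rewrite /kinetic -fin_moment ?(core_kinetic_fin Lf0)//; last first.
  by apply: integral_ge0 => x _; rewrite lee_fin mulr_ge0 ?sqr_ge0 ?core_ge0.
apply: (@moment_turn (fun x => x.2 ^+ 2)) => //; first exact: measurable_funX.
by move=> x; exact: sqr_ge0.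
Qed.

Let tilt_g : (\int[nu]_x (tilt (turn c x) * g x)%:E = (mass f0 + m0)%:E)%E.
Proof.
have Nf0 : nonnegative f0 by apply: aeW => x _; exact: f0_ge0.
have := magnetization_dot Lf0 Nf0 0.
rewrite steady_magnetization/= cos0 sin0 mulr1 mulr0 addr0 => m0E.
rewrite (_ : mass f0 + m0 = tilted_mass f0 0); last by rewrite m0E; ring.
rewrite /tilted_mass -fin_moment ?(tilted_mass_fin Lf0)//; last first.
  by apply: integral_ge0 => x _; rewrite lee_fin mulr_ge0 ?tilt_ge0 ?core_ge0.
rewrite (@moment_turn (@tilt R))//.
- by apply: eq_integral => x _; rewrite /turn subr0; case: x.
- exact: measurable_tilt.
- exact: tilt_ge0.
- by move=> t v; rewrite /tilt/= mulr_natl cosD2pi.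
Qed.

Let tail_g (s : R) : 0 <= s -> tail nu g s = distribution_function f0 s.
Proof.
move=> s0; rewrite (distribution_tail (measurable_core Lf0) s0) /tail.
have ml (h : T * T -> R) : measurable_fun setT h -> measurable_fun setT (fun x => (layer h (s, x))%:E).
  move=> mh; apply/measurable_EFinP; apply: (measurableT_comp (measurable_layer mh)).
  exact: measurable_pair1.
rewrite integral_strip_measure; [|exact: ml|by move=> x; rewrite lee_fin layer_ge0].
rewrite [RHS]integral_strip_measure; first last.
- by move=> x; rewrite lee_fin layer_ge0.
- by apply: ml; exact: measurable_core Lf0.
rewrite (@ge0_integral_strip_shift _ (fun x => (layer G (s, x))%:E))//.
- by apply: eq_integral => x /set_mem xs; rewrite /layer/= coreE.
- exact: ml.
- by move=> x; rewrite lee_fin layer_ge0.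
- by move=> t v; rewrite /layer/= Gper.
Qed.

Section perturbation.
Variable f : R * R -> R.
Hypotheses (Pf : nonnegative f) (Lf : weightedL1 f).

Let fc := core f.
Let mfc : measurable_fun setT fc := measurable_core Lf.
Let fc0 x : 0 <= fc x. Proof. exact: core_ge0. Qed.

Let mass_f : (\int[nu]_x (fc x)%:E = (mass f)%:E)%E.
Proof.
rewrite /mass -fin_moment ?(core_mass_fin Lf)//.
by apply: integral_ge0 => x _; rewrite lee_fin.
Qed.

Let kinetic_f : (\int[nu]_x (x.2 ^+ 2 * fc x)%:E = (kinetic f)%:E)%E.
Proof.
rewrite /kinetic -fin_moment ?(core_kinetic_fin Lf)//.
by apply: integral_ge0 => x _; rewrite lee_fin mulr_ge0 ?sqr_ge0.
Qed.

Let tilt_f : (\int[nu]_x (tilt (turn c x) * fc x)%:E = (tilted_mass f c)%:E)%E.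
Proof.
rewrite /tilted_mass -fin_moment ?(tilted_mass_fin Lf)//.
by apply: integral_ge0 => x _; rewrite lee_fin mulr_ge0 ?tilt_ge0.
Qed.

Let eps (x : T * T) := height m0 (turn c x).

Let meps : measurable_fun setT eps.
Proof. exact: (measurableT_comp (measurable_height m0) (measurable_turn c)). Qed.

Let height_moment (h : T * T -> R) (I K P : R) : measurable_fun setT h ->
  (forall x, 0 <= h x) ->
  (\int[nu]_x (h x)%:E = I%:E)%E -> (\int[nu]_x (x.2 ^+ 2 * h x)%:E = K%:E)%E ->
  (\int[nu]_x (tilt (turn c x) * h x)%:E = P%:E)%E ->
  (\int[nu]_x (eps x * h x)%:E = (K / 2 + m0 * (2 * I - P))%:E)%E.
Proof.
move=> mh h0 hI hK hP.
have m0' := ltW m0_gt0.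
have mk : measurable_fun setT (fun x : T * T => (x.2 ^+ 2 * h x)%:E).
  by apply/measurable_EFinP; apply: measurable_funM => //; exact: measurable_funX.
have mt : measurable_fun setT (fun x : T * T => (tilt (turn c x) * h x)%:E).
  by apply/measurable_EFinP; exact: measurable_funM.
have mh' : measurable_fun setT (fun x : T * T => (h x)%:E) by exact/measurable_EFinP.
have me : measurable_fun setT (fun x : T * T => (eps x * h x)%:E).
  by apply/measurable_EFinP; exact: measurable_funM.
have k0 (x : T * T) : (0 <= (x.2 ^+ 2 * h x)%:E)%E by rewrite lee_fin mulr_ge0 ?sqr_ge0.
have t0 (x : T * T) : (0 <= (tilt (turn c x) * h x)%:E)%E by rewrite lee_fin mulr_ge0 ?tilt_ge0.
have h0' (x : T * T) : (0 <= (h x)%:E)%E by rewrite lee_fin.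
have e0' (x : T * T) : (0 <= (eps x * h x)%:E)%E by rewrite lee_fin mulr_ge0 ?height_ge0.
have E : (\int[nu]_x (eps x * h x)%:E + m0%:E * \int[nu]_x (tilt (turn c x) * h x)%:E
   = (2^-1)%:E * \int[nu]_x (x.2 ^+ 2 * h x)%:E + (2 * m0)%:E * \int[nu]_x (h x)%:E)%E.
  rewrite -!ge0_integralZl ?lee_fin ?invr_ge0 ?mulr_ge0//.
  rewrite -!ge0_integralD//.
  - apply: eq_integral => x _; rewrite -!EFinM -!EFinD; congr EFin.
    by rewrite /eps /height /tilt; ring.
  - by move=> x _; rewrite mule_ge0// lee_fin invr_ge0.
  - exact: emeasurable_funM.
  - by move=> x _; rewrite mule_ge0// lee_fin mulr_ge0.
  - exact: emeasurable_funM.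
  - by move=> x _; rewrite mule_ge0// lee_fin.
  - exact: emeasurable_funM.
move: E; rewrite hI hK hP -!EFinM -EFinD.
case: (\int[nu]_x _)%E => [r| |]//= [E]; congr EFin; lra.
Qed.

Hypothesis Mf : magnetization f =
  (euclid (magnetization f) * cos c, euclid (magnetization f) * sin c).

Let tilted_f : tilted_mass f c = mass f + euclid (magnetization f).
Proof.
have := magnetization_dot Lf Pf c; rewrite {1 2}Mf /=.
rewrite -!mulrA -mulrDr -!expr2 cos2Dsin2 mulr1 => ->; ring.
Qed.

Let magnetization_gap : `|euclid (magnetization f) - m0| <=
  euclid (magnetization f - magnetization f0c).
Proof.
have := magnetization_dot L_f0c nonneg_f0c c; rewrite /tilted_mass /mass.
rewrite moment_core//; last by move=> x; exact: tilt_ge0.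
have -> : (\int[nu]_x (core f0c x)%:E = (mass f0)%:E)%E.
  rewrite -mass_g; have := @moment_core (cst 1) (measurable_cst _) (fun=> ler01).
  by under eq_integral do rewrite mul1r; under [RHS]eq_integral do rewrite mul1r.
rewrite tilt_g => Eg0.
have Eg : (magnetization f0c).1 * cos c + (magnetization f0c).2 * sin c = m0.
  by rewrite Eg0 /=; ring.
set a1 := (magnetization f).1 - (magnetization f0c).1.
set a2 := (magnetization f).2 - (magnetization f0c).2.
have -> : euclid (magnetization f) - m0 = a1 * cos c + a2 * sin c.
  have := magnetization_dot Lf Pf c; rewrite tilted_f => Ef.
  exact: dot_difference Eg Ef.
rewrite -ler_sqr ?nnegrE ?sqrtr_ge0// real_normK ?num_real// sqr_sqrtr ?addr_ge0 ?sqr_ge0//.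
rewrite /= -/a1 -/a2; have := cos2Dsin2 c; have := sqr_ge0 (a1 * sin c - a2 * cos c).
move: (cos c) (sin c) => u v H1 H2.
have -> : a1 ^+ 2 + a2 ^+ 2 = (a1 ^+ 2 + a2 ^+ 2) * (u ^+ 2 + v ^+ 2) by rewrite H2 mulr1.
by nra.
Qed.

Let energy_gap : energy f - energy f0 =
  kinetic f / 2 - kinetic f0 / 2 - euclid (magnetization f) ^+ 2 / 2 + m0 ^+ 2 / 2.
Proof.
have E : energy f = kinetic f / 2 - euclid (magnetization f) ^+ 2 / 2.
  by rewrite /energy kineticE// mulrC [2^-1 * _ ^+ 2]mulrC.
have E0 : energy f0 = kinetic f0 / 2 - m0 ^+ 2 / 2.
  rewrite /energy kineticE//; last by apply: aeW => x _; exact: f0_ge0.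
  rewrite steady_magnetization /euclid /= expr0n addr0 sqrtr_sqr.
  by rewrite real_normK ?num_real// mulrC [2^-1 * _ ^+ 2]mulrC.
rewrite E E0; ring.
Qed.

Let etaL := height_level m0 hF.

Let metaL : measurable_fun setT etaL. Proof. exact: measurable_height_level. Qed.

Let superlevel (s : R) (x : T * T) : 0 < s -> (s < g x) = (eps x < etaL s).
Proof. by move=> s0; rewrite /g /G (@profile_superlevel _ _ _ _ hF m0_gt0). Qed.

(** The error term of large superlevels, in terms of the distribution functions
    alone. *)
Definition volume_loss : \bar R :=
  (\int[mu]_(s in pos) (distribution_function f0 s ^+ 2
     * maxe 0 (distribution_function f0 s - distribution_function f s)))%E.

Let loss_le :
  (\int[mu]_(s in pos) ((etaL s)%:E * maxe 0 (tail nu g s - tail nu fc s))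
   <= (2 * m0)%:E * tail_dist nu fc g + volume_loss)%E.
Proof.
have mtf := measurable_tail nu mfc; have mtg := measurable_tail nu mg.
have m0' := ltW m0_gt0.
pose W' := (\int[mu]_(s in pos) (tail nu g s ^+ 2 * maxe 0 (tail nu g s - tail nu fc s)))%E.
have posE (s : R) : s \in pos -> 0 < s by rewrite inE/= in_itv/= andbT.
have -> : volume_loss = W'.
  apply: eq_integral => s /posE s0.
  by rewrite tail_g ?(ltW s0)// -(distribution_tail mfc (ltW s0)).
have mm : measurable_fun setT (fun s => maxe 0 (tail nu g s - tail nu fc s))%E.
  by apply: (measurable_maxe (measurable_cst _)); exact: emeasurable_funB.
have max0 s : (0 <= maxe 0 (tail nu g s - tail nu fc s))%E by rewrite le_max lexx.
have md : measurable_fun setT (fun s => `|tail nu fc s - tail nu g s|)%E.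
  by apply: measurableT_comp => //; exact: emeasurable_funB.
have msq : measurable_fun setT (fun s => tail nu g s ^+ 2)%E.
  by under eq_fun do rewrite expe2; exact: emeasurable_funM.
rewrite /tail_dist -ge0_integralZl ?lee_fin ?mulr_ge0//; last exact: measurable_funTS.
rewrite -ge0_integralD; last 5 first.
- exact: measurable_itv.
- by move=> s _; rewrite mule_ge0// lee_fin mulr_ge0.
- by apply: measurable_funTS; exact: emeasurable_funM.
- by move=> s _; rewrite mule_ge0// expe_ge0// tail_ge0.
- by apply: measurable_funTS; exact: emeasurable_funM.
apply: ge0_integral_mono => s /mem_set/posE s0.
  by rewrite mule_ge0// lee_fin; exact: height_level_ge0.
have tf : tail nu fc s \is a fin_num.
  by rewrite ge0_fin_numE ?tail_ge0// tail_fin// mass_f ltry.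
have tg : tail nu g s \is a fin_num.
  by rewrite ge0_fin_numE ?tail_ge0// tail_fin// mass_g ltry.
apply: (@le_trans _ _ (((2 * m0)%:E + tail nu g s ^+ 2) * maxe 0 (tail nu g s - tail nu fc s))%E).
  rewrite lee_wpmul2r// tail_g ?(ltW s0)//; exact: height_level_le.
rewrite ge0_muleDl ?lee_fin ?mulr_ge0 ?expe_ge0 ?tail_ge0// leeD2r// lee_wpmul2l ?lee_fin ?mulr_ge0//.
rewrite -abseN (_ : (- (tail nu fc s - tail nu g s) = tail nu g s - tail nu fc s)%E).
  by rewrite ge_max abse_ge0 lee_abs.
by rewrite fin_num_oppeB// addeC.
Qed.

(** The displacement that is tested is the gap of the magnetizations itself, so
    that its first order effect is the square of the gap. *)
Lemma stability_estimate (K q d : R) : 0 <= K -> 0 <= q -> q < 1 / 2 -> 0 <= d ->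
  (forall k, 0 < k -> (\int[mu]_(s in pos) \int[nu]_x (shell eps etaL k (s, x))%:E
    <= (k * K)%:E)%E) ->
  (forall t, `|t| <= d -> (\int[mu]_(s in pos) \int[nu]_x
     (remainder eps etaL (fun x => tilt (turn c x)) (tilt_level m0 hF) t (s, x))%:E
     <= (q * t ^+ 2)%:E)%E) ->
  euclid (magnetization f - magnetization f0c) <= d ->
  ((\int[nu]_x (`|fc x - g x|)%:E) ^+ 2 <= (energy_const K q)%:E *
    ((energy f - energy f0)%:E
     + (mass_const m0 d (mass f0) * (1 + mass f))%:E * tail_dist nu fc g
     + volume_loss))%E.
Proof.
move=> K0 q0 q1 d0 shellH remH hd.
have eps0 x : 0 <= eps x by exact: height_ge0.
have eta0 s : 0 <= etaL s by exact: height_level_ge0.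
have If : (\int[nu]_x (fc x)%:E < +oo)%E by rewrite mass_f ltry.
have Ig : (\int[nu]_x (g x)%:E < +oo)%E by rewrite mass_g ltry.
have I0 : 0 <= mass f by rewrite fine_ge0// integral_ge0// => x _; rewrite lee_fin core_ge0.
have Ig0 : 0 <= mass f0 by rewrite fine_ge0// integral_ge0// => x _; rewrite lee_fin core_ge0.
have A0 : 0 < energy_const K q.
  rewrite ltr_wpDl// !mulr_ge0//; first by lra.
  by rewrite addr_ge0// invr_ge0; lra.
have Mc0 : 0 <= mass_const m0 d (mass f0) by rewrite /mass_const !addr_ge0// mulr_ge0// ltW.
set D := tail_dist nu fc g.
have D0 : (0 <= D)%E by apply: integral_ge0 => s _; exact: abse_ge0.
have DI : (D <= (mass f + mass f0)%:E)%E.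
  by rewrite EFinD -mass_f -mass_g; exact: tail_dist_le_mass.
have [Dr DE] : exists Dr, D = Dr%:E.
  by exists (fine D); rewrite fineK// ge0_fin_numE// (le_lt_trans DI)// ltry.
have W0 : (0 <= volume_loss)%E.
  apply: integral_ge0 => s _; apply: mule_ge0; last by rewrite le_max lexx.
  by apply: expe_ge0; exact: distribution_ge0.
have [Wy|Wy] := eqVneq volume_loss +oo%E.
  rewrite Wy DE -EFinM -EFinD addey// gt0_muley ?lte_fin// leey //.
have [w wE] : exists w, volume_loss = w%:E.
  by exists (fine volume_loss); rewrite fineK// ge0_fin_numE// ltey.
have TE := transport_energy mfc mg fc0 g0 If Ig meps metaL eps0 eta0 superlevel.
have := le_trans TE (leeD2l _ loss_le).
rewrite (height_moment mg g0 mass_g kinetic_g tilt_g).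
rewrite (height_moment mfc fc0 mass_f kinetic_f tilt_f).
rewrite -/D DE wE -EFinM -!EFinD tilted_f.
set TC := transport_cost _ _ _ _ _.
have T0 : (0 <= TC)%E.
  by apply: integral_ge0 => s _; apply: integral_ge0 => x _; rewrite lee_fin mulr_ge0.
move=> TH; have [t tE] : exists t, TC = t%:E.
  exists (fine TC); rewrite fineK// ge0_fin_numE// ltNge leye_eq.
  by apply/negP => /eqP TCE; move: TH; rewrite TCE.
have [n nE] : exists n, (\int[nu]_x (Num.max 0 (g x - fc x))%:E = n%:E)%E.
  have := transport_defect mfc mg fc0 g0 If meps metaL superlevel ltr01.
  rewrite -/TC tE mul1e => H; exists (fine (\int[nu]_x (Num.max 0 (g x - fc x))%:E)%E).
  rewrite fineK// ge0_fin_numE; last by apply: integral_ge0 => x _; rewrite lee_fin le_max lexx.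
  apply: le_lt_trans H _; rewrite mul1e; apply: le_lt_trans (leeD2l _ (shellH _ ltr01)) _.
  by rewrite -EFinD ltry.
have [l lE] : exists l, (\int[nu]_x (`|fc x - g x|)%:E = l%:E)%E.
  have := dist_le_defect mfc mg fc0 g0 If Ig; rewrite nE -/D DE -EFinM -EFinD => H.
  exists (fine (\int[nu]_x (`|fc x - g x|)%:E)%E).
  rewrite fineK// ge0_fin_numE; first exact: le_lt_trans H (ltry _).
  by apply: integral_ge0 => x _; rewrite lee_fin.
have Dr0 : 0 <= Dr by rewrite -lee_fin -DE.
have I1 : mass f <= mass f0 + Dr.
  by have := mass_le mfc mg fc0 g0 If Ig; rewrite mass_f mass_g -/D DE -EFinD lee_fin.
have I2 : mass f0 <= mass f + Dr.
  by have := mass_ge mfc mg fc0 g0 If Ig; rewrite mass_f mass_g -/D DE -EFinD lee_fin.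
set h := euclid (magnetization f) - m0.
have hd' : `|h| <= d := le_trans magnetization_gap hd.
rewrite lE -EFin_expe -EFinM lee_fin.
apply: (@combine_estimates _ K q m0 d _ h _ _ Dr w t n l) => //.
- by rewrite -lee_fin -wE.
- by rewrite -lee_fin -tE.
- by rewrite -lee_fin -nE; apply: integral_ge0 => x _; rewrite lee_fin le_max lexx.
- by rewrite -lee_fin -lE; apply: integral_ge0 => x _; rewrite lee_fin.
- by rewrite -lee_fin -DE.
- move: TH; rewrite tE -EFinD lee_fin energy_gap /h => TH.
  by apply: energy_balance TH; rewrite ?lerBlDl// ltW.
- move=> k k0; have := transport_defect mfc mg fc0 g0 If meps metaL superlevel k0.
  rewrite -/TC tE nE -EFinM => H; rewrite -lee_fin; apply: le_trans H _.
  rewrite EFinD leeD2l// expr2 -mulrA EFinM lee_wpmul2l ?lee_fin ?(ltW k0)//; exact: shellH.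
- rewrite -lee_fin EFinD EFinM -nE -DE -lE; exact: dist_le_defect.
have tl02 s : 0 <= tilt_level m0 hF s <= 2 by exact: tilt_level_itv.
have mtl : measurable_fun setT (tilt_level m0 hF) by exact: measurable_tilt_level.
have := transport_test mfc mg fc0 g0 If Ig meps metaL superlevel h mtilt_turn mtl
  (fun x => tilt_ge0 _) tl02.
rewrite tilt_f tilt_g /= !ltry => /(_ isT isT) H.
have := le_trans H (leeD2r _ (leeD2l _ (remH h hd'))).
rewrite -/TC tE -/D DE -EFinM -!EFinD lee_fin tilted_f => HH.
apply: tilt_balance HH => //.
by rewrite ler_norml lerBlDl I1 andbT lerNl opprB lerBlDl.
Qed.

Let f_core : {ae leb2, forall x, strip x -> f x = core f x}.
Proof.
have [N [mN N0 NS]] := Pf; exists N; split => // x /= Hx; apply: NS => /= fx; apply: Hx => xs.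
by rewrite /core patchE mem_set//; apply/esym/max_idPr; exact: fx.
Qed.

Lemma norm1_mass : norm1 (fun x => (f x)%:E) = (mass f)%:E.
Proof.
rewrite -mass_f integral_strip_measure//; last exact/measurable_EFinP.
rewrite /norm1; apply: ae_eq_integral.
- exact: measurable_strip.
- by apply: measurableT_comp => //; apply/measurable_EFinP; exact: measurable_on_strip.
- by apply: measurable_funTS; exact/measurable_EFinP.
have [N [mN N0 NS]] := f_core; exists N; split => // x /= Hx; apply: NS => /= fx; apply: Hx => xs.
by rewrite fx//= ger0_norm// fc0.
Qed.

Lemma norm1_perturbation :
  norm1 (fun x => (f x - f0c x)%:E) = (\int[nu]_x (`|fc x - g x|)%:E)%E.
Proof.
have md : measurable_fun setT (fun x => (`|fc x - g x|)%:E).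
  by apply/measurable_EFinP; apply: measurableT_comp => //; exact: measurable_funB.
rewrite integral_strip_measure//.
rewrite /norm1; apply: ae_eq_integral.
- exact: measurable_strip.
- apply: measurableT_comp => //; apply/measurable_EFinP; apply: measurable_funB.
    exact: measurable_on_strip.
  by rewrite (_ : f0c = g); [exact: measurable_funTS|exact/funext].
- exact: measurable_funTS.
have [N [mN N0 NS]] := f_core; exists N; split => // x /= Hx; apply: NS => /= fx; apply: Hx => xs.
by rewrite f0cE fx.
Qed.

Lemma tail_dist_le_norm1 :
  (tail_dist nu fc g <= norm1 (fun x => (rearr f x - rearr f0 x)%E))%E.
Proof.
have mc0 := measurable_core Lf0.
have If : (\int[nu]_x (core f x)%:E < +oo)%E by rewrite mass_f ltry.
have := tail_dist_le_rearr mfc mc0 If (core_mass_fin Lf0).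
apply: le_trans; rewrite le_eqVlt; apply/orP; left; apply/eqP; apply: eq_integral => s.
rewrite inE/= in_itv/= andbT => s0.
by rewrite tail_g ?(ltW s0)// (distribution_tail mc0 (ltW s0)).
Qed.

Lemma volume_loss_le_beta :
  (volume_loss <= \int[leb]_(s in `[0%R, +oo[%classic)
     (distribution_function f0 s ^+ 2 * beta (rearr f) (rearr f0) s))%E.
Proof.
have mc0 := measurable_core Lf0.
have If : (\int[nu]_x (core f x)%:E < +oo)%E by rewrite mass_f ltry.
rewrite /volume_loss [leLHS]integral_mkcond [leRHS]integral_mkcond.
have sq0 s : (0 <= distribution_function f0 s ^+ 2)%E.
  by apply: expe_ge0; exact: distribution_ge0.
apply: ge0_integral_mono => s _.
  by rewrite patchE; case: ifP => // _; apply: mule_ge0 => //; rewrite le_max lexx.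
rewrite !patchE; case: ifPn => [|_]; last first.
  by case: ifP => // _; apply: mule_ge0 => //; exact: measure_ge0.
rewrite inE/= in_itv/= andbT => s0; rewrite mem_set/=; last by rewrite in_itv/= andbT ltW.
apply: lee_wpmul2l; first exact: (sq0 s).
exact: (beta_ge mfc mc0 If (core_mass_fin Lf0) s0).
Qed.

Lemma volume_loss_le_dist (V : R) : 0 <= V ->
  (forall s, 0 <= s -> (distribution_function f0 s <= V%:E)%E) ->
  (volume_loss <= (V ^+ 2)%:E * tail_dist nu fc g)%E.
Proof.
move=> V0 HV.
have md : measurable_fun setT (fun s => `|tail nu fc s - tail nu g s|)%E.
  by apply: measurableT_comp => //; apply: emeasurable_funB; exact: measurable_tail.
rewrite /tail_dist -ge0_integralZl ?lee_fin ?sqr_ge0//; last exact: measurable_funTS.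
apply: ge0_integral_mono => s; rewrite /= in_itv/= andbT => s0.
  apply: mule_ge0; last by rewrite le_max lexx.
  by apply: mule_ge0; exact: distribution_ge0.
have D0 := distribution_ge0 f0 s; have DV := HV s (ltW s0).
apply: lee_pmul.
- exact: mule_ge0.
- by rewrite le_max lexx.
- by rewrite expr2 EFinM; exact: lee_pmul.
rewrite -(tail_g (ltW s0)) (distribution_tail mfc (ltW s0)).
have tf : tail nu fc s \is a fin_num.
  by rewrite ge0_fin_numE ?tail_ge0// tail_fin// mass_f ltry.
have tg : tail nu g s \is a fin_num.
  by rewrite ge0_fin_numE ?tail_ge0// tail_fin// mass_g ltry.
rewrite -abseN (_ : (- (tail nu fc s - tail nu g s) = tail nu g s - tail nu fc s)%E).
  by rewrite ge_max abse_ge0 lee_abs.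
by rewrite fin_num_oppeB// addeC.
Qed.

End perturbation.

End turned.

End steady.

(** * The stability theorem *)

(** The constant in front of the mass and of the rearrangements may be enlarged
    together with the overall constant, since the right-hand side, being at
    least a multiple of a square, is nonnegative. *)
Lemma enlarge_const (R : realType) (A c C H I : R) (L2 D X W Z : \bar R) :
  0 < A -> 0 <= c -> A <= C -> c <= C -> 1 <= C -> 0 <= I ->
  (0 <= L2)%E -> (0 <= D)%E -> (0 <= W)%E -> (D <= X)%E -> (W <= C%:E * Z)%E ->
  (L2 <= A%:E * (H%:E + (c * (1 + I))%:E * D + W))%E ->
  (L2 <= C%:E * (H%:E + C%:E * (1 + I%:E) * X + C%:E * Z))%E.
Proof.
move=> A0 c0 AC cC C1 I0 L0 D0 W0 DX WZ H0.
have C0 : 0 < C := lt_le_trans ltr01 C1.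
set Y := (H%:E + (c * (1 + I))%:E * D + W)%E in H0.
have Y0 : (0 <= Y)%E.
  by have := le_trans L0 H0; rewrite pmule_rge0.
apply: le_trans H0 _; apply: (@le_trans _ _ (C%:E * Y)%E).
  by apply: lee_wpmul2r; rewrite ?lee_fin.
apply: lee_wpmul2l; first by rewrite lee_fin ltW.
apply: leeD => //; apply: leeD2l; rewrite -EFinD -EFinM.
apply: lee_pmul => //; rewrite lee_fin; first by rewrite mulr_ge0// addr_ge0.
by rewrite ler_wpM2r// addr_ge0.
Qed.

Theorem theorem1p5 (R : realType) (F : R -> R) (m0 : R) (f0 : R * R -> R)
  (m0_gt0 : 0 < m0)
  (f0E : forall x : R * R, f0 x = F (e0 m0 x))
  (steady : forall theta : R, torus theta -> potential f0 theta = phi0 m0 theta)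
  (hA : assumptionA F m0 f0)
  (stable : (kappa0 F m0 < 1)%E) :
  exists delta C : R, [/\ 0 < delta, 0 < C &
    forall (f : R * R -> R) (thetaf : R),
      nonnegative f -> weightedL1 f ->
      torus thetaf ->
      magnetization f = (euclid (magnetization f) * cos thetaf,
                         euclid (magnetization f) * sin thetaf) ->
      euclid (magnetization f - magnetization (translate f0 thetaf)) < delta ->
      (norm1 (fun x => (f x - translate f0 thetaf x)%:E) ^+ 2
       <= C%:E *
          ((energy f - energy f0)%:E
           + C%:E * (1 + norm1 (fun x => (f x)%:E))
             * norm1 (fun x => rearr f x - rearr f0 x)
           + C%:E * \int[leb]_(s in `[0%R, +oo[%classic)
               ((s ^+ 2)%:E * maxe 0 (sharp f0 s - sharp f s))
           + C%:E * \int[leb]_(s in `[0%R, +oo[%classic)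
               (distribution_function f0 s ^+ 2
                * beta (rearr f) (rearr f0) s)))%E
      /\
      (compactly_supported f0 ->
       (norm1 (fun x => (f x - translate f0 thetaf x)%:E) ^+ 2
        <= C%:E *
           ((energy f - energy f0)%:E
            + C%:E * (1 + norm1 (fun x => (f x)%:E))
              * norm1 (fun x => rearr f x - rearr f0 x)))%E)].
Proof.
have [estar [hF Lf0 hlog]] := hA.
have m0e := cutoff_above hF m0_gt0 f0E steady.
have [K K0 shellH] := shell_bound hF m0_gt0 m0e hlog.
have [d [q [d0 q0 q1 remH]]] := remainder_bound hF m0_gt0 m0e hlog stable.
pose A := energy_const K q; pose c := mass_const m0 d (mass f0).
have A1 : 0 < A.
  rewrite /A /energy_const ltr_wpDl// !mulr_ge0//; first by lra.
  by rewrite addr_ge0// invr_ge0; lra.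
have If0 : 0 <= mass f0.
  by rewrite fine_ge0// integral_ge0// => x _; rewrite lee_fin core_ge0.
have c0 : 0 <= c by rewrite /c /mass_const !addr_ge0// mulr_ge0// ltW.
have [V V0 HV] : exists2 V : R, 0 <= V & compactly_supported f0 ->
    forall s, 0 <= s -> (distribution_function f0 s <= V%:E)%E.
  have [cs|ncs] := pselect (compactly_supported f0); last by exists 0.
  by have [V V0 HV] := compact_distribution hF f0E cs; exists V.
have V2 := sqr_ge0 V.
pose C := A + c + V ^+ 2 + 1.
have [AC cC C1] : [/\ A <= C, c <= C & 1 <= C] by rewrite /C; split; lra.
exists d, C; split => //; first by lra.
move=> f t Pf Lf tt Mf dM.
have I0 : 0 <= mass f.
  by rewrite fine_ge0// integral_ge0// => x _; rewrite lee_fin core_ge0.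
have est := stability_estimate m0_gt0 f0E Lf0 steady tt Pf Lf Mf K0 q0 q1 (ltW d0)
  (fun k => shellH t k tt) (fun u => remH t u tt) (ltW dM).
rewrite -(norm1_perturbation hF f0E t Pf Lf) -/A -/c in est.
have DX := tail_dist_le_norm1 hF f0E Lf0 tt Lf.
have WV := fun cs => volume_loss_le_dist hF f0E Lf0 tt Lf V0 (HV cs).
have WZ := volume_loss_le_beta Lf0 Lf.
rewrite (norm1_mass Pf Lf).
move: est DX WV WZ; set L := norm1 _; set D := tail_dist _ _ _; set X := norm1 _.
set Z := (\int[_]_(s in _) (_ * beta _ _ _))%E.
set Y := (\int[_]_(s in _) (_ * maxe _ _))%E; set W := volume_loss _ _.
move=> est DX WV WZ.
have C0 : 0 < C by lra.
have L0 : (0 <= L)%E by apply: integral_ge0 => x _; exact: abse_ge0.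
have L20 : (0 <= L ^+ 2)%E by exact: expe_ge0.
have D0 : (0 <= D)%E by apply: integral_ge0 => s _; exact: abse_ge0.
have sq0 s : (0 <= distribution_function f0 s ^+ 2)%E.
  by apply: expe_ge0; exact: measure_ge0.
have W0 : (0 <= W)%E.
  by apply: integral_ge0 => s _; apply: mule_ge0 => //; rewrite le_max lexx.
have Z0 : (0 <= Z)%E.
  by apply: integral_ge0 => s _; apply: mule_ge0 => //; exact: measure_ge0.
have Y0 : (0 <= Y)%E.
  apply: integral_ge0 => s _; apply: mule_ge0; first by rewrite lee_fin sqr_ge0.
  by rewrite le_max lexx.
split.
  have WZ' : (W <= C%:E * Z)%E.
    by apply: le_trans WZ _; rewrite -[leLHS]mul1e; apply: lee_wpmul2r => //; rewrite lee_fin.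
  apply: le_trans (enlarge_const A1 c0 AC cC C1 I0 L20 D0 W0 DX WZ' est) _.
  apply: lee_wpmul2l; first by rewrite lee_fin ltW.
  by apply: leeD2r; rewrite leeDl// mule_ge0// lee_fin ltW.
move=> /WV {}WV.
have cV0 : 0 <= c + V ^+ 2 by rewrite addr_ge0.
have cVC : c + V ^+ 2 <= C by rewrite /C; lra.
have Z' : (0 <= C%:E * 0)%E by rewrite mule0.
rewrite -[X in (_ <= C%:E * X)%E]adde0 -[X in (_ <= C%:E * (_ + X))%E](mule0 C%:E).
apply: (enlarge_const A1 cV0 AC cVC C1 I0 L20 D0 (lexx 0%E) DX Z').
apply: le_trans est _; apply: lee_wpmul2l; first by rewrite lee_fin ltW.
rewrite adde0 -addeA; apply: leeD2l.
have I1 : 0 <= 1 + mass f by rewrite addr_ge0.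
have -> : (((c + V ^+ 2) * (1 + mass f))%:E * D =
    (c * (1 + mass f))%:E * D + (V ^+ 2 * (1 + mass f))%:E * D)%E.
  by rewrite mulrDl EFinD ge0_muleDl// lee_fin mulr_ge0.
apply: leeD2l.
apply: le_trans WV _; apply: lee_wpmul2r => //; rewrite lee_fin.
by rewrite ler_peMr// lerDl.
Qed.
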